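(* Let $X$ be a Banach space, $1<p<\infty$, let $n,N\ge 1$ be integers, and let $\beta,\alpha^1,\dots,\alpha^N\in\mathbb{N}^n$ be multi-indices with $|\alpha^j|=|\beta|$ for all $j=1,\dots,N$. Suppose that there exists a set $F\subset\{1,\dots,n\}$ such that the numbers $\sum_{\ell\in F}\alpha^j_\ell$, $j=1,\dots,N$, all have the same parity (all even or all odd), and this parity is different from the parity of $\sum_{\ell\in F}\beta_\ell$. If $K<\infty$ is a constant such that $$\|\partial^\beta u\|_{L^p(\mathbb{R}^n,X)}\le K\sum_{j=1}^N\|\partial^{\alpha^j}u\|_{L^p(\mathbb{R}^n,X)}\qquad\text{for all } u\in C_c^\infty(\mathbb{R}^n,X),$$ then $X$ is a UMD space and $\beta_p(X)\le KN$.
   Context: $\mathbb{N}=\{0,1,2,\dots\}$. For a multi-index $\beta=(\beta_1,\dots,\beta_n)\in\mathbb{N}^n$, $|\beta|=\beta_1+\dots+\beta_n$ and $\partial^\beta=\partial_1^{\beta_1}\cdots\partial_n^{\beta_n}$. $C_c^\infty(\mathbb{R}^n,X)$ is the space of smooth compactly supported $X$-valued functions, and $L^p(\cdot,X)$ is the Bochner $L^p$ space. UMD property: a Banach space $X$ is UMD if for some (equivalently, for all) $1<p<\infty$ there is a constant $C_p<\infty$ such that $$\Big\|\sum_{\ell=1}^r\sigma_\ell d_\ell\Big\|_{L^p(\Omega,X)}\le C_p\Big\|\sum_{\ell=1}^r d_\ell\Big\|_{L^p(\Omega,X)}$$ for all $r\ge1$, all signs $\sigma_\ell\in\{-1,1\}$,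 all probability spaces $\Omega$ and all martingale difference sequences $(d_\ell)$ in $L^p(\Omega,X)$. For given $p$, $\beta_p(X)$ denotes the smallest admissible constant $C_p$ (the UMD constant; $\beta_p(X)=\infty$ if $X$ is not UMD). The number $\beta_p(X)$ is unrelated to the multi-index $\beta$. *)

(* Defs.v *)
From HB Require Import structures.
From mathcomp Require Import all_boot all_order all_algebra.
From mathcomp Require Import all_classical all_reals all_analysis.
Set Implicit Arguments.
Unset Strict Implicit.
Unset Printing Implicit Defensive.
Import Order.TTheory GRing.Theory Num.Theory.
Import numFieldNormedType.Exports.

Local Open Scope classical_set_scope.
Local Open Scope ring_scope.

Definition cons_pair {T : Type} {n : nat} (x : T * n.-tuple T) : n.+1.-tuple T :=
  [tuple of x.1 :: x.2].

Lemma measurable_cons_pair d (T : measurableType d) n :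
  measurable_fun [set: T * n.-tuple T] (@cons_pair T n).
Proof. exact: measurable_cons. Qed.

Section tuple_cons_measure.
Context d (T : measurableType d) (R : realType) (n : nat).
Context (m1 : {sigma_finite_measure set T -> \bar R}).
Context (m2 : {sigma_finite_measure set (n.-tuple T) -> \bar R}).

Definition tuple_cons_measure : set (n.+1.-tuple T) -> \bar R :=
  pushforward (m1 \x m2)%E (@cons_pair T n).

Let tuple_cons_measure0 : tuple_cons_measure set0 = 0%E.
Proof. by rewrite /tuple_cons_measure /pushforward preimage_set0 measure0. Qed.

Let tuple_cons_measure_ge0 A : (0 <= tuple_cons_measure A)%E.
Proof. by rewrite /tuple_cons_measure /pushforward; exact: measure_ge0. Qed.

Let tuple_cons_measure_sigma_additive : semi_sigma_additive tuple_cons_measure.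
Proof.
have mP A : measurable A -> measurable (@cons_pair T n @^-1` A).
  by move=> mA; rewrite -[X in measurable X]setTI; exact: measurable_cons_pair.
move=> F mF tF mUF; rewrite /tuple_cons_measure /pushforward preimage_bigcup.
apply: measure_semi_sigma_additive.
- by move=> k; exact: mP.
- apply/trivIsetP => /= i j _ _ ij; rewrite -preimage_setI.
  by move/trivIsetP : tF => /(_ _ _ _ _ ij) ->//; rewrite preimage_set0.
- by rewrite -preimage_bigcup; exact: mP.
Qed.

HB.instance Definition _ := isMeasure.Build _ _ _ tuple_cons_measure
  tuple_cons_measure0 tuple_cons_measure_ge0 tuple_cons_measure_sigma_additive.

Let tuple_cons_measure_sigma_finite : sigma_finite setT tuple_cons_measure.
Proof.
have /sigma_finiteP[F [TF ndF Foo]] := sigma_finiteT m1.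
have /sigma_finiteP[G [TG ndG Goo]] := sigma_finiteT m2.
pose g (t : n.+1.-tuple T) : T * n.-tuple T := (thead t, [tuple of behead t]).
have mg : measurable_fun setT g.
  apply/measurable_fun_pair; first exact: measurable_tnth.
  exact: measurable_behead.
exists (fun k => g @^-1` (F k `*` G k)).
  apply/esym; rewrite -subTset => t _.
  have [i _ Fi] : (\bigcup_k F k) (thead t) by rewrite -TF.
  have [j _ Gj] : (\bigcup_k G k) [tuple of behead t] by rewrite -TG.
  exists (maxn i j) => //; split => /=.
    by move: Fi; exact/subsetPset/ndF/leq_maxl.
  by move: Gj; exact/subsetPset/ndG/leq_maxr.
move=> k; have [mF Fk] := Foo k; have [mG Gk] := Goo k; split.
  by rewrite -[X in measurable X]setTI; apply: mg => //; exact: measurableX.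
rewrite /= /tuple_cons_measure /pushforward -comp_preimage.
rewrite (_ : g \o _ = id); last first.
  by apply/funext => -[a t]; rewrite /g /=; congr pair; exact/val_inj.
by rewrite product_measure1E// lte_mul_pinfty// ge0_fin_numE.
Qed.

HB.instance Definition _ := Measure_isSigmaFinite.Build _ _ _
  tuple_cons_measure tuple_cons_measure_sigma_finite.

End tuple_cons_measure.

Fixpoint lebesgue_tuple (R : realType) (n : nat) :
    {sigma_finite_measure set (n.-tuple (measurableTypeR R)) -> \bar R} :=
  if n is n'.+1 then tuple_cons_measure (@lebesgue_measure R) (lebesgue_tuple R n')
  else \d_[tuple].

Section Lp_norm.
Context {R : realType} {X : normedModType R}.

Definition LpX_norm d (T : measurableType d) (mu : {measure set T -> \bar R})
    (p : R) (f : T -> X) : \bar R :=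
  Lnorm mu p%:E (fun x => `|f x|%:E).

(* The library has no measurable structure on 'rV[R]_n: functions on R^n are
   integrated after reading a tuple of coordinates as a row vector. *)
Definition LpRn_norm n (p : R) (u : 'rV[R]_n -> X) : \bar R :=
  LpX_norm (lebesgue_tuple R n) p (fun t : n.-tuple R => u (\row_i tnth t i)).

End Lp_norm.

Section multi_index.
Context {R : realType} {X : normedModType R} {n : nat}.
Implicit Types (u : 'rV[R]_n -> X) (b : 'I_n -> nat).

Definition partial (i : 'I_n) u : 'rV[R]_n -> X := 'D_(delta_mx 0 i) u.

Definition partials (s : seq 'I_n) u : 'rV[R]_n -> X := foldr partial u s.

Definition mdeg b : nat := (\sum_(i < n) b i)%N.

(* partial_0^(b 0) (partial_1^(b 1) (... u)) *)
Definition mpartial b u : 'rV[R]_n -> X :=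
  foldr (fun i => iter (b i) (partial i)) u (enum 'I_n).

Definition smooth u : Prop := forall s : seq 'I_n,
  continuous (partials s u) /\
  forall i x, derivable (partials s u) x (delta_mx 0 i).

Definition smooth_compact_support u : Prop :=
  smooth u /\ compact (closure [set x | u x != 0]).

End multi_index.

Section Bochner.
Context {R : realType} {X : normedModType R} d (T : measurableType d).
Implicit Types (P : probability T R) (G : set_system T) (f g s : T -> X).

Definition simple_function G s : Prop :=
  finite_set (range s) /\ forall y, G (s @^-1` [set y]).

(* Functions, not classes modulo null sets: every class in L^p has a
   representative of this form. *)
Definition strongly_measurable G f : Prop :=
  exists s : nat -> T -> X, (forall k, simple_function G (s k)) /\
    forall x, s k x @[k --> \oo] --> f x.

Definition simple_integral P s : X :=
  \sum_(y \in range s) fine (P (s @^-1` [set y])) *: y.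

Definition is_Bochner_integral P f (v : X) : Prop :=
  strongly_measurable measurable f /\
  exists s : nat -> T -> X, [/\ forall k, simple_function measurable (s k),
    (\int[P]_x (`|f x - s k x|)%:E)%E @[k --> \oo] --> 0%E &
    simple_integral P (s k) @[k --> \oo] --> v].

Definition is_Bochner_integral_on P (A : set T) f (v : X) : Prop :=
  is_Bochner_integral P (fun x => \1_A x *: f x) v.

Definition is_conditional_expectation P G f g : Prop :=
  strongly_measurable G g /\
  forall A, G A -> exists v,
    is_Bochner_integral_on P A f v /\ is_Bochner_integral_on P A g v.

Definition in_Lp P (p : R) f : Prop :=
  strongly_measurable measurable f /\ (LpX_norm P p f < +oo)%E.

Definition filtration (F : nat -> set_system T) : Prop :=
  forall l, [/\ sigma_algebra setT (F l), F l `<=` measurable & F l `<=` F l.+1].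

(* [D i] is the increment between times i and i + 1. *)
Definition martingale_difference P (p : R) r (D : 'I_r -> T -> X) : Prop :=
  exists F : nat -> set_system T, filtration F /\
    forall i : 'I_r, [/\ in_Lp P p (D i), strongly_measurable (F i.+1) (D i) &
      is_conditional_expectation P (F i) (D i) (cst 0)].

End Bochner.

Section UMD.
Context {R : realType}.

Definition UMD_bound (p : R) (X : completeNormedModType R) (C : R) : Prop :=
  forall d (T : measurableType d) (P : probability T R) (r : nat)
      (sigma : 'I_r -> R) (D : 'I_r -> T -> X),
    (0 < r)%N -> (forall i, sigma i = 1 \/ sigma i = -1) ->
    martingale_difference P p D ->
    (LpX_norm P p (fun x => (\sum_(i < r) sigma i *: D i x)%R)
      <= C%:E * LpX_norm P p (fun x => (\sum_(i < r) D i x)%R))%E.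

Definition is_UMD (X : completeNormedModType R) : Prop :=
  exists p : R, 1 < p /\ exists C : R, UMD_bound p X C.

(* +oo when no constant is admissible. For X = 0 every real is admissible and
   the value is -oo; for all other X admissible constants are at least 1. *)
Definition UMD_constant (p : R) (X : completeNormedModType R) : \bar R :=
  ereal_inf [set C%:E | C in [set C : R | UMD_bound p X C]].

End UMD.

(* Main.v *)
Require Import Defs.
From mathcomp Require Import all_boot all_order all_algebra.
From mathcomp Require Import all_classical all_reals all_analysis.
From mathcomp Require Import measurable_realfun finmap ring lra.
Set Implicit Arguments.
Unset Strict Implicit.
Unset Printing Implicit Defensive.
Import Order.TTheory GRing.Theory Num.Theory.
Import numFieldNormedType.Exports.
Local Open Scope classical_set_scope.
Local Open Scope ring_scope.

(* Derivatives of rapidly oscillating waves cos(M xi . x), where xi is (1, ..., 1)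
   or its reflection in the coordinates of F: up to a sign common to all j, the
   leading part of the derivative of order alpha^j is the same for both kinds of
   waves, while that of order beta changes its sign with the kind. Waves of
   increasing frequencies, multiplied by near-indicators of zero mean around their
   average, therefore realize a zigzag martingale: a finite binary tree of
   increments whose sum is seen by the alpha^j, and whose sum with a sign chosen at
   each node is seen by beta. The Riemann-Lebesgue lemma makes the oscillations
   asymptotically independent, so the hypothesis bounds the p-th moment of the
   signed sum by (K N)^p times that of the plain sum. The near-indicators are
   trigonometric polynomials, by Fejer's kernel, so that antiderivatives of all
   orders are explicit and bounded.
   Conversely, a martingale difference sequence is approximated in L^p by simple
   functions, and a transition into finitely many values is split into a
   succession of binary ones with the same sign; the sums with and without signs
   are then, up to small errors, the two coordinates of a zigzag tree.
   If K < 0, the bound also holds with K = 0, which forces X = 0. *)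

(** The obstacle is that a smooth weight cannot be a nontrivial indicator. For the plain sum this is
    harmless: convexity of the p-th power bounds the norm of a smooth mixture of leaf values by
    their p-th moment. For the signed sum a bound from below is needed, which holds only up to a
    multiple of the defect, the sum of the integrals of [w * (1 - w)] over the leaf weights [w]; the
    defect is therefore controlled throughout the construction. The p-th power of the cutoff acts,
    up to normalization, as the density of the probability space on which the tree is realized, so
    the cutoff is chosen with a smooth p-th power. An increment is a wave integrated as often as it
    will be differentiated and divided by the corresponding power of its frequency: among the
    Leibniz terms only the one with all derivatives on the wave survives at high frequency. All
    derivatives of order alpha^j are then close to one and the same function, so the sum of their
    norms is about the number of the alpha^j times a single norm. This is the origin of the factor
    [N] in the constant. *)

Section trigonometric_polynomials.
Context {R : realType}.
Implicit Types (l : seq (R * R * R)) (t : R).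

(* A term (a, w, f) stands for the wave a cos(w t + f). *)
Definition trig l t : R := \sum_(x <- l) x.1.1 * cos (x.1.2 * t + x.2).

(** A phase shift by a quarter period turns the cosine into minus the sine, so derivatives and
    antiderivatives of waves remain cosine waves. Integration divides by the frequency, whence the
    condition [zero_mean] in [trig_intK]. *)
Definition trig_der l := [seq (x.1.1 * x.1.2, x.1.2, x.2 + pi / 2) | x <- l].
Definition trig_int l := [seq (x.1.1 / x.1.2, x.1.2, x.2 - pi / 2) | x <- l].
Definition trig_bound l : R := \sum_(x <- l) `|x.1.1|.
Definition zero_mean l := all (fun x : R * R * R => x.1.2 != 0) l.

Lemma trig_cons x l t : trig (x :: l) t = x.1.1 * cos (x.1.2 * t + x.2) + trig l t.
Proof. by rewrite /trig big_cons. Qed.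

Lemma trig_cat l1 l2 t : trig (l1 ++ l2) t = trig l1 t + trig l2 t.
Proof. by rewrite /trig big_cat. Qed.

Lemma is_derive_wave (w f t : R) :
  is_derive t 1 (fun s => cos (w * s + f)) (- (w * sin (w * t + f))).
Proof.
have -> : (fun s => cos (w * s + f)) = cos \o (fun s : R => w *: s + f) by [].
have d : is_derive t 1 (fun s : R => w *: s + f) w.
  have := is_deriveD (is_deriveZ w (is_derive_id t (1 : R))) (is_derive_cst f t 1).
  by rewrite addr0 [_ *: 1]mulr1.
have := @is_derive1_comp _ cos (fun s : R => w *: s + f) t _ _ (is_derive_cos _) d.
by rewrite mulNr mulrC.
Qed.

Lemma is_derive_trig l t : is_derive t 1 (trig l) (trig (trig_der l) t).
Proof.
elim: l => [|x l ih].
  have -> : trig [::] = cst 0 by apply/funext => s; rewrite /trig big_nil.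
  exact: is_derive_cst.
have -> : trig (x :: l) =
    (x.1.1 \*: ((fun s => cos (x.1.2 * s + x.2)) : R -> R)) + trig l.
  by apply/funext => s; rewrite trig_cons.
rewrite trig_cons; apply: is_deriveD => /=.
have := is_deriveZ x.1.1 (is_derive_wave x.1.2 x.2 t).
by rewrite addrA cosDpihalf [_ *: _]mulrN mulrA mulrN.
Qed.

Lemma trig_intK l : zero_mean l -> trig_der (trig_int l) = l.
Proof.
elim: l => //= -[[a w] f] l ih /andP[/= w0 zl]; rewrite ih//.
by rewrite -mulrA mulVf// mulr1 subrK.
Qed.

Lemma zero_mean_int l : zero_mean (trig_int l) = zero_mean l.
Proof. by rewrite /zero_mean /trig_int all_map. Qed.

Lemma trig_le_bound l t : `|trig l t| <= trig_bound l.
Proof.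
apply: (le_trans (ler_norm_sum _ _ _)); apply: ler_sum => x _.
by rewrite normrM ler_piMr// cos_max.
Qed.

Lemma trig_bound_ge0 l : 0 <= trig_bound l.
Proof. by apply: sumr_ge0 => x _. Qed.

End trigonometric_polynomials.

(** * Fejer's kernel and almost-indicators among trigonometric polynomials *)

Section Fejer.
Context {R : realType}.
Implicit Types (k : nat) (t : R).

(** Off-diagonal terms of the squared modulus of the sum of [exp(i j t)] over [j < k], divided by
    [k]. The diagonal contributes the constant 1, so [1 + trig (Fejer_list k)] is the Fejer
    kernel. *)
Definition Fejer_list k : seq (R * R * R) :=
  [seq (k%:R^-1, i%:R - j%:R, 0) | i <- iota 0 k, j <- [seq j <- iota 0 k | j != i]].

Lemma Fejer_zero_mean k : zero_mean (Fejer_list k).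
Proof.
apply/allP => x /allpairsPdep[i [j [_]]]; rewrite mem_filter => /andP[ij _] -> /=.
by rewrite subr_eq0 eqr_nat eq_sym.
Qed.

Let C k t : R := \sum_(i <- iota 0 k) cos (i%:R * t).
Let S k t : R := \sum_(i <- iota 0 k) sin (i%:R * t).

Lemma FejerE k t : (0 < k)%N ->
  k%:R * (1 + trig (Fejer_list k) t) = C k t ^+ 2 + S k t ^+ 2.
Proof.
move=> k0; have kn0 : k%:R != 0 :> R by rewrite pnatr_eq0 -lt0n.
have -> : C k t ^+ 2 + S k t ^+ 2 =
   \sum_(i <- iota 0 k) \sum_(j <- iota 0 k) cos ((i%:R - j%:R) * t).
  rewrite !expr2 /C /S !big_distrl/= -big_split/=; apply: eq_bigr => i _.
  rewrite !big_distrr/= -big_split/=; apply: eq_bigr => j _.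
  by rewrite mulrBl cosB.
rewrite /trig /Fejer_list big_allpairs_dep/= mulrDr mulr1.
have {1}-> : k%:R = \sum_(i <- iota 0 k) 1 :> R.
  by rewrite big_const_seq count_predT size_iota iter_addr_0.
rewrite big_distrr -big_split/= big_seq [RHS]big_seq; apply: eq_bigr => i ik.
rewrite [RHS](bigD1_seq i)//= ?iota_uniq// subrr mul0r cos0; congr +%R.
rewrite big_filter big_distrr/=; apply: eq_bigr => j _.
by rewrite addr0 mulrA mulfV// mul1r.
Qed.

Lemma Fejer_ge0 k t : (0 < k)%N -> 0 <= 1 + trig (Fejer_list k) t.
Proof.
move=> k0; rewrite -(@pmulr_rge0 _ k%:R) ?ltr0n// FejerE//.
by rewrite addr_ge0 ?sqr_ge0.
Qed.

Lemma Fejer0 k : (0 < k)%N -> 1 + trig (Fejer_list k) 0 = k%:R :> R.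
Proof.
move=> k0; have kn0 : k%:R != 0 :> R by rewrite pnatr_eq0 -lt0n.
apply: (mulfI kn0); rewrite FejerE// /C /S.
under eq_bigr do rewrite mulr0 cos0; under [in X in _ + X]eq_bigr do rewrite mulr0 sin0.
rewrite big_const_seq count_predT size_iota iter_addr_0.
by rewrite big1// expr0n addr0 expr2.
Qed.

(** The geometric sum of the [exp(i j t)] has modulus at most 2 over that of [1 - exp(i t)], whose
    square is [2 * (1 - cos t)]. Multiplying [C] and [S] by [2 * sin (t / 2)] makes both sums
    telescope and avoids complex numbers. *)
Lemma Fejer_decay k t : (0 < k)%N ->
  k%:R * (1 + trig (Fejer_list k) t) * (1 - cos t) <= 2.
Proof.
move=> k0; rewrite FejerE//.
have hc : cos t = 1 - 2 * sin (t / 2) ^+ 2.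
  have -> : cos t = cos ((t / 2) *+ 2) by congr cos; lra.
  by rewrite cos_mulr2n sin2cos2; lra.
have tele f (m : nat) : \sum_(i <- iota 0 m) (f i.+1 - f i) = f m - f 0%N :> R.
  elim: m => [|m ih]; first by rewrite big_nil subrr.
  by rewrite -addn1 iotaD big_cat/= ih big_seq1 add0n addn1; lra.
have hC : 2 * sin (t / 2) * C k t = sin ((k%:R - 1 / 2) * t) + sin (t / 2).
  rewrite -[RHS]opprK opprD -[X in - (_ + X)]sinN.
  have -> : - sin ((k%:R - 1 / 2) * t) + sin (- (t / 2)) =
     - (sin ((k%:R - 1 / 2) * t) - sin ((0%:R - 1/2) * t)).
    by rewrite opprB addrC; congr (sin _ + _); rewrite /=; lra.
  rewrite opprK -(tele (fun k => sin ((k%:R - 1 / 2) * t))) /C big_distrr/=.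
  apply: eq_bigr => i _.
  have -> : (i.+1%:R - 1 / 2) * t = i%:R * t + t / 2 by rewrite -natr1; lra.
  have -> : (i%:R - 1 / 2) * t = i%:R * t - t / 2 by lra.
  by rewrite sinD sinB; lra.
have hS : 2 * sin (t / 2) * S k t = cos (t / 2) - cos ((k%:R - 1 / 2) * t).
  have -> : cos (t / 2) - cos ((k%:R - 1 / 2) * t) =
     (- cos ((k%:R - 1 / 2) * t)) - (- cos ((0%:R - 1/2) * t)).
    rewrite opprK addrC; congr (_ + _); rewrite -cosN; congr cos; rewrite /=; lra.
  rewrite -(tele (fun k => - cos ((k%:R - 1 / 2) * t))) /S big_distrr/=.
  apply: eq_bigr => i _.
  have -> : (i.+1%:R - 1 / 2) * t = i%:R * t + t / 2 by rewrite -natr1; lra.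
  have -> : (i%:R - 1 / 2) * t = i%:R * t - t / 2 by lra.
  by rewrite cosD cosB; lra.
rewrite hc.
have -> : (C k t ^+ 2 + S k t ^+ 2) * (1 - (1 - 2 * sin (t / 2) ^+ 2)) =
  ((2 * sin (t / 2) * C k t) ^+ 2 + (2 * sin (t / 2) * S k t) ^+ 2) / 2.
  by rewrite !exprMn; lra.
rewrite hC hS ler_pdivrMr//.
(* The two squares add up to [2 - 2 * cos (a + b)], which is at most 4. *)
set a := (k%:R - 1 / 2) * t; set b := t / 2.
have := cos2Dsin2 a; have := cos2Dsin2 b; have := cos_geN1 (a + b).
rewrite cosD => h1 h2 h3.
nra.
Qed.

End Fejer.

Section near_indicator.
Context {R : realType}.
Implicit Types (l : seq (R * R * R)) (t : R).

Definition trig_scale (c : R) l := [seq (c * x.1.1, x.1.2, x.2) | x <- l].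
Definition trig_shift (s : R) l := [seq (x.1.1, x.1.2, x.1.2 * s + x.2) | x <- l].

Lemma trig_scaleE c l t : trig (trig_scale c l) t = c * trig l t.
Proof.
by rewrite /trig big_map big_distrr/=; apply: eq_bigr => x _; rewrite mulrA.
Qed.

Lemma trig_shiftE s l t : trig (trig_shift s l) t = trig l (t + s).
Proof.
by rewrite /trig big_map; apply: eq_bigr => x _ /=; rewrite mulrDr addrA.
Qed.

Lemma zero_mean_scale c l : zero_mean (trig_scale c l) = zero_mean l.
Proof. by rewrite /zero_mean all_map. Qed.

Lemma zero_mean_shift s l : zero_mean (trig_shift s l) = zero_mean l.
Proof. by rewrite /zero_mean all_map. Qed.

Lemma zero_mean_cat l1 l2 : zero_mean (l1 ++ l2) = zero_mean l1 && zero_mean l2.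
Proof. exact: all_cat. Qed.

Lemma continuous_trig l : continuous (trig l).
Proof.
move=> t; apply: differentiable_continuous; apply/derivable1_diffP.
exact: (@ex_derive _ _ _ _ _ _ _ (is_derive_trig l t)).
Qed.

Definition integral_frequencies l :=
  forall x, x \in l -> exists i j : nat, x.1.2 = i%:R - j%:R.

Lemma trig_periodic l t : integral_frequencies l -> trig l (t + pi *+ 2) = trig l t.
Proof.
move=> il; rewrite /trig big_seq [RHS]big_seq; apply: eq_bigr => x /il[i [j ->]].
congr (_ * _); rewrite -[RHS](periodicn (@cosD2pi R) i).
rewrite -[LHS](periodicn (@cosD2pi R) j); congr cos.
by rewrite -[pi *+ 2 *+ j]mulr_natr -[pi *+ 2 *+ i]mulr_natr; ring.
Qed.

Lemma Fejer_frequencies k : integral_frequencies (@Fejer_list R k).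
Proof. by move=> x /allpairsPdep[i [j [_ _ ->]]] /=; exists i, j. Qed.

Lemma trig_int_frequencies l : integral_frequencies l ->
  integral_frequencies (trig_int l).
Proof. by move=> il x /mapP[y /il + ->]. Qed.

Lemma ind_period (P : R -> Prop) : (forall t, P t <-> P (t + pi *+ 2)) ->
  (forall t, 0 <= t < pi *+ 2 -> P t) -> forall t, P t.
Proof.
move=> PP P0 t; have pi0 := @pi_gt0 R.
have p2 : 0 < pi *+ 2 :> R by rewrite mulr2n; lra.
have Pn (n : nat) s : P s <-> P (s + pi *+ 2 * n%:R).
  elim: n => [|n ih]; first by rewrite mulr0 addr0.
  by rewrite -natr1 mulrDr mulr1 addrA -PP.
have /andP[z1 z2] := floor_itv (t / (pi *+ 2)).
set z := Num.floor _ in z1 z2.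
rewrite ler_pdivlMr// in z1; rewrite ltr_pdivrMr// intrD mulrDl mul1r in z2.
have : P (t - z%:~R * (pi *+ 2)) by apply: P0; rewrite subr_ge0 z1/=; lra.
case: (z) => n.
  by rewrite (Pn n) -pmulrn (mulrC n%:R) subrK.
rewrite NegzE mulrNz mulNr opprK -pmulrn (mulrC n.+1%:R) => H.
exact/(Pn n.+1).
Qed.

(** Antiderivative of the Fejer kernel: increasing, almost flat away from the multiples of [2 pi],
    and rising by [2 pi] over each period. *)
Definition staircase k t : R := t + trig (trig_int (Fejer_list k)) t.

Lemma is_derive_staircase k t :
  is_derive t 1 (staircase k) (1 + trig (Fejer_list k) t).
Proof.
have -> : staircase k = (id : R -> R) + trig (trig_int (Fejer_list k)) by [].
apply: is_deriveD; rewrite -[in X in is_derive _ _ _ X](trig_intK (Fejer_zero_mean k)).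
exact: is_derive_trig.
Qed.

Lemma staircase_MVT k a b : a <= b -> exists2 c, c \in `[a, b]%R &
  staircase k b - staircase k a = (1 + trig (Fejer_list k) c) * (b - a).
Proof.
move=> ab; apply: MVT_segment => // [x _|]; first exact: is_derive_staircase.
apply: continuous_subspaceT => x; apply: differentiable_continuous.
by apply/derivable1_diffP; exact: (@ex_derive _ _ _ _ _ _ _ (is_derive_staircase k x)).
Qed.

Lemma staircase_le k a b : (0 < k)%N -> a <= b -> staircase k a <= staircase k b.
Proof.
move=> k0 ab; have [c _ E] := staircase_MVT k ab.
by rewrite -subr_ge0 E mulr_ge0 ?subr_ge0// Fejer_ge0.
Qed.

Lemma staircaseD2pi k t : staircase k (t + pi *+ 2) = staircase k t + pi *+ 2.
Proof.
have il := trig_int_frequencies (@Fejer_frequencies k).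
by rewrite /staircase (trig_periodic _ il) addrAC.
Qed.

Lemma cos_le_away (d t : R) : 0 < d -> d <= pi -> d <= t -> t <= pi *+ 2 - d ->
  cos t <= cos d.
Proof.
move=> d0 dpi dt td.
have [tp|tp] := leP t pi.
  by rewrite leNgt ltr_cos ?in_itv/= -?leNgt//; apply/andP; split; lra.
have -> : cos t = cos (pi *+ 2 - t) by rewrite -cosN -cosD2pi addrC.
rewrite mulr2n in td *.
by rewrite leNgt ltr_cos ?in_itv/= -?leNgt//; lra.
Qed.

(** Mean value theorem: at distance at least [d] from the multiples of [2 pi] the slope is at most
    [2 / (k * (1 - cos d))], and the interval is shorter than [2 pi]. *)
Lemma staircase_flat k (d a b : R) : (0 < k)%N -> 0 < d -> d < pi ->
  d <= a -> a <= b -> b <= pi *+ 2 - d ->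
  staircase k b - staircase k a <= 4 * pi / (k%:R * (1 - cos d)).
Proof.
move=> k0 d0 dpi da ab bd; have pi0 := @pi_gt0 R.
have [c] := staircase_MVT k ab; rewrite in_itv/= => /andP[ac cb] ->.
have cd : cos d < 1 by rewrite -cos0 ltr_cos// in_itv/=; lra.
have kp : 0 < k%:R :> R by rewrite ltr0n.
have cc : cos c <= cos d by apply: cos_le_away => //; lra.
have F0 := Fejer_ge0 c k0.
have Fd := Fejer_decay c k0.
rewrite ler_pdivlMr ?mulr_gt0 ?subr_gt0//.
rewrite mulr2n in bd.
set f := 1 + _ in F0 Fd *.
have h1 : k%:R * f * (1 - cos d) <= 2.
  apply: le_trans Fd; apply: ler_wpM2l; last lra.
  by rewrite mulr_ge0// ltW.
have -> : f * (b - a) * (k%:R * (1 - cos d)) = (k%:R * f * (1 - cos d)) * (b - a) by ring.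
have : 0 <= k%:R * f * (1 - cos d) by rewrite !mulr_ge0// ?ltW// subr_gt0.
nra.
Qed.

(* Step function of one period, smoothed: the difference quotient of the
   staircase is close to 1 when a jump lies between [t] and [t + 2 pi lam]. *)
Lemma near_indicator (lam e : R) : 0 <= lam <= 1 -> 0 < e ->
  exists l l' : seq (R * R * R), [/\ zero_mean l, zero_mean l',
    forall t, 0 <= lam + trig l t <= 1 &
    forall t, (lam + trig l t) * (1 - (lam + trig l t)) <= e + trig l' t].
Proof.
move=> /andP[lam0 lam1] e0; have pi0 := @pi_gt0 R.
have p2E : pi *+ 2 = pi + pi :> R by rewrite mulr2n.
have [q q0 qe] : exists2 q : nat, (0 < q)%N & 4 / q%:R < e / 2.
  have h0 : 0 < 8 / e by rewrite divr_gt0.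
  have := archi_boundP (ltW h0); set q := Num.bound _ => qe.
  have q0 : (0 < q)%N by rewrite -(ltr0n R); exact: lt_trans qe.
  exists q => //; rewrite ltr_pdivrMr ?ltr0n//.
  by rewrite ltr_pdivrMr// in qe; lra.
(* [b] will dominate the error near the jumps: it equals 2 at 0, hence is at least 1 around the
   multiples of [2 pi], while its mean [2 / q] is small. The aim is [h t * (1 - h t) <= e / 2 + b t
   + b (t + m)]; the choice of [q] makes the constant part of the right side at most [e]. *)
pose b t := 2 / q%:R * (1 + trig (Fejer_list q) t).
have qp : 0 < q%:R :> R by rewrite ltr0n.
have b0 t : 0 <= b t by rewrite mulr_ge0 ?Fejer_ge0// divr_ge0// ltW.
have bper t : b (t + pi *+ 2) = b t by rewrite /b trig_periodic//; exact: Fejer_frequencies.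
have [d [d0 dpi bd]] : exists d, [/\ 0 < d, d < pi & forall t, `|t| < d -> 1 <= b t].
  have : (trig (Fejer_list q) t) @[t --> 0] --> trig (Fejer_list q) (0 : R).
    exact: continuous_trig.
  move=> /cvgrPdist_lt /(_ (q%:R / 2)); rewrite divr_gt0// => /(_ isT).
  move=> /nbhs_ballP[d0 /= d00 H].
  exists (Num.min d0 1); split.
  - by rewrite lt_min d00 ltr01.
  - by rewrite gt_min; apply/orP; right; have := @pi_ge2 R; lra.
  - move=> t; rewrite lt_min => /andP[td _].
    have := H t; rewrite /ball/= sub0r normrN => /(_ td).
    have := @Fejer0 R q q0; set f0 := trig _ 0; set f1 := trig _ t => E.
    move=> /ltr_normlW; have -> : b t = 2 * (1 + f1) / q%:R by rewrite /b -/f1; ring.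
    by rewrite ler_pdivlMr// => ?; lra.
have cd : cos d < 1 by rewrite -cos0 ltr_cos// in_itv/=; lra.
have [k k0 ke] : exists2 k : nat, (0 < k)%N & 2 / (k%:R * (1 - cos d)) < e / 2.
  have c0 : 0 < 1 - cos d by rewrite subr_gt0.
  have h0 : 0 < 4 / e / (1 - cos d) by rewrite !divr_gt0.
  have := archi_boundP (ltW h0); set k := Num.bound _ => hk.
  have kp : 0 < k%:R :> R by apply: lt_trans hk.
  exists k; first by rewrite -(ltr0n R).
  rewrite ltr_pdivrMr// in hk; rewrite ltr_pdivrMr ?mulr_gt0//.
  by rewrite ltr_pdivrMr// in hk; lra.
(* The linear part of the staircase contributes [m / (2 pi) = lam] to the difference quotient [h];
   the rest is a trigonometric polynomial of mean zero. Since [0 <= m <= 2 pi], monotonicity and the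
   rise of [2 pi] per period keep [h] between 0 and 1. *)
pose m := pi *+ 2 * lam; pose St := @staircase k.
pose h t := (St (t + m) - St t) / (pi *+ 2).
have p2 : 0 < pi *+ 2 :> R by rewrite p2E; lra.
have m0 : 0 <= m by rewrite mulr_ge0// ltW.
have m1 : m <= pi *+ 2 by rewrite ler_piMr// ltW.
have h01 t : 0 <= h t <= 1.
  apply/andP; split.
    by apply: divr_ge0; [rewrite subr_ge0; apply: staircase_le => //; lra|exact: ltW].
  rewrite ler_pdivrMr// mul1r lerBlDl -staircaseD2pi.
  by apply: staircase_le => //; lra.
have hper t : h (t + pi *+ 2) = h t.
  by rewrite /h /St [t + _ + m]addrAC !staircaseD2pi; congr (_ / _); ring.
exists (trig_scale (pi *+ 2)^-1 (trig_shift m (trig_int (Fejer_list k)) ++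
          trig_scale (-1) (trig_int (Fejer_list k)))).
exists (trig_scale (2 / q%:R) (Fejer_list q ++ trig_shift m (Fejer_list q))).
have hE t : lam + trig (trig_scale (pi *+ 2)^-1 (trig_shift m (trig_int (Fejer_list k)) ++
          trig_scale (-1) (trig_int (Fejer_list k)))) t = h t.
  rewrite trig_scaleE trig_cat trig_shiftE trig_scaleE /h /St /staircase.
  have -> : lam = m / (pi *+ 2) by rewrite /m mulrAC mulfV ?mul1r// gt_eqF.
  by ring.
split.
- rewrite zero_mean_scale zero_mean_cat zero_mean_shift zero_mean_scale.
  by rewrite zero_mean_int Fejer_zero_mean.
- by rewrite zero_mean_scale zero_mean_cat zero_mean_shift Fejer_zero_mean.
- by move=> t; rewrite hE.
move=> t; rewrite hE trig_scaleE trig_cat trig_shiftE.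
have : h t * (1 - h t) <= e / 2 + b t + b (t + m).
  move: t; apply: ind_period.
    by move=> t; rewrite [t + _ + m]addrAC hper !bper.
  move=> t /andP[t0 t2].
  have /andP[h0 h1] := h01 t.
  have b1 := b0 t; have b2 := b0 (t + m).
  have big s j : `|s - pi *+ 2 * j%:R| < d -> 1 <= b s.
    by move=> /bd; rewrite -(periodicn bper j (_ - _)) -[pi *+ 2 *+ j]mulr_natr subrK.
  (* If [t] or [t + m] is within [d] of a jump, the corresponding value of [b] is at least 1.
     Otherwise either no jump lies between [t] and [t + m] and [h t] is small, or exactly one does
     and [1 - h t] is small. *)
  have [td|td] := ltP t d.
    have : 1 <= b t by apply: bd; rewrite ger0_norm.
    by nra.
  have [td2|td2] := ltP (pi *+ 2 - d) t.
    have : 1 <= b t by apply: (big _ 1%N); rewrite mulr1 ltr_norml; apply/andP; split; lra.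
    by nra.
  have flat a c : d <= a -> a <= c -> c <= pi *+ 2 - d ->
      (St c - St a) / (pi *+ 2) <= e / 2.
    move=> da ac cd2; rewrite ler_pdivrMr//.
    apply: (le_trans (staircase_flat k0 d0 dpi da ac cd2)).
    have -> : 4 * pi / (k%:R * (1 - cos d)) = 2 / (k%:R * (1 - cos d)) * (pi *+ 2).
      by rewrite p2E; ring.
    by apply: ler_wpM2r; rewrite ltW.
  have [tm|tm] := leP (t + m) (pi *+ 2 - d).
    have := flat t (t + m) td; rewrite lerDl => /(_ m0 tm); rewrite -/(h t).
    by nra.
  have [tm2|tm2] := ltP (t + m) (pi *+ 2 + d).
    have : 1 <= b (t + m) by apply: (big _ 1%N); rewrite mulr1 ltr_norml; apply/andP; split; lra.
    by nra.
  have := flat (t + m - pi *+ 2) t.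
  have -> : St (t + m - pi *+ 2) = St (t + m) - pi *+ 2.
    by rewrite -[in RHS](subrK (pi *+ 2) (t + m)) /St staircaseD2pi addrK.
  have -> : (St t - (St (t + m) - pi *+ 2)) / (pi *+ 2) = 1 - h t.
    by rewrite /h -(mulfV (lt0r_neq0 p2)); ring.
  move=> H; have {H} : 1 - h t <= e / 2 by apply: H; lra.
  by nra.
move=> H; apply: (le_trans H); rewrite /b.
set f1 := trig _ t; set f2 := trig _ (t + m).
have -> : e / 2 + 2 / q%:R * (1 + f1) + 2 / q%:R * (1 + f2) =
  e / 2 + 4 / q%:R + 2 / q%:R * (f1 + f2) by ring.
by rewrite lerD2r; lra.
Qed.

End near_indicator.

(** * Smooth functions, differentiation rules, cutoffs and waves *)

Section directional_derivatives.
Context {R : realType} {V W : normedModType R}.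

Lemma is_derive_line (f : V -> W) (x v : V) (d : W) :
  is_derive x v f d <-> is_derive (0 : R) 1 (fun h : R => f (h *: v + x)) d.
Proof.
have E : (fun h : R => h^-1 *: ((f \o shift x) (h *: v) - f x)) =
  (fun h => h^-1 *: (((fun h : R => f (h *: v + x)) \o shift 0) (h *: 1)
     - (fun h : R => f (h *: v + x)) 0)).
  by apply/funext => h /=; rewrite addr0 scale0r add0r [_ *: 1]mulr1.
by split=> -[D <-]; split; rewrite /derivable /derive ?E// -E.
Qed.

Lemma is_derive_scalel (f : V -> R) (c : W) (x v : V) (d : R) :
  is_derive x v f d -> is_derive x v (fun y => f y *: c) (d *: c).
Proof.
move=> [/cvg_ex[l fl] E].
have El : l = d by rewrite -E; apply/esym/cvg_lim.
have H : h^-1 *: (((fun y => f y *: c) \o shift x) (h *: v) - f x *: c) @[h --> 0^'] --> d *: c.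
  rewrite -El.
  have H0 : (h^-1 *: ((f \o shift x) (h *: v) - f x)) *: c @[h --> 0^'] --> l *: c.
    exact: (@cvgZr_tmp _ _ _ _ _ _ _ c fl).
  apply: (cvg_trans _ H0).
  apply: near_eq_cvg; near=> h => /=.
  by rewrite -scalerBl scalerA.
split; first by apply/cvg_ex; exists (d *: c).
exact/cvg_lim.
Unshelve. all: by end_near. Qed.

End directional_derivatives.

Section derivative_comp.
Context {R : realType} {V : normedModType R}.

Lemma is_derive_comp_real (F : R -> R) (f : V -> R) (x v : V) (a b : R) :
  is_derive (f x) 1 F a -> is_derive x v f b -> is_derive x v (F \o f) (a * b).
Proof.
move=> dF /(is_derive_line f x v b) df; apply/(is_derive_line (F \o f) x v (a * b)).
apply: (@is_derive1_comp _ F (fun h : R => f (h *: v + x)) 0) => //.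
by rewrite scale0r add0r.
Qed.

End derivative_comp.

Section continuity.
Context {R : realType} {T : topologicalType} {X : normedModType R}.
Implicit Types (f g : T -> R) (u w : T -> X).

Lemma fctD_continuous u w : continuous u -> continuous w ->
  continuous (fun x => u x + w x).
Proof. by move=> cu cw x; apply: cvgD; [exact: cu|exact: cw]. Qed.

Lemma fctB_continuous u w : continuous u -> continuous w ->
  continuous (fun x => u x - w x).
Proof. by move=> cu cw x; apply: cvgB; [exact: cu|exact: cw]. Qed.

Lemma fct_norm_continuous u : continuous u -> continuous (fun x => `|u x|).
Proof. by move=> cu x; apply: cvg_norm; exact: cu. Qed.

Lemma fctM_continuous f g : continuous f -> continuous g ->
  continuous (fun x => f x * g x).
Proof. by move=> cu cw x; apply: cvgM; [exact: cu|exact: cw]. Qed.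

Lemma fctZr_continuous f (c : X) : continuous f -> continuous (fun x => f x *: c).
Proof. by move=> cu x; apply: cvgZr_tmp; exact: cu. Qed.

Lemma fct_sum_continuous I (r : seq I) (F : I -> T -> X) :
  (forall i, continuous (F i)) -> continuous (fun x => \sum_(i <- r) F i x).
Proof.
move=> cF; elim: r => [|i r ih].
  by under eq_fun do rewrite big_nil; exact: cst_continuous.
by under eq_fun do rewrite big_cons; exact: fctD_continuous (cF i) ih.
Qed.

Lemma comp_continuous (F : R -> R) f : continuous F -> continuous f ->
  continuous (fun x => F (f x)).
Proof. by move=> cF cf x; apply: continuous_comp; [exact: cf|exact: cF]. Qed.

End continuity.

Section smooth_functions.
Context {R : realType} {n : nat}.
Implicit Types (f g : 'rV[R]_n -> R) (s : seq 'I_n) (i : 'I_n) (x v : 'rV[R]_n).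

Lemma partials_rcons (X : normedModType R) s i (u : 'rV[R]_n -> X) :
  partials (rcons s i) u = partials s (partial i u).
Proof. by rewrite /partials foldr_rcons. Qed.

Lemma smooth_partial (X : normedModType R) i (u : 'rV[R]_n -> X) :
  smooth u -> smooth (partial i u).
Proof. by move=> su s; rewrite -partials_rcons; exact: su. Qed.

Lemma smooth_partials (X : normedModType R) s (u : 'rV[R]_n -> X) :
  smooth u -> smooth (partials s u).
Proof. by move=> su; elim: s => // i s ih; exact: smooth_partial. Qed.

Lemma smooth_continuous (X : normedModType R) (u : 'rV[R]_n -> X) :
  smooth u -> continuous u.
Proof. by move=> /(_ [::])[]. Qed.

Lemma smooth_is_derive (X : normedModType R) (u : 'rV[R]_n -> X) x i : smooth u ->
  is_derive x (delta_mx 0 i) u (partial i u x).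
Proof. by move=> /(_ [::])[_ du]; apply: derivableP; exact: du. Qed.

(** Coinduction replaces an induction over lists of directions, in which the shape of the iterated
    derivatives would have to be tracked. Each use picks a class of functions closed under the
    differentiation rule at hand. *)
Lemma smooth_coind (X : normedModType R) (S : ('rV[R]_n -> X) -> Prop) :
  (forall u, S u -> continuous u /\ exists du : 'I_n -> 'rV[R]_n -> X, forall i,
     (forall x, is_derive x (delta_mx 0 i) u (du i x)) /\ S (du i)) ->
  forall u, S u -> smooth u.
Proof.
move=> SS u Su s; have : S (partials s u).
  elim: s => //= i s /SS[_ [du /(_ i)[dui Sdu]]].
  suff -> : partial i (partials s u) = du i by [].
  by apply/funext => x; exact: derive_val.
move=> /SS[cu [du dui]]; split=> // i x; have [dx _] := dui i.
exact: (@ex_derive _ _ _ _ _ _ _ (dx x)).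
Qed.

Lemma smooth_cst (X : normedModType R) (c : X) : smooth (fun _ : 'rV[R]_n => c).
Proof.
apply: (@smooth_coind _ (fun u => exists c, u = cst c)); last by exists c.
move=> u [{}c ->]; split; first exact: cst_continuous.
by exists (fun _ => cst 0) => i; split; [move=> x; exact: is_derive_cst|exists 0].
Qed.

Lemma smoothD (X : normedModType R) (u w : 'rV[R]_n -> X) :
  smooth u -> smooth w -> smooth (fun x => u x + w x).
Proof.
move=> su sw; apply: (@smooth_coind _ (fun z => exists u w,
  [/\ smooth u, smooth w & z = fun x => u x + w x])); last by exists u, w.
move=> _ [{su}u [{sw}w [su sw ->]]]; split.
  exact: (fctD_continuous (smooth_continuous su) (smooth_continuous sw)).
exists (fun i x => partial i u x + partial i w x) => i; split.
  by move=> x; exact: (is_deriveD (smooth_is_derive x i su) (smooth_is_derive x i sw)).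
by exists (partial i u), (partial i w); exact: And3 (smooth_partial i su) (smooth_partial i sw) erefl.
Qed.

Lemma smooth_sum (X : normedModType R) I (r : seq I) (F : I -> 'rV[R]_n -> X) :
  (forall j : I, smooth (F j)) -> smooth (fun x => \sum_(j <- r) F j x).
Proof.
move=> sF; elim: r => [|i r ih].
  by under eq_fun do rewrite big_nil; exact: smooth_cst.
by under eq_fun do rewrite big_cons; exact: smoothD.
Qed.

Lemma smooth_scalel (X : normedModType R) f (c : X) :
  smooth f -> smooth (fun x => f x *: c).
Proof.
move=> sf; apply: (@smooth_coind _ (fun z => exists f, smooth f /\ z = fun x => f x *: c));
  last by exists f.
move=> _ [{sf}f [sf ->]]; split.
  exact: (fctZr_continuous (smooth_continuous sf)).
exists (fun i x => partial i f x *: c) => i; split.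
  by move=> x; apply: is_derive_scalel; exact: smooth_is_derive.
by exists (partial i f); exact: conj (smooth_partial i sf) erefl.
Qed.

Lemma smoothM f g : smooth f -> smooth g -> smooth (fun x => f x * g x).
Proof.
(* Single products are not closed under differentiation; finite sums of products are, by the Leibniz
   rule. *)
move=> sf sg; apply: (@smooth_coind _ (fun z => exists l : seq (('rV[R]_n -> R) * ('rV[R]_n -> R)),
  (forall p, List.In p l -> smooth p.1 /\ smooth p.2) /\
   z = fun x => \sum_(p <- l) p.1 x * p.2 x)); last first.
  exists [:: (f, g)]; split; first by move=> p [<-|[]]; exact: conj sf sg.
  by apply/funext => x; rewrite big_seq1.
move=> _ [l [sl ->]]; split.
  elim: l sl => [|p l ih] sl.
    by under eq_fun do rewrite big_nil; exact: cst_continuous.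
  under eq_fun do rewrite big_cons; apply: fctD_continuous.
    have [s1 s2] := sl p (or_introl erefl).
    exact: (fctM_continuous (smooth_continuous s1) (smooth_continuous s2)).
  by apply: ih => q ql; apply: sl; right.
exists (fun i x => \sum_(p <- [seq (partial i p.1, p.2) | p <- l] ++
                               [seq (p.1, partial i p.2) | p <- l]) p.1 x * p.2 x) => i.
split; last first.
  eexists; split; last by reflexivity.
  move=> p /List.in_app_iff[] /List.in_map_iff[q [<- /sl[s1 s2]]] /=.
    exact: conj (smooth_partial i s1) s2.
  exact: conj s1 (smooth_partial i s2).
move=> x; rewrite big_cat !big_map/= -big_split/=.
elim: l sl => [|p l ih] sl.
  under eq_fun do rewrite big_nil; rewrite big_nil; exact: is_derive_cst.
under eq_fun do rewrite big_cons; rewrite big_cons; apply: is_deriveD.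
  have [s1 s2] := sl p (or_introl erefl).
  apply: is_derive_eq.
    exact: (is_deriveM (smooth_is_derive x i s1) (smooth_is_derive x i s2)).
  by rewrite /GRing.scale /=; ring.
by apply: ih => q ql; apply: sl; right.
Qed.

Definition derivatives (F : nat -> R -> R) :=
  forall k (t : R), is_derive t (1 : R) (F k) (F k.+1 t).

Lemma derivatives_continuous (F : nat -> R -> R) k : derivatives F -> continuous (F k).
Proof.
move=> dF t; apply: differentiable_continuous; apply/derivable1_diffP.
exact: (@ex_derive _ _ _ _ _ _ _ (dF k t)).
Qed.

Lemma smooth_comp (F : nat -> R -> R) f : derivatives F -> smooth f ->
  smooth (fun x => F 0%N (f x)).
Proof.
(* The class consists of sums of products of [F k \o f] with smooth functions: the chain rule raises
   [k] and multiplies the smooth factor by a derivative of [f]. *)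
move=> dF sf; apply: (@smooth_coind _ (fun z => exists l : seq (nat * ('rV[R]_n -> R)),
  (forall p, List.In p l -> smooth p.2) /\
   z = fun x => \sum_(p <- l) F p.1 (f x) * p.2 x)); last first.
  exists [:: (0%N, fun=> 1)]; split; first by move=> p [<-|[]]; exact: smooth_cst.
  by apply/funext => x; rewrite big_seq1 mulr1.
move=> _ [l [sl ->]]; split.
  elim: l sl => [|p l ih] sl.
    by under eq_fun do rewrite big_nil; exact: cst_continuous.
  under eq_fun do rewrite big_cons; apply: fctD_continuous.
    have s2 := sl p (or_introl erefl).
    apply: (fctM_continuous _ (smooth_continuous s2)).
    apply: (@comp_continuous R _ (F p.1) f); first exact: derivatives_continuous.
    exact: smooth_continuous.
  by apply: ih => q ql; apply: sl; right.
exists (fun i x => \sum_(p <- [seq (p.1.+1, fun x => partial i f x * p.2 x) | p <- l] ++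
                               [seq (p.1, partial i p.2) | p <- l]) F p.1 (f x) * p.2 x) => i.
split; last first.
  eexists; split; last by reflexivity.
  move=> p /List.in_app_iff[] /List.in_map_iff[q [<- /sl s2]] /=.
    exact: (smoothM (smooth_partial i sf) s2).
  exact: smooth_partial.
move=> x; rewrite big_cat !big_map/= -big_split/=.
elim: l sl => [|p l ih] sl.
  under eq_fun do rewrite big_nil; rewrite big_nil; exact: is_derive_cst.
under eq_fun do rewrite big_cons; rewrite big_cons; apply: is_deriveD.
  have s2 := sl p (or_introl erefl).
  apply: is_derive_eq.
    apply: is_deriveM; last exact: smooth_is_derive.
    by apply: is_derive_comp_real; [exact: dF|exact: smooth_is_derive].
  by rewrite /GRing.scale /=; ring.
by apply: ih => q ql; apply: sl; right.
Qed.

Definition dotv v x : R := \sum_i v 0 i * x 0 i.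

Lemma is_derive_dotv v x i : is_derive x (delta_mx 0 i) (dotv v) (v 0 i).
Proof.
have lin (h : R) : dotv v (h *: delta_mx 0 i + x) = h * v 0 i + dotv v x.
  rewrite /dotv (eq_bigr (fun j => h * (v 0 j * (j == i)%:R) + v 0 j * x 0 j)); last first.
    by move=> j _; rewrite !mxE eqxx andTb; ring.
  rewrite big_split/= -big_distrr/=; congr (h * _ + _).
  rewrite (bigD1 i)//= eqxx mulr1 big1 ?addr0// => j /negPf ->.
  by rewrite mulr0.
apply/is_derive_line; under eq_fun do rewrite lin.
have := is_deriveD (is_deriveZ (v 0 i) (is_derive_id (0 : R) (1 : R)))
  (is_derive_cst (dotv v x) (0 : R) 1).
rewrite addr0 [_ *: 1]mulr1 => H.
suff -> : (fun h : R => h * v 0 i + dotv v x) = (v 0 i \*: id)%R + cst (dotv v x) by [].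
by apply/funext => h /=; rewrite mulrC.
Qed.

Lemma continuous_dotv v : continuous (dotv v).
Proof.
apply: (@fct_sum_continuous _ _ R^o) => i.
apply: (@fctM_continuous R _ (fun=> v 0 i) (fun x : 'rV[R]_n => x 0 i)).
  exact: cst_continuous.
exact: coord_continuous.
Qed.

Lemma smooth_dotv v : smooth (dotv v).
Proof.
have : (fun f => f = dotv v \/ exists c : R, f = cst c) (dotv v) by left.
apply: (@smooth_coind _ (fun f => f = dotv v \/ exists c : R, f = cst c)) => f [->|[c ->]]; split.
- exact: continuous_dotv.
- by exists (fun i _ => v 0 i) => i; split => [x|];
    [exact: is_derive_dotv|right; exists (v 0 i)].
- exact: cst_continuous.
- by exists (fun _ => cst 0) => i; split; [move=> x; exact: is_derive_cst|right; exists 0].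
Qed.

Lemma partialD (X : normedModType R) i (u w : 'rV[R]_n -> X) : smooth u -> smooth w ->
  partial i (fun x => u x + w x) = fun x => partial i u x + partial i w x.
Proof.
move=> su sw; apply/funext => x; apply: derive_val.
exact: (is_deriveD (smooth_is_derive x i su) (smooth_is_derive x i sw)).
Qed.

Lemma partialsD (X : normedModType R) s (u w : 'rV[R]_n -> X) : smooth u -> smooth w ->
  partials s (fun x => u x + w x) = fun x => partials s u x + partials s w x.
Proof.
by move=> su sw; elim: s => //= i s ->; exact: (partialD i (smooth_partials s su) (smooth_partials s sw)).
Qed.

Lemma partials_cst0 (X : normedModType R) s :
  partials s (fun=> 0 : X) = fun=> 0.
Proof.
by elim: s => //= i s ->; apply/funext => x; apply: derive_val; exact: is_derive_cst.
Qed.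

Lemma partial_scalel (X : normedModType R) i f (c : X) : smooth f ->
  partial i (fun x => f x *: c) = fun x => partial i f x *: c.
Proof.
move=> sf; apply/funext => x; apply: derive_val.
by apply: is_derive_scalel; exact: smooth_is_derive.
Qed.

Lemma partials_scalel (X : normedModType R) s f (c : X) : smooth f ->
  partials s (fun x => f x *: c) = fun x => partials s f x *: c.
Proof.
by move=> sf; elim: s => //= i s ->; exact: (partial_scalel i c (smooth_partials s sf)).
Qed.

Lemma partials_mulr s f (c : R) : smooth f ->
  partials s (fun x => f x * c) = fun x => partials s f x * c.
Proof. exact: (@partials_scalel R^o). Qed.

Lemma partialM i f g : smooth f -> smooth g ->
  partial i (fun x => f x * g x) = fun x => partial i f x * g x + f x * partial i g x.
Proof.
move=> sf sg; apply/funext => x; apply: derive_val; apply: is_derive_eq.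
  exact: (is_deriveM (smooth_is_derive x i sf) (smooth_is_derive x i sg)).
by rewrite /GRing.scale /=; ring.
Qed.

Lemma mpartialE (X : normedModType R) (b : 'I_n -> nat) (u : 'rV[R]_n -> X) :
  mpartial b u = partials (flatten [seq nseq (b i) i | i <- enum 'I_n]) u.
Proof.
rewrite /mpartial /partials; elim: (enum 'I_n) => //= i r ->.
rewrite foldr_cat; elim: (b i) => //= k ih; by rewrite ih.
Qed.

Lemma size_mindex (b : 'I_n -> nat) :
  size (flatten [seq nseq (b i) i | i <- enum 'I_n]) = mdeg b.
Proof.
rewrite size_flatten /shape -map_comp sumnE big_map /mdeg big_enum/=.
by apply: eq_bigr => i _; rewrite /= size_nseq.
Qed.

Lemma prod_mindex (b : 'I_n -> nat) (v : 'I_n -> R) :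
  \prod_(i <- flatten [seq nseq (b i) i | i <- enum 'I_n]) v i = \prod_i v i ^+ b i.
Proof.
rewrite big_flatten/= big_map big_enum/=; apply: eq_bigr => i _.
by rewrite big_nseq -Monoid.iteropE.
Qed.

End smooth_functions.

Section flat_function.
Context {R : realType}.
Implicit Types (p : {poly R}) (t : R).

(** The classical [exp (- 1 / t)], times a polynomial in [1 / t] so that the family is closed under
    differentiation; [flat_step] is the effect of the derivative on the polynomial. *)
Definition flat p t : R := if 0 < t then p.[t^-1] * expR (- t^-1) else 0.

Definition flat_step p : {poly R} := 'X^2 * (p - p^`()).

Lemma poly_le_expR p : exists2 C, 0 <= C & forall t, 0 <= t -> `|p.[t]| <= C * expR t.
Proof.
have mon k t : 0 <= t -> t ^+ k <= k`!%:R * expR t.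
  move=> t0; case: k => [|k].
    by rewrite expr0 fact0 mul1r (le_trans _ (expR_ge1Dx t))// lerDl.
  have H := expR_ge1Dxn k t0; rewrite -ler_pdivrMl ?ltr0n ?fact_gt0// mulrC.
  by apply: le_trans H; rewrite lerDr.
exists (\sum_(i < size p) `|p`_i| * i`!%:R).
  by apply: sumr_ge0 => i _; rewrite mulr_ge0// ler0n.
move=> t t0; rewrite horner_coef big_distrl/=.
apply: (le_trans (ler_norm_sum _ _ _)); apply: ler_sum => i _.
by rewrite normrM normrX (ger0_norm t0) -mulrA ler_wpM2l// mon.
Qed.

Lemma is_derive_flat p t : is_derive t (1 : R) (flat p) (flat (flat_step p) t).
Proof.
case: (ltrgt0P t) => t0.
- have -> : flat (flat_step p) t =
      p.[t^-1] *: (expR (- t^-1) * t ^- 2) + expR (- t^-1) *: (p^`().[t^-1] * - t ^- 2).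
    rewrite /flat t0 /flat_step hornerM hornerXn hornerD hornerN exprVn /GRing.scale/=.
    by ring.
  have dinv : is_derive t (1 : R) (GRing.inv : R -> R) (- t ^- 2).
    have := @is_deriveV R (id : R -> R) t 1 1 (lt0r_neq0 t0) _.
    by rewrite /GRing.scale /= mulr1; apply; exact: is_derive_id.
  have dinvN : is_derive t (1 : R) (fun t : R => - t^-1) (t ^- 2).
    by have := is_deriveN dinv; rewrite opprK.
  apply: (@near_eq_is_derive _ _ _ ((horner p \o GRing.inv) * (expR \o (fun t => - t^-1)))).
    near=> s; have s0 : 0 < s by near: s; exact: lt_nbhsr.
    by rewrite [RHS]/flat s0.
  exact: (is_deriveM (@is_derive1_comp _ (horner p) GRing.inv _ _ _ (is_derive_poly _ _) dinv)
    (@is_derive1_comp _ expR (fun t : R => - t^-1) _ _ _ (is_derive_expR _) dinvN)).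
- have -> : flat (flat_step p) t = 0 by rewrite /flat ltNge ltW.
  have d0 : is_derive t (1 : R) (cst (0 : R)) 0 by exact: is_derive_cst.
  apply: near_eq_is_derive d0.
  near=> s; rewrite /flat/= ifF//; apply/negbTE; rewrite -leNgt ltW//; near: s.
  exact: lt_nbhsl.
- rewrite t0; have -> : flat (flat_step p) 0 = 0 by rewrite /flat ltxx.
  (* To the right of 0 the difference quotient is [p.[h^-1] / h] times [exp (- 1 / h)]. Bounding
     ['X^2 * p] rather than ['X * p] by the exponential leaves a factor [h], so the quotient tends
     to 0. *)
  have [C C0 HC] := poly_le_expR ('X^2 * p).
  have H : h^-1 *: ((flat p \o shift 0) (h *: (1 : R)) - flat p 0) @[h --> (0 : R)^'] --> (0 : R).
    apply/cvgrPdist_le => e e0; near=> h.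
    rewrite sub0r normrN /= addr0 [h *: 1]mulr1 {2}/flat ltxx subr0 [_ *: _]/(_ * _).
    rewrite normrM normfV /flat; case: ifPn => h0; last by rewrite normr0 mulr0 ltW.
    have hi0 : 0 <= h^-1 by rewrite invr_ge0 ltW.
    have := HC h^-1 hi0; rewrite hornerM hornerXn normrM [X in X * _ <= _]ger0_norm ?exprn_ge0//.
    rewrite normrM [ `|expR _|]ger0_norm ?expR_ge0// (gtr0_norm h0) => K.
    rewrite mulrA expRN ler_pdivrMr ?expR_gt0//.
    have -> : h^-1 * `|p.[h^-1]| = h * (h^-1 ^+ 2 * `|p.[h^-1]|).
      by rewrite expr2 -!mulrA mulVKf ?lt0r_neq0.
    apply: (@le_trans _ _ (h * (C * expR h^-1))); first by rewrite ler_wpM2l// ltW.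
    rewrite mulrA ler_wpM2r ?expR_ge0//.
    have hC : `|h| < e / (C + 1).
      by near: h; apply: dnbhs0_lt; rewrite divr_gt0// ltr_wpDl.
    rewrite (gtr0_norm h0) ltr_pdivlMr ?ltr_wpDl// in hC.
    by apply/ltW; apply: le_lt_trans hC; rewrite ler_wpM2l ?lerDl// ltW.
  split; first by apply/cvg_ex; exists 0.
  exact/cvg_lim.
Unshelve. all: by end_near. Qed.

End flat_function.

Section bump.
Context {R : realType} {n : nat}.
Implicit Types (f g : 'rV[R]_n -> R) (s : seq 'I_n) (i : 'I_n) (x v : 'rV[R]_n).

Lemma flat_derivatives : derivatives (fun k => flat (iter k (@flat_step R) 1)).
Proof. by move=> k t; exact: is_derive_flat. Qed.

(** The scale [c] makes the family stable under real powers: by [powR_bump] a p-th power is a change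
    of scale, so it is smooth again. *)
Definition bump (c : R) x : R := flat 1 (c * (1 - \sum_i x 0 i ^+ 2)).

Lemma smooth_bump c : smooth (bump c).
Proof.
have := @smooth_comp R n (fun k => flat (iter k (@flat_step R) 1))
  (fun x => c * (1 + (-1) * \sum_i dotv (delta_mx 0 i) x * dotv (delta_mx 0 i) x)) flat_derivatives.
have E : (fun x : 'rV[R]_n => flat (iter 0 (@flat_step R) 1)
    (c * (1 + (-1) * \sum_i dotv (delta_mx 0 i) x * dotv (delta_mx 0 i) x))) = bump c.
  apply/funext => x; rewrite /bump/= mulN1r; congr (flat _ (_ * (1 - _))).
  apply: eq_bigr => i _; rewrite expr2.
  suff -> : dotv (delta_mx 0 i) x = x 0 i by [].
  rewrite /dotv (bigD1 i)//= mxE !eqxx mul1r big1 ?addr0// => j ji.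
  by rewrite mxE eqxx andTb (negbTE ji) mul0r.
rewrite E; apply; apply: smoothM; first exact: smooth_cst.
apply: smoothD; first exact: smooth_cst.
apply: smoothM; first exact: smooth_cst.
by apply: smooth_sum => i; apply: smoothM; exact: smooth_dotv.
Qed.

Lemma flat1E t : flat (1 : {poly R}) t = if 0 < t then expR (- t^-1) else 0.
Proof. by rewrite /flat hornerC mul1r. Qed.

Lemma bump_ge0 c x : 0 <= bump c x.
Proof. by rewrite /bump flat1E; case: ifP => // _; exact: expR_ge0. Qed.

Lemma powR_bump p x : 0 < p -> bump 1 x `^ p = bump p^-1 x.
Proof.
move=> p0; rewrite /bump !flat1E mul1r pmulr_rgt0 ?invr_gt0//.
case: ifP => [h|_]; last by rewrite powR0 ?gt_eqF.
by rewrite -expRM invfM invrK mulNr mulrC.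
Qed.

(** The norm of row vectors is the sup norm, so the support lies in a cube of side 2; hence the
    constants [2 ^+ n] in later estimates. *)
Definition supported (X : normedModType R) (u : 'rV[R]_n -> X) :=
  forall x, 1 < `|x| -> u x = 0.

Lemma rV_norm_leP (r : R) x : 0 <= r -> reflect (forall i, `|x 0 i| <= r) (`|x| <= r).
Proof.
move=> r0; apply: (iffP idP) => [H i|H].
  apply: le_trans H.
  have /mapP[j Hj ->] : `|x 0 i| \in [seq `|x v.1 v.2| | v : 'I_1 * 'I_n].
    by apply/mapP; exists (ord0, i) => //=; rewrite mem_enum.
  by rewrite [leRHS]/Num.norm /= mx_normrE; apply/bigmax_geP; right => /=; exists j.
rewrite [leLHS]/Num.norm /= mx_normrE; apply/bigmax_leP; split => // -[i j] _ /=.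
by rewrite ord1; exact: H.
Qed.

Lemma bump_supported c : 0 < c -> supported (bump c).
Proof.
move=> c0 x x1; rewrite /bump flat1E ifF//; apply/negbTE; rewrite -leNgt.
rewrite pmulr_rle0// subr_le0.
have [i xi] : exists i, 1 < `|x 0 i|.
  apply: contrapT => H; move: x1; rewrite ltNge => /negP; apply.
  apply/rV_norm_leP => // i; rewrite leNgt; apply/negP => K; apply: H.
  by exists i.
rewrite (bigD1 i)//=; apply: (@le_trans _ _ (x 0 i ^+ 2)).
  by rewrite -real_normK ?num_real// expr_ge1 ?normr_ge0 ?ltW.
by rewrite lerDl sumr_ge0// => j _; exact: sqr_ge0.
Qed.

Lemma partial_supported (X : normedModType R) i (u : 'rV[R]_n -> X) :
  supported u -> supported (partial i u).
Proof.
move=> su x x1; have -> : partial i u x = 'D_(delta_mx 0 i) (cst (0 : X)) x.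
  apply: near_eq_derive; near=> y; rewrite su//; near: y.
  have : open [set y : 'rV[R]_n | 1 < `|y|].
    have -> : [set y : 'rV[R]_n | 1 < `|y|] = (fun y => `|y|) @^-1` [set r | 1 < r] by [].
    apply: open_comp; last exact: open_gt.
    by move=> y _; exact: norm_continuous.
  by move=> H; exact: open_nbhs_nbhs (conj H x1).
exact: derive_val.
Unshelve. all: by end_near. Qed.

Lemma partials_supported (X : normedModType R) s (u : 'rV[R]_n -> X) :
  supported u -> supported (partials s u).
Proof. by move=> su; elim: s => //= i s; exact: partial_supported. Qed.

Lemma compact_unit_ball : compact [set x : 'rV[R]_n | `|x| <= 1].
Proof.
apply: bounded_closed_compact.
  by exists 1; split; [exact: num_real|move=> M M1 x /= /le_trans; apply; exact: ltW].
have -> : [set x : 'rV[R]_n | `|x| <= 1] = (fun y => `|y|) @^-1` [set r | r <= 1] by [].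
apply: closed_comp; last exact: closed_le.
by move=> y _; exact: norm_continuous.
Qed.

Lemma supported_bounded f : continuous f -> supported f ->
  exists2 C, 0 <= C & forall x, `|f x| <= C.
Proof.
move=> cf sf; have : bounded_set (f @` [set x | `|x| <= 1]).
  apply: compact_bounded; apply: continuous_compact; last exact: compact_unit_ball.
  exact: continuous_subspaceT.
move=> /ex_strict_bound_gt0[k k_gt0 /= H]; exists k; first exact: ltW.
move=> x; have [x1|x1] := leP `|x| 1; last by rewrite sf// normr0 ltW.
by apply: ltW; apply: H; exists x.
Qed.

Lemma supported_compact (X : normedModType R) (u : 'rV[R]_n -> X) :
  smooth u -> supported u -> smooth_compact_support u.
Proof.
move=> su uu; split => //; apply: (subclosed_compact _ compact_unit_ball).
  exact: closed_closure.
have cl : closed [set x : 'rV[R]_n | `|x| <= 1] := compact_closed (@norm_hausdorff _ _) compact_unit_ball.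
rewrite [X in _ `<=` X](closure_id _).1//; apply: closure_subset => x /= ux.
by rewrite leNgt; apply/negP => /uu /eqP; rewrite (negbTE ux).
Qed.

End bump.

Section waves.
Context {R : realType} {n : nat}.
Implicit Types (a : 'rV[R]_n -> R) (s : seq 'I_n) (i : 'I_n) (x v w : 'rV[R]_n).
Implicit Types (l : seq (R * R * R)).

Definition wave l w x : R := trig l (dotv w x).

Lemma smooth_wave l w : smooth (wave l w).
Proof.
apply: (@smooth_comp R n (fun k => trig (iter k trig_der l)) (dotv w)).
  by move=> k t; exact: is_derive_trig.
exact: smooth_dotv.
Qed.

Lemma partial_wave i l w : partial i (wave l w) = fun x => w 0 i * wave (trig_der l) w x.
Proof.
apply/funext => x; apply: derive_val; rewrite mulrC.
apply: (is_derive_comp_real (F := trig l)); first exact: is_derive_trig.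
exact: is_derive_dotv.
Qed.

Lemma smooth_mul_wave a l w : smooth a -> smooth (fun x => a x * wave l w x).
Proof. by move=> sa; exact: smoothM sa (smooth_wave l w). Qed.

(** A derivative that falls on the wave yields a factor [N], one that falls on [a] does not. Only
    the Leibniz term with all derivatives on the wave has full order; the others lose at least one
    power of [N]. *)
Lemma partials_wave s v a l : smooth a -> supported a ->
  exists2 C, 0 <= C & forall N : R, 1 <= N -> forall x,
   N * `|partials s (fun x => a x * wave l (N *: v) x) x -
     N ^+ size s * (\prod_(i <- s) v 0 i) * (a x * wave (iter (size s) trig_der l) (N *: v) x)|
    <= C * N ^+ size s.
Proof.
(* Innermost derivative first: it leaves two functions of the same shape, one with amplitude
   [partial i a] and one with wave [trig_der l], to which the induction hypothesis applies. *)
elim/last_ind: s a l => [|s i ih] a l sa ua.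
  by exists 0 => // N _ x; rewrite big_nil/= expr0 !mul1r subrr normr0 mulr0 mul0r.
have [C1 C10 H1] := ih (partial i a) l (smooth_partial i sa) (partial_supported i ua).
have [C2 C20 H2] := ih a (trig_der l) sa ua.
have [A A0 HA] := supported_bounded (smooth_continuous (smooth_partial i sa)) (partial_supported i ua).
set P := \prod_(i <- s) v 0 i in H1 H2.
set B := trig_bound (iter (size s) trig_der l).
exists (C1 + `|P| * A * B + `|v 0 i| * C2).
  by rewrite !addr_ge0 ?mulr_ge0// trig_bound_ge0.
move=> N N1 x; have N0 : 0 < N by apply: lt_le_trans N1.
rewrite size_rcons partials_rcons big_rcons/= -/P.
rewrite (partialM i sa (smooth_wave _ _)) partial_wave mxE.
have -> : (fun x => partial i a x * wave l (N *: v) x +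
    a x * (N * v 0 i * wave (trig_der l) (N *: v) x)) =
  (fun x => partial i a x * wave l (N *: v) x +
    (a x * wave (trig_der l) (N *: v) x) * (N * v 0 i)).
  by apply/funext => y; congr (_ + _); ring.
rewrite partialsD; last first.
- apply: smoothM; last exact: smooth_cst.
  exact: smooth_mul_wave.
- by apply: smooth_mul_wave; exact: smooth_partial.
rewrite partials_mulr; last exact: smooth_mul_wave.
have := H1 N N1 x; have := H2 N N1 x.
rewrite -[iter (size s) _ (trig_der l)]iterSr.
set D2 := partials s _ x; set D1 := partials s _ x.
set W1 := wave _ _ x; set W2 := wave _ _ x => K2 K1.
have -> : D1 + D2 * (N * v 0 i) - N ^+ (size s).+1 * (P * v 0 i) * (a x * W1) =
  D1 + N * v 0 i * (D2 - N ^+ size s * P * (a x * W1)).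
  by rewrite exprS; ring.
have K3 : `|D1| <= (C1 + `|P| * A * B) * N ^+ size s.
  have Ns : 0 <= N ^+ size s by rewrite exprn_ge0// ltW.
  have K4 : `|D1 - N ^+ size s * P * (partial i a x * W2)| <= C1 * N ^+ size s.
    by apply: le_trans K1; rewrite ler_peMl.
  rewrite -[D1](subrK (N ^+ size s * P * (partial i a x * W2))).
  apply: (le_trans (ler_normD _ _)); rewrite mulrDl lerD// !normrM.
  rewrite (ger0_norm Ns) -[X in X <= _]mulrA [X in X <= _]mulrC -!mulrA.
  rewrite ler_wpM2l// !mulrA ler_wpM2r// ler_pM//.
  exact: trig_le_bound.
apply: (@le_trans _ _ (N * `|D1| + `|v 0 i| * N * (N * `|D2 - N ^+ size s * P * (a x * W1)|))).
  apply: (@le_trans _ _ (N * (`|D1| + `|N * v 0 i * (D2 - N ^+ size s * P * (a x * W1))|))).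
    by rewrite ler_wpM2l ?ler_normD// ltW.
  by rewrite !normrM (gtr0_norm N0) mulrDr lerD2l le_eqVlt; apply/orP; left; apply/eqP; ring.
rewrite mulrDl lerD//.
  by rewrite exprS [leRHS]mulrCA ler_wpM2l// ltW.
rewrite exprS -!mulrA ler_wpM2l// mulrA.
have -> : C2 * (N * N ^+ size s) = N * (C2 * N ^+ size s) by ring.
by rewrite ler_wpM2l// ltW.
Qed.

End waves.

(** * Integration over R^n, and integrals of partial derivatives *)

Section integration_on_Rn.
Context {R : realType}.
Local Notation RR := (measurableTypeR R).

Definition rowt {n} (t : n.-tuple R) : 'rV[R]_n := \row_i tnth t i.

Lemma measurable_countable_comp d d' (T : measurableType d) (U : measurableType d')
  (Z : countType) (c : T -> Z) (h : Z -> U) :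
  (forall z, measurable (c @^-1` [set z])) -> measurable_fun setT (h \o c).
Proof.
move=> mc _ B mB; rewrite setTI.
have -> : (h \o c) @^-1` B = \bigcup_z (if `[< B (h z) >] then c @^-1` [set z] else set0).
  apply/seteqP; split=> [t /= Bt|t [z _]].
    by exists (c t) => //; rewrite asboolT.
  by case: ifPn => // /asboolP Bz /= cz; rewrite cz.
apply: countable_bigcupT_measurable; first exact: countableP.
by move=> z; case: ifPn.
Qed.

(* Continuous functions of n real variables are limits of functions of the
   integer parts of the rescaled variables. *)
Lemma measurable_continuous n (f : 'rV[R]_n -> R) : continuous f ->
  measurable_fun [set: n.-tuple RR] (fun t : n.-tuple RR => f (rowt t)).
Proof.
move=> cf.
pose c k (t : n.-tuple RR) := [ffun i => Num.floor (tnth t i * k.+1%:R)].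
pose r k (z : {ffun 'I_n -> int}) : 'rV[R]_n := \row_i ((z i)%:~R / k.+1%:R).
apply: (@measurable_fun_cvg _ _ _ setT (fun k => (f \o r k) \o c k)) => [k|t _].
  apply: measurable_countable_comp => z.
  have -> : c k @^-1` [set z] = \bigcap_(i in [set: 'I_n])
     ((@tnth n RR ^~ i) @^-1` `[(z i)%:~R / k.+1%:R, (z i + 1)%:~R / k.+1%:R[%classic).
    have k0 : 0 < k.+1%:R :> R by rewrite ltr0n.
    apply/seteqP; split=> t /=.
      move=> E i _ /=; rewrite in_itv/= ler_pdivrMr// ltr_pdivlMr//.
      have := congr1 (fun g : {ffun 'I_n -> int} => g i) E.
      by rewrite ffunE => <-; exact: floor_itv.
    move=> H; apply/ffunP => i; rewrite ffunE.
    have := H i I; rewrite /= in_itv/= ler_pdivrMr// ltr_pdivlMr// => /floor_def.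
    by [].
  apply: fin_bigcap_measurable => [|i _]; first exact: finite_finset.
  rewrite -[X in measurable X]setTI.
  by apply: measurable_tnth.
suff H : r k (c k t) @[k --> \oo] --> rowt t by apply: (cvg_comp _ _ H); exact: cf.
apply/cvgrPdist_le => e e0; near=> k.
have k0 : 0 < k.+1%:R :> R by rewrite ltr0n.
apply/rV_norm_leP; first exact: ltW.
move=> i; rewrite !mxE ffunE.
have /andP[h1 h2] := floor_itv (tnth t i * k.+1%:R).
rewrite intrD in h2.
set z := (Num.floor _)%:~R in h1 h2 *.
have -> : tnth t i - z / k.+1%:R = (tnth t i * k.+1%:R - z) / k.+1%:R.
  by rewrite mulrBl mulfK// gt_eqF.
rewrite ger0_norm; last by rewrite divr_ge0 ?subr_ge0// ltW.
apply: (@le_trans _ _ k.+1%:R^-1).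
  by rewrite ler_pdivrMr// mulVf ?gt_eqF// lerBlDl ltW.
apply: ltW; near: k; exact: near_infty_natSinv_lt (PosNum e0).
Unshelve. all: by end_near. Qed.

Definition cube n (r : R) : set (n.-tuple RR) := [set t | `|rowt t| <= r].

Lemma measurable_cube n r : measurable (@cube n r).
Proof.
have := @measurable_continuous n (fun x => `|x|) (@norm_continuous _ _).
move=> /(_ measurableT `]-oo, r]%classic (measurable_itv _)); rewrite setTI.
by rewrite (_ : _ @^-1` _ = cube r).
Qed.

Lemma cube_cons n r (s : R) (t : n.-tuple R) : 0 <= r ->
  (`|rowt (cons_pair (s, t))| <= r) = (`|s| <= r) && (`|rowt t| <= r).
Proof.
move=> r0; apply/(rV_norm_leP _ r0)/andP => [H|[hs /(rV_norm_leP _ r0) ht] i].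
  split; first by have := H ord0; rewrite mxE tnth0.
  apply/(rV_norm_leP _ r0) => i; have := H (lift ord0 i).
  by rewrite !mxE tnthS.
rewrite mxE; case: (unliftP ord0 i) => [j|] ->; last by rewrite tnth0.
by rewrite tnthS; have := ht j; rewrite mxE.
Qed.

Lemma lebesgue_cube n r : 0 < r ->
  lebesgue_tuple R n (@cube n r) = ((r *+ 2) ^+ n)%:E.
Proof.
move=> r0; elim: n => [|n ih].
  rewrite /= diracE expr0 mem_set//= /cube/=.
  by apply/rV_norm_leP; [exact: ltW|case].
rewrite /= /tuple_cons_measure /pushforward.
have -> : @cons_pair _ n @^-1` (@cube n.+1 r) = (`[- r, r]%classic : set RR) `*` @cube n r.
  apply/seteqP; split=> -[s t] /=; rewrite /cube/= cube_cons ?(ltW r0)// in_itv/= -ler_norml.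
    by move/andP.
  by move=> [-> ->].
rewrite product_measure1E//; last exact: measurable_cube.
rewrite ih exprS EFinM; congr (_ * _)%E.
have := lebesgue_measure_itv `[(- r), r].
by rewrite /= lte_fin gtrN// -EFinB opprK mulr2n.
Qed.

Section fixed_dimension.
Context {n : nat}.
Local Notation mu := (lebesgue_tuple R n).
Implicit Types (f g : 'rV[R]_n -> R).

Definition integ f : R := \int[mu]_t f (rowt t).

Definition test_function f := continuous f /\ supported f.

Lemma test_functionD f g : test_function f -> test_function g ->
  test_function (fun x => f x + g x).
Proof.
move=> [cf sf] [cg sg]; split; first exact: fctD_continuous.
by move=> x x1; rewrite sf// sg// addr0.
Qed.

Lemma test_functionM f g : test_function f -> continuous g ->
  test_function (fun x => f x * g x).
Proof.
move=> [cf sf] cg; split; first exact: fctM_continuous.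
by move=> x x1; rewrite sf// mul0r.
Qed.

Lemma test_functionZ (c : R) f : test_function f -> test_function (fun x => c * f x).
Proof.
move=> [cf sf]; split; first exact: (fctM_continuous (@cst_continuous _ _ c) cf).
by move=> x x1; rewrite sf// mulr0.
Qed.

Lemma test_function_sum I (r : seq I) (F : I -> 'rV[R]_n -> R) :
  (forall i, test_function (F i)) -> test_function (fun x => \sum_(i <- r) F i x).
Proof.
move=> tF; split; first by apply: (@fct_sum_continuous _ _ R^o) => i; case: (tF i).
by move=> x x1; rewrite big1// => i _; case: (tF i) => _ ->.
Qed.

Let mu_cube r : 0 < r ->
  (mu : {measure set (n.-tuple RR) -> \bar R}) (cube r) = ((r *+ 2) ^+ n)%:E.
Proof. exact: lebesgue_cube. Qed.

Lemma integrable_cube r : 0 < r -> mu.-integrable setT (EFin \o \1_(cube r)).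
Proof.
move=> r0; have mc := @measurable_cube n r.
apply/integrableP; split; first exact/measurable_EFinP/measurable_indic.
under eq_integral => t _ do rewrite /= ger0_norm//.
by rewrite integral_indic// setIT mu_cube// ltry.
Qed.

Lemma test_function_integrable f : test_function f ->
  mu.-integrable setT (EFin \o (fun t => f (rowt t))).
Proof.
move=> [cf sf]; have [C C0 HC] := supported_bounded cf sf.
have mf := measurable_continuous cf.
apply: (@le_integrable _ _ _ _ _ measurableT _ (EFin \o (fun t => C * \1_(cube 1) t))).
- exact/measurable_EFinP.
- move=> t _ /=; rewrite lee_fin indicE.
  have [t1|t1] := leP `|rowt t| 1.
    by rewrite mem_set// mulr1 (ger0_norm C0).
  by rewrite sf// normr0.
- apply: (@eq_integrable _ _ _ mu setT measurableT (fun t => C%:E * (EFin \o \1_(cube 1)) t)%E) => //.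
  by apply: integrableZl => //; exact: integrable_cube.
Qed.

Lemma integD f g : test_function f -> test_function g ->
  integ (fun x => f x + g x) = integ f + integ g.
Proof. by move=> tf tg; apply: RintegralD => //; exact: test_function_integrable. Qed.

Lemma integZ (c : R) f : test_function f -> integ (fun x => c * f x) = c * integ f.
Proof. by move=> tf; apply: RintegralZl => //; exact: test_function_integrable. Qed.

Lemma integ_sum I (r : seq I) (F : I -> 'rV[R]_n -> R) : (forall i, test_function (F i)) ->
  integ (fun x => \sum_(i <- r) F i x) = \sum_(i <- r) integ (F i).
Proof.
move=> tF; elim: r => [|i r ih].
  rewrite big_nil /integ; under eq_fun do rewrite big_nil.
  by rewrite /Rintegral integral0.
rewrite big_cons -ih -integD//; last exact: test_function_sum.
by congr integ; apply/funext => x; rewrite big_cons.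
Qed.

Lemma le_integ f g : test_function f -> test_function g -> (forall x, f x <= g x) ->
  integ f <= integ g.
Proof.
by move=> tf tg fg; apply: le_Rintegral => //; exact: test_function_integrable.
Qed.

Lemma integ_norm_le f C : test_function f -> (forall x, `|f x| <= C) ->
  `|integ f| <= C * 2 ^+ n.
Proof.
move=> tf fC; have C0 : 0 <= C by apply: le_trans (fC 0).
have it := test_function_integrable tf.
apply: (le_trans (le_normr_Rintegral measurableT it)).
rewrite -lee_fin fineK; last first.
  by have /integrableP[_] := it; rewrite ge0_fin_numE// integral_ge0.
apply: (@le_trans _ _ (\int[mu]_t (C%:E * (\1_(cube 1) t)%:E))%E).
  apply: ge0_le_integral => //.
  - by apply/measurable_EFinP/measurableT_comp => //; exact: measurable_continuous tf.1.
  - apply/measurable_funeM/measurable_EFinP/measurable_indic; exact: measurable_cube.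
  - move=> t _; rewrite -EFinM lee_fin indicE.
    have [t1|t1] := leP `|rowt t| 1; first by rewrite mem_set// mulr1.
    by rewrite tf.2// normr0 mulr_ge0.
rewrite integralZl//; last exact: integrable_cube.
rewrite integral_indic//; last exact: measurable_cube.
by rewrite setIT mu_cube// -EFinM.
Qed.

Lemma integ_gt0 f : test_function f -> (forall x, 0 <= f x) -> 0 < f 0 -> 0 < integ f.
Proof.
move=> tf f0 f00.
have : (f x) @[x --> (0 : 'rV[R]_n)] --> f 0 by exact: tf.1.
move=> /cvgrPdist_lt /(_ (f 0 / 2)); rewrite divr_gt0// => /(_ isT).
move=> /nbhs_ballP[d /= d0 H].
have it := test_function_integrable tf.
have d2 : 0 < d / 2 by rewrite divr_gt0.
apply: (@lt_le_trans _ _ (f 0 / 2 * (d / 2 *+ 2) ^+ n)).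
  by rewrite mulr_gt0 ?divr_gt0// exprn_gt0// mulrn_wgt0.
rewrite -lee_fin fineK; last exact: integrable_fin_num.
apply: (@le_trans _ _ (\int[mu]_t ((f 0 / 2)%:E * (\1_(cube (d / 2)) t)%:E))%E); last first.
  apply: ge0_le_integral => //.
  - by move=> t _; rewrite -EFinM lee_fin mulr_ge0// divr_ge0// ltW.
  - apply/measurable_funeM/measurable_EFinP/measurable_indic; exact: measurable_cube.
  - by apply/measurable_EFinP; exact: measurable_continuous tf.1.
  - move=> t _; rewrite -EFinM lee_fin indicE.
    have [t1|t1] := leP `|rowt t| (d / 2).
      rewrite mem_set// mulr1.
      have := H (rowt t); rewrite mx_norm_ball /ball_/= sub0r normrN => /(_ _).
      move=> K; have : `|f 0 - f (rowt t)| < f 0 / 2 by apply: K; lra.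
      by move=> /ltr_normlW; lra.
    rewrite memNset; first by rewrite mulr0.
    by rewrite /cube/=; apply/negP; rewrite -ltNge.
rewrite integralZl//; last exact: integrable_cube.
rewrite integral_indic//; last exact: measurable_cube.
by rewrite setIT mu_cube// -EFinM.
Qed.

End fixed_dimension.

(** The first coordinate is split off by the construction of [lebesgue_tuple], so Fubini and the
    fundamental theorem of calculus in this one variable suffice. No other direction is ever
    integrated by parts. *)
Lemma integ_partial0 n (f : 'rV[R]_n.+1 -> R) : smooth f -> supported f ->
  integ (partial ord0 f) = 0.
Proof.
move=> sf uf; pose g := partial ord0 f.
have tg : test_function g.
  split; first exact: smooth_continuous (smooth_partial ord0 sf).
  exact: partial_supported.
have ig := test_function_integrable tg.
have mg := measurable_continuous tg.1.
suff: (\int[lebesgue_tuple R n.+1]_t (g (rowt t))%:E = 0)%E.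
  by rewrite /integ /Rintegral => ->.
have mc := @measurable_cons_pair _ RR n.
pose m1 : {sigma_finite_measure set RR -> \bar R} := @lebesgue_measure R.
pose m2 := lebesgue_tuple R n.
have mgc : measurable_fun setT (fun z : RR * n.-tuple RR => (g (rowt (cons_pair z)))%:E).
  by apply/measurable_EFinP; apply: measurableT_comp mg mc.
have E A : measurable A -> A `<=` setT ->
    lebesgue_tuple R n.+1 A = pushforward (m1 \x m2)%E (@cons_pair RR n) A by [].
have igc : ((m1 \x m2)%E).-integrable setT (fun z => (g (rowt (cons_pair z)))%:E).
  have /integrableP[_ ig2] := ig.
  apply/integrableP; split => //.
  rewrite (eq_measure_integral (pushforward (m1 \x m2)%E (@cons_pair RR n))) in ig2; last exact: E.
  rewrite ge0_integral_pushforward// in ig2.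
  by apply/measurable_EFinP; apply: measurableT_comp => //; exact/measurable_EFinP.
have pE : (\int[lebesgue_tuple R n.+1]_t (g (rowt t))%:E =
   \int[(m1 \x m2)%E]_z (g (rowt (cons_pair z)))%:E)%E.
  rewrite (eq_measure_integral (pushforward (m1 \x m2)%E (@cons_pair RR n))); last exact: E.
  rewrite integral_pushforward//; exact/measurable_EFinP.
rewrite pE -integral21_prod_meas1//.
apply: integral0_eq => t _; rewrite /fubini_G.
pose F (s : R) := f (rowt (cons_pair (s, t))).
pose G (s : R) := g (rowt (cons_pair (s, t))).
have shift s h : rowt (cons_pair (h + s, t)) = h *: delta_mx 0 ord0 + rowt (cons_pair (s, t)).
  apply/rowP => i; rewrite !mxE; case: (unliftP ord0 i) => [j|] ->.
    by rewrite !tnthS eqxx andTb mulr0 add0r.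
  by rewrite !tnth0 !eqxx mulr1.
have dF s : is_derive s (1 : R) F (G s).
  have := smooth_is_derive (rowt (cons_pair (s, t))) ord0 sf.
  move=> /is_derive_line dl; apply/is_derive_line.
  have -> // : (fun h : R => F (h *: 1 + s)) =
     (fun h : R => f (h *: delta_mx 0 ord0 + rowt (cons_pair (s, t)))).
  by apply/funext => h; rewrite -shift [_ *: 1]mulr1.
have cF : continuous F.
  move=> s; apply: differentiable_continuous; apply/derivable1_diffP.
  exact: (@ex_derive _ _ _ _ _ _ _ (dF s)).
have cG : continuous G.
  move=> s; have cs : (fun s : R => rowt (cons_pair (s, t))) =
      (fun s : R => s *: delta_mx 0 ord0 + rowt (cons_pair (0 : R, t))).
    by apply/funext => s'; rewrite -shift addr0.
  rewrite /G; apply: (@continuous_comp _ _ _ (fun s : R => rowt (cons_pair (s, t))) g); last exact: tg.1.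
  rewrite cs; apply: cvgD; last exact: cvg_cst.
  by apply: cvgZr_tmp; exact: cvg_id.
have big s : 1 < `|s| -> 1 < `|rowt (cons_pair (s, t))|.
  by move=> s1; rewrite ltNge cube_cons// negb_and -ltNge s1.
(* The interval reaches beyond the unit cube so that [f] vanishes at both end points: [supported]
   says nothing where the norm is exactly 1. *)
have -> : (\int[m1]_s (g (rowt (cons_pair (s, t))))%:E =
    \int[@lebesgue_measure R]_(s in `[(-2)%R, 2%R]) (G s)%:E)%E.
  rewrite [RHS]integral_mkcond; apply: eq_integral => s _.
  rewrite patchE; case: ifPn => //; rewrite notin_setE/= in_itv/= => /negP.
  rewrite -ler_norml -ltNge => s2.
  by rewrite tg.2//; apply: big; lra.
rewrite (@continuous_FTC2 _ G F)//.
- by rewrite /F !uf ?subee//; apply: big; rewrite ?normrN normr_nat; lra.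
- by rewrite (@lt_trans _ _ 0)// ?oppr_lt0.
- exact: continuous_subspaceT.
- split.
  + by move=> s _; exact: (@ex_derive _ _ _ _ _ _ _ (dF s)).
  + exact/cvg_at_right_filter/cF.
  + exact/cvg_at_left_filter/cF.
- by move=> s _; rewrite derive1E; exact: derive_val.
Qed.

End integration_on_Rn.

(** * Zigzag trees and their realization by waves *)

Section trees.
Context {R : realType} {X : normedModType R}.

(* A zigzag martingale starting at (0, 0): at a node, the pair (a, c) moves by
   (1 - lam)(s d, d) with probability lam and by - lam (s d, d) otherwise,
   where the sign s is -1 when the boolean is true. *)
Inductive tree := Leaf | Node (lam : R) (s : bool) (d : X) (t1 t2 : tree).

Fixpoint wf_tree t := if t is Node lam _ _ t1 t2 then
  [&& 0 <= lam <= 1, wf_tree t1 & wf_tree t2] else true.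

(** [lfst] collects the signed increments along a branch and [lsnd] the unsigned ones. *)
Record leaf := MkLeaf { lprob : R; lfst : X; lsnd : X }.

Definition shift_leaf (q : R) (a c : X) (b : leaf) :=
  MkLeaf (q * lprob b) (a + lfst b) (c + lsnd b).

Fixpoint leaves t : seq leaf := if t is Node lam s d t1 t2 then
    [seq shift_leaf lam (((-1) ^+ s * (1 - lam)) *: d) ((1 - lam) *: d) b | b <- leaves t1]
    ++ [seq shift_leaf (1 - lam) (((-1) ^+ s * - lam) *: d) (- lam *: d) b | b <- leaves t2]
  else [:: MkLeaf 1 0 0].

Lemma leaf_prob01 t b : wf_tree t -> List.In b (leaves t) -> 0 <= lprob b <= 1.
Proof.
elim: t b => [|lam s d t1 ih1 t2 ih2] b /=.
  by move=> _ [<-|[]] /=; rewrite ler01 lexx.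
move=> /and3P[/andP[l0 l1] w1 w2] /List.in_app_iff[] /List.in_map_iff[b' [<-]] /=.
  by move=> /(ih1 _ w1) /andP[h0 h1]; rewrite mulr_ge0//= mulr_ile1.
move=> /(ih2 _ w2) /andP[h0 h1].
by rewrite mulr_ge0 ?subr_ge0//= mulr_ile1 ?subr_ge0// lerBlDr lerDl.
Qed.

(** The flag will be the kind of a derivative: true for the order [beta], which sees the signed
    sum. *)
Definition lval (k : bool) (b : leaf) := if k then lfst b else lsnd b.

End trees.
Arguments tree {R} X.
Arguments leaf {R} X.

Section Riemann_Lebesgue.
Context {R : realType} {n : nat}.
Implicit Types (f : 'rV[R]_n.+1 -> R) (v : 'rV[R]_n.+1) (l : seq (R * R * R)).

(** One integration by parts in the first variable replaces the wave by its antiderivative, which is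
    bounded because no frequency vanishes, and gains a factor [1 / N]. Only the first coordinate of
    [v] enters, and reflections preserve its modulus. *)
Lemma Riemann_Lebesgue f v l : smooth f -> supported f -> zero_mean l ->
  `|v 0 ord0| = 1 -> exists2 C, 0 <= C & forall N : R, 1 <= N ->
  N * `|integ (fun x => f x * wave l (N *: v) x)| <= C.
Proof.
move=> sf uf zl v1.
have [A A0 HA] := supported_bounded (smooth_continuous (smooth_partial ord0 sf))
  (partial_supported ord0 uf).
exists (A * trig_bound (trig_int l) * 2 ^+ n.+1).
  by rewrite !mulr_ge0 ?exprn_ge0// trig_bound_ge0.
move=> N N1; have N0 : 0 < N by apply: lt_le_trans N1.
pose w := wave (trig_int l) (N *: v).
have sw : smooth w := smooth_wave _ _.
have sfw : smooth (fun x => f x * w x) := smoothM sf sw.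
have ufw : supported (fun x => f x * w x) by move=> x /uf ->; rewrite mul0r.
have := integ_partial0 sfw ufw; rewrite (partialM ord0 sf sw) partial_wave trig_intK//.
have t1 : test_function (fun x => partial ord0 f x * w x).
  apply: test_functionM; last exact: smooth_continuous.
  split; last exact: partial_supported.
  exact: (smooth_continuous (smooth_partial ord0 sf)).
have t2 : test_function (fun x => f x * wave l (N *: v) x).
  apply: test_functionM; last exact: (smooth_continuous (smooth_wave _ _)).
  by split => //; exact: (smooth_continuous sf).
have E x : f x * ((N *: v) 0 ord0 * wave l (N *: v) x) =
  (N * v 0 ord0) * (f x * wave l (N *: v) x) by rewrite mxE; ring.
under [X in integ X]eq_fun do rewrite E.
rewrite integD//; last exact: test_functionZ.
rewrite integZ// addrC => /eqP; rewrite addr_eq0 => /eqP/(congr1 Num.norm).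
rewrite !normrM normrN (gtr0_norm N0) v1 mulr1 => ->.
apply: integ_norm_le => // x; rewrite normrM ler_pM// trig_le_bound//.
Qed.

End Riemann_Lebesgue.

Section approximation.
Context {R : realType} {X : normedModType R} {n : nat}.
Variables (p : R) (J : finType) (kind : J -> bool) (gam : J -> 'I_n.+1 -> nat).
Variables (m : nat) (v : bool -> 'rV[R]_n.+1) (tau : bool -> R).
Hypothesis p0 : 0 < p.
Hypothesis degm : forall j, mdeg (gam j) = m.
(** [tau s] normalizes the leading coefficients of the derivatives of waves along [v s]: afterwards
    only orders of kind true notice [s]. *)
Hypothesis tauv : forall j s, tau s * \prod_i v s 0 i ^+ gam j i =
  if kind j then (-1) ^+ s else 1.
Hypothesis v1 : forall s, `|v s 0 ord0| = 1.
Local Notation Rn := 'rV[R]_n.+1.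

Definition cutoff : Rn -> R := bump 1.
Local Notation chi := cutoff.
Definition cutoff_powR : Rn -> R := bump p^-1.
Local Notation chip := cutoff_powR.

Definition weight (W : Rn -> R) := smooth W /\ forall x, 0 <= W x <= 1.

(* [L] lists the leaves of a tree with the smooth functions that replace the
   indicators of the corresponding events, conditioned to an event replaced by [W]. *)
Definition approximates (W : Rn -> R) (e : R) (u : Rn -> X)
    (L : seq ((Rn -> R) * leaf X)) :=
  [/\ smooth u /\ supported u,
      forall w, List.In w L -> weight w.1,
      forall x, \sum_(w <- L) w.1 x = W x,
      forall j x, `|mpartial (gam j) u x -
         chi x *: \sum_(w <- L) w.1 x *: lval (kind j) w.2| <= e &
      forall w, List.In w L ->
       `|integ (fun x => chip x * w.1 x) - lprob w.2 * integ (fun x => chip x * W x)| <= e /\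
       integ (fun x => chip x * (w.1 x * (1 - w.1 x))) <=
         integ (fun x => chip x * (W x * (1 - W x))) + e].

Lemma chip_test (g : Rn -> R) : continuous g -> test_function (fun x => chip x * g x).
Proof.
move=> cg; apply: (test_functionM _ cg); split.
  exact: (smooth_continuous (smooth_bump _)).
by apply: bump_supported; rewrite invr_gt0.
Qed.

Lemma smooth_mpartial (b : 'I_n.+1 -> nat) (u : Rn -> X) : smooth u -> smooth (mpartial b u).
Proof. by move=> su; rewrite mpartialE; exact: smooth_partials. Qed.

Lemma mpartialD (b : 'I_n.+1 -> nat) (u w : Rn -> X) : smooth u -> smooth w ->
  mpartial b (fun x => u x + w x) = fun x => mpartial b u x + mpartial b w x.
Proof. by move=> su sw; rewrite !mpartialE partialsD. Qed.

Lemma iter_trig_intK k (l : seq (R * R * R)) : zero_mean l ->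
  iter k trig_der (iter k trig_int l) = l.
Proof.
move=> zl; have zi j : zero_mean (iter j trig_int l).
  by elim: j => //= j ih; rewrite zero_mean_int.
by elim: k => //= k ih; rewrite -iterS iterSr trig_intK.
Qed.

(** Take the m-fold antiderivative of the wave and divide it by [N ^+ m]: every derivative of order
    [m] gives back the wave itself, with the coefficient of [tauv], up to an error of order
    [1 / N]. *)
Lemma increment_approx (W : Rn -> R) (l : seq (R * R * R)) s (d : X) (e : R) :
  smooth W -> zero_mean l -> 0 < e -> exists2 N0 : R, 1 <= N0 & forall N, N0 <= N ->
  exists u : Rn -> X, [/\ smooth u, supported u & forall j x,
    `|mpartial (gam j) u x - (chi x * W x * wave l (N *: v s) x *
        (if kind j then (-1) ^+ s else 1)) *: d| <= e].
Proof.
move=> sW zl e0.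
pose a x : R := chi x * W x.
have sa : smooth a := smoothM (smooth_bump 1) sW.
have ua : supported a by move=> x x1; rewrite /a /cutoff bump_supported// mul0r.
pose ix j := flatten [seq nseq (gam j i) i | i <- enum 'I_n.+1].
have sz j : size (ix j) = m by rewrite size_mindex degm.
have H j : exists C, 0 <= C /\ forall N : R, 1 <= N -> forall x,
   N * `|partials (ix j) (fun x => a x * wave (iter m trig_int l) (N *: v s) x) x -
     N ^+ m * (\prod_i v s 0 i ^+ gam j i) * (a x * wave l (N *: v s) x)| <= C * N ^+ m.
  have [C C0 HC] := partials_wave (ix j) (v s) (iter m trig_int l) sa ua.
  exists C; split => // N N1 x; have := HC N N1 x.
  by rewrite sz iter_trig_intK// prod_mindex.
have /choice[C HC] := H.
pose D := \sum_j C j.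
have D0 : 0 <= D by apply: sumr_ge0 => j _; case: (HC j).
have t0 : 0 <= `|tau s| * D * `|d| / e by rewrite divr_ge0 ?mulr_ge0// ltW.
exists (1 + `|tau s| * D * `|d| / e); first by rewrite lerDl.
move=> N N0; have N1 : 1 <= N by apply: le_trans N0; rewrite lerDl.
have Np : 0 < N by apply: lt_le_trans N1.
pose f x := (a x * wave (iter m trig_int l) (N *: v s) x).
have sf : smooth f by exact: smooth_mul_wave.
exists (fun x => f x *: ((tau s / N ^+ m) *: d)); split.
- exact: smooth_scalel.
- by move=> x x1; rewrite /f ua// mul0r scale0r.
move=> j x; rewrite mpartialE partials_scalel// -/(ix j) scalerA -scalerBl normrZ.
have [_ /(_ N N1 x)] := HC j; rewrite -/f.
set P := partials _ _ x; rewrite -tauv; set pr := \prod_i _; set w := wave _ _ x.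
have Nm : N ^+ m != 0 by rewrite expf_neq0// gt_eqF.
have -> : P * (tau s / N ^+ m) - chi x * W x * w * (tau s * pr) =
   tau s * (N ^+ m)^-1 * (P - N ^+ m * pr * (a x * w)).
  by rewrite /a; field.
move=> K; rewrite 2!normrM normfV (ger0_norm (exprn_ge0 m (ltW Np))).
have K2 : (N ^+ m)^-1 * `|P - N ^+ m * pr * (a x * w)| <= D / N.
  rewrite ler_pdivlMr// -[X in X <= _]mulrA ler_pdivrMl ?exprn_gt0// mulrC.
  apply: (le_trans K); rewrite [leRHS]mulrC ler_wpM2r ?exprn_ge0 ?(ltW Np)//.
  by rewrite /D (bigD1 j)//= lerDl sumr_ge0// => i _; case: (HC i).
rewrite -[X in X * _ <= _]mulrA.
apply: (@le_trans _ _ (`|tau s| * (D / N) * `|d|)).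
  by rewrite ler_wpM2r// ler_wpM2l.
have -> : `|tau s| * (D / N) * `|d| = (`|tau s| * D * `|d|) / N by field; rewrite gt_eqF.
rewrite ler_pdivrMr// -ler_pdivrMl// mulrC.
by apply: le_trans N0; rewrite lerDr.
Qed.

Lemma integ_chip_ge0 (g : Rn -> R) : continuous g -> (forall x, 0 <= g x) ->
  0 <= integ (fun x => chip x * g x).
Proof.
by move=> cg g0; apply: Rintegral_ge0 => t _; rewrite mulr_ge0// bump_ge0.
Qed.

Lemma weightM (W g : Rn -> R) : weight W -> weight g -> weight (fun x => W x * g x).
Proof.
move=> [sW W01] [sg g01]; split; first exact: smoothM.
move=> x; have /andP[a b] := W01 x; have /andP[c d] := g01 x.
by rewrite mulr_ge0//= mulr_ile1.
Qed.

Lemma weight_onem (g : Rn -> R) : weight g -> weight (fun x => 1 - g x).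
Proof.
move=> [sg g01]; split; last first.
  by move=> x; have /andP[c d] := g01 x; rewrite subr_ge0 d/= lerBlDr lerDl.
have := smoothD (smooth_cst (1 : R)) (smooth_scalel (-1 : R) sg).
by under eq_fun do rewrite [_ *: _]mulrN1.
Qed.

(** Induction on the tree, for all weights [W] at once. A node splits [W] into [W * g] and
    [W * (1 - g)], where [g] is a near-indicator of mean [lam] read along a wave; the subtrees are
    built on these new weights, so their frequencies are chosen after that of the node.
    Riemann-Lebesgue controls both the masses and the defects. *)
Lemma tree_approx t W e : wf_tree t -> weight W -> 0 < e ->
  exists u L, [seq w.2 | w <- L] = leaves t /\ approximates W e u L.
Proof.
elim: t W e => [|lam s d t1 ih1 t2 ih2] W e.
  move=> _ wW e0; exists (fun=> 0), [:: (W, MkLeaf 1 0 0)]; split => //; split.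
  - by split => //; exact: smooth_cst.
  - by move=> w [<-|[]].
  - by move=> x; rewrite big_seq1.
  - move=> j x; rewrite mpartialE partials_cst0 big_seq1 /lval /=.
    by case: (kind j); rewrite !scaler0 subrr normr0 ltW.
  - move=> w [<-|[]] /=; rewrite mul1r subrr normr0; split; first exact: ltW.
    by rewrite lerDl ltW.
move=> /= /and3P[lam01 wf1 wf2] wW e0.
have [sW W01] := wW; have cW := smooth_continuous sW.
have I0 := @integ_chip_ge0 W cW (fun x => (andP (W01 x)).1).
set I := integ _ in I0.
(* The constant part of the defect, integrated against [chip * W], must stay below [e / 4]; the
   divisor is [I + 1] because [I] may vanish. *)
have eta0 : 0 < e / 4 / (I + 1) by rewrite !divr_gt0// ltr_wpDl.
have [l [l' [zl zl' h01 hvar]]] := near_indicator lam01 eta0.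
have sT : smooth (fun x => chip x * W x) := smoothM (smooth_bump _) sW.
have uT : supported (fun x => chip x * W x).
  by move=> x x1; rewrite /cutoff_powR bump_supported ?mul0r// invr_gt0.
have [C1 C10 HC1] := Riemann_Lebesgue sT uT zl (v1 s).
have [C2 C20 HC2] := Riemann_Lebesgue sT uT zl' (v1 s).
have e4 : 0 < e / 4 by rewrite divr_gt0.
have [N0 N01 HN] := increment_approx s d sW zl e4.
(* This frequency makes the increment accurate and both oscillating integrals at most [e / 4]. *)
pose N := N0 + (C1 + C2) / (e / 4).
have NN0 : N0 <= N by rewrite lerDl divr_ge0 ?addr_ge0// ltW.
have N1 : 1 <= N by apply: le_trans NN0.
have Np : 0 < N by apply: lt_le_trans N1.
have small (C c : R) : 0 <= C -> C <= C1 + C2 -> N * `|c| <= C -> `|c| <= e / 4.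
  move=> C0 C12 K; rewrite -(ler_pM2l Np); apply: (le_trans K); apply: (le_trans C12).
  by rewrite -ler_pdivrMr// /N lerDr; apply: le_trans N01.
have [u0 [su0 uu0 Hu0]] := HN N NN0.
pose g x := lam + wave l (N *: v s) x.
have wg : weight g.
  split; last by move=> x; exact: h01.
  exact: smoothD (smooth_cst lam) (smooth_wave _ _).
have wW1 := weightM wW wg; have wW2 := weightM wW (weight_onem wg).
have [u1 [L1 [E1 [[su1 uu1] wL1 sL1 dL1 iL1]]]] := ih1 _ _ wf1 wW1 e4.
have [u2 [L2 [E2 [[su2 uu2] wL2 sL2 dL2 iL2]]]] := ih2 _ _ wf2 wW2 e4.
pose sh1 := @shift_leaf R X lam (((-1) ^+ s * (1 - lam)) *: d) ((1 - lam) *: d).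
pose sh2 := @shift_leaf R X (1 - lam) (((-1) ^+ s * - lam) *: d) (- lam *: d).
have su01 := smoothD su0 su1.
have cwave q : continuous (wave q (N *: v s)) := smooth_continuous (smooth_wave _ _).
have cg := smooth_continuous wg.1.
have I1 : `|integ (fun x => chip x * (W x * g x)) - lam * I| <= e / 4.
  have -> : integ (fun x => chip x * (W x * g x)) =
     integ (fun x => lam * (chip x * W x) + (chip x * W x) * wave l (N *: v s) x).
    by congr integ; apply/funext => x; rewrite /g; ring.
  rewrite integD; last 2 first.
  - exact/test_functionZ/chip_test.
  - exact/test_functionM/cwave/chip_test.
  rewrite integZ; last exact: chip_test.
  rewrite -/I addrAC subrr add0r.
  by apply: (small C1 _ C10 _ (HC1 N N1)); rewrite lerDl.
have I2 : `|integ (fun x => chip x * (W x * (1 - g x))) - (1 - lam) * I| <= e / 4.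
  have -> : integ (fun x => chip x * (W x * (1 - g x))) =
     integ (fun x => chip x * W x + (-1) * (chip x * (W x * g x))).
    by congr integ; apply/funext => x; ring.
  rewrite integD; last 2 first.
  - exact: chip_test.
  - by apply/test_functionZ/chip_test; exact: fctM_continuous.
  rewrite integZ; last by apply: chip_test; exact: fctM_continuous.
  rewrite -/I -normrN.
  set y := integ _ in I1 *.
  by have -> : - (I + -1 * y - (1 - lam) * I) = y - lam * I by ring.
have V x : g x * (1 - g x) <= e / 4 / (I + 1) + wave l' (N *: v s) x by exact: hvar.
have cvar : continuous (fun x => W x * (1 - W x)).
  exact: (fctM_continuous cW (smooth_continuous (weight_onem wW).1)).
have V0 : integ (fun x => chip x * (W x * (1 - W x)) +
       (e / 4 / (I + 1) * (chip x * W x) + (chip x * W x) * wave l' (N *: v s) x)) <=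
     integ (fun x => chip x * (W x * (1 - W x))) + (e / 4 + e / 4).
  rewrite integD; last 2 first.
  - exact: chip_test.
  - by apply: test_functionD; [exact/test_functionZ/chip_test|exact/test_functionM/cwave/chip_test].
  rewrite lerD2l integD; last 2 first.
  - exact/test_functionZ/chip_test.
  - exact/test_functionM/cwave/chip_test.
  rewrite integZ; last exact: chip_test.
  rewrite lerD//.
    rewrite -/I mulrAC ler_pdivrMr ?ltr_wpDl// ler_wpM2l// ?lerDl//.
    exact: ltW.
  apply: (le_trans (ler_norm _)).
  by apply: (small C2 _ C20 _ (HC2 N N1)); rewrite lerDr.
(* Meant for [f = g] and [f = 1 - g], whose defects agree. The defect of [W * f] is at most that of
   [W] plus [W] times that of [f]; the difference is [W * (1 - W) * (1 - f ^+ 2)]. *)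
have var (f : Rn -> R) : weight f -> (forall x, f x * (1 - f x) = g x * (1 - g x)) ->
    integ (fun x => chip x * (W x * f x * (1 - W x * f x))) <=
    integ (fun x => chip x * (W x * (1 - W x))) + (e / 4 + e / 4).
  move=> wf fg; apply: le_trans V0; apply: le_integ.
  - apply: chip_test; apply: fctM_continuous.
      exact: (smooth_continuous (weightM wW wf).1).
    exact: (smooth_continuous (weight_onem (weightM wW wf)).1).
  - apply: test_functionD; first exact: chip_test.
    by apply: test_functionD; [exact/test_functionZ/chip_test|exact/test_functionM/cwave/chip_test].
  move=> x.
  have -> : chip x * (W x * (1 - W x)) +
       (e / 4 / (I + 1) * (chip x * W x) + (chip x * W x) * wave l' (N *: v s) x) =
     chip x * (W x * (1 - W x) + W x * (e / 4 / (I + 1) + wave l' (N *: v s) x)) by ring.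
  rewrite ler_wpM2l ?bump_ge0//.
  have /andP[W0 W1] := W01 x; have /andP[f0 f1] := wf.2 x.
  apply: (@le_trans _ _ (W x * (1 - W x) + W x * (f x * (1 - f x)))).
    have h1 : 0 <= W x * (1 - W x) * (1 - f x) by rewrite !mulr_ge0// subr_ge0.
    have h2 : 0 <= W x * (1 - W x) * (f x * (1 - f x)) by rewrite !mulr_ge0// subr_ge0.
    by nra.
  by rewrite lerD2l ler_wpM2l// fg.
exists (fun x => u0 x + u1 x + u2 x).
exists ([seq (w.1, sh1 w.2) | w <- L1] ++ [seq (w.1, sh2 w.2) | w <- L2]).
split.
  rewrite map_cat -!map_comp -E1 -E2 -!map_comp; congr (_ ++ _).
split.
- split; first exact: smoothD su01 su2.
  by move=> x x1; rewrite uu0// uu1// uu2// !addr0.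
- by move=> w /List.in_app_iff[] /List.in_map_iff[w' [<-]] /=; [exact: wL1|exact: wL2].
- move=> x; rewrite big_cat !big_map/= sL1 sL2; ring.
- move=> j x.
  have -> : mpartial (gam j) (fun x => u0 x + u1 x + u2 x) =
      fun x => mpartial (gam j) u0 x + mpartial (gam j) u1 x + mpartial (gam j) u2 x.
    rewrite mpartialD ?mpartialD//.
  rewrite big_cat !big_map/=.
  pose sg : R := if kind j then (-1) ^+ s else 1.
  have S (L : seq ((Rn -> R) * leaf X)) q (r : R) (y : Rn) :
      \sum_(w <- L) w.1 y *: lval (kind j) (shift_leaf q (((-1) ^+ s * r) *: d) (r *: d) w.2) =
      (\sum_(w <- L) w.1 y) *: ((sg * r) *: d) + \sum_(w <- L) w.1 y *: lval (kind j) w.2.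
    rewrite scaler_suml -big_split/=; apply: eq_bigr => w _.
    rewrite -scalerDr; congr (_ *: _); rewrite /lval /sg.
    by case: (kind j) => //=; rewrite mul1r.
  rewrite /sh1 /sh2 !S sL1 sL2.
  set S1 := \sum_(w <- L1) _; set S2 := \sum_(w <- L2) _.
  have -> : mpartial (gam j) u0 x + mpartial (gam j) u1 x + mpartial (gam j) u2 x -
      chi x *: (W x * g x *: (sg * (1 - lam) *: d) + S1 +
       (W x * (1 - g x) *: (sg * - lam *: d) + S2)) =
      (mpartial (gam j) u0 x - (chi x * W x * wave l (N *: v s) x * sg) *: d) +
      (mpartial (gam j) u1 x - chi x *: S1) + (mpartial (gam j) u2 x - chi x *: S2).
    have -> : chi x * W x * wave l (N *: v s) x * sg =
       chi x * (W x * g x) * (sg * (1 - lam)) + chi x * (W x * (1 - g x)) * (sg * - lam).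
      by rewrite /g; ring.
    rewrite !scalerDr !scalerA scalerDl !mulrA.
    set A := _ *: d; set B := _ *: d.
    set a := mpartial _ _ _; set b := mpartial _ _ _; set c := mpartial _ _ _.
    set y1 := _ *: S1; set y2 := _ *: S2.
    rewrite [A + y1 + _]addrACA -[a + b + c]addrA opprD addrACA -[RHS]addrA.
    by congr (_ + _); rewrite opprD addrACA.
  apply: (le_trans (ler_normD _ _)).
  have := ler_normD (mpartial (gam j) u0 x - (chi x * W x * wave l (N *: v s) x * sg) *: d)
    (mpartial (gam j) u1 x - chi x *: S1).
  have := Hu0 j x; have := dL1 j x; have := dL2 j x; rewrite -/sg -/S1 -/S2.
  by lra.
- have [l0 l1] := andP lam01.
  move=> w /List.in_app_iff[] /List.in_map_iff[w' [<-]] wL /=.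
    have [K1 K2] := iL1 _ wL.
    have /andP[q0 q1] : 0 <= lprob w'.2 <= 1.
      by apply: (@leaf_prob01 _ _ t1) => //; rewrite -E1; apply/List.in_map_iff; exists w'.
    split; last by have := var g wg (fun=> erefl); lra.
    rewrite -(subrK (lprob w'.2 * integ (fun x => chip x * (W x * g x))) (integ _)) -addrA.
    apply: (le_trans (ler_normD _ _)).
    rewrite -/I [lam * _]mulrC -mulrA -mulrBr normrM (ger0_norm q0).
    have : lprob w'.2 * `|integ (fun x => chip x * (W x * g x)) - lam * I| <= 1 * (e / 4).
      by rewrite ler_pM.
    by lra.
  have [K1 K2] := iL2 _ wL.
  have /andP[q0 q1] : 0 <= lprob w'.2 <= 1.
    by apply: (@leaf_prob01 _ _ t2) => //; rewrite -E2; apply/List.in_map_iff; exists w'.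
  split.
    rewrite -(subrK (lprob w'.2 * integ (fun x => chip x * (W x * (1 - g x)))) (integ _)) -addrA.
    apply: (le_trans (ler_normD _ _)).
    rewrite -/I [(1 - lam) * _]mulrC -mulrA -mulrBr normrM (ger0_norm q0).
    have : lprob w'.2 * `|integ (fun x => chip x * (W x * (1 - g x))) - (1 - lam) * I| <= 1 * (e / 4).
      by rewrite ler_pM.
    by lra.
  have := var (fun x => 1 - g x) (weight_onem wg).
  by move=> H; have {H} := H (fun x => ltac:(ring)); lra.
Qed.

End approximation.

(** * Convexity of the p-th power and L^p norms of test functions *)

Section power_inequalities.
Context {R : realType}.
Variable p : R.
Hypothesis p1 : 1 < p.

Let p0 : 0 < p. Proof. exact: lt_trans p1. Qed.

(** Young's inequality for [x] and the power of [t] with exponent [p - 1], with conjugate exponents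
    [p] and [p / (p - 1)]. This covers [t = 0] without differentiation. *)
Lemma powR_tangent (x t : R) : 0 <= x -> 0 <= t ->
  t `^ p + p * t `^ (p - 1) * (x - t) <= x `^ p.
Proof.
move=> x0 t0; have q0 : 0 < p - 1 by rewrite subr_gt0.
have pn : p != 0 by rewrite gt_eqF.
have qn : p - 1 != 0 by rewrite gt_eqF.
have := @conjugate_powR _ x (t `^ (p - 1)) p (p / (p - 1)) x0 (powR_ge0 _ _) p0.
have q1 : 0 < p / (p - 1) by rewrite divr_gt0.
have pq : p^-1 + (p / (p - 1))^-1 = 1 by field; rewrite pn qn.
move=> /(_ q1 pq); rewrite -powRrM mulrC [(p - 1) * _]mulrC divfK//.
rewrite [t `^ (p - 1) * x]mulrC.
have -> : t `^ p = t * t `^ (p - 1) by rewrite mulr_powRB1.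
set y := t `^ (p - 1) => H.
have := ler_wpM2l (ltW p0) H.
rewrite mulrDr.
have -> : p * (x `^ p / p) = x `^ p by field.
have -> : p * (t * y / (p / (p - 1))) = (p - 1) * (t * y) by field; rewrite pn qn.
by lra.
Qed.

Lemma le_powRD (y d : R) : 0 <= y -> 0 <= d ->
  (y + d) `^ p <= y `^ p + p * (y + d) `^ (p - 1) * d.
Proof.
move=> y0 d0; have := powR_tangent y0 (addr_ge0 y0 d0).
by rewrite opprD addrA subrr sub0r mulrN lerBlDr.
Qed.

Context {X : normedModType R} {I : finType}.
Variables (w : I -> R) (z : I -> X).
Hypothesis w0 : forall i, 0 <= w i.
Hypothesis w1 : \sum_i w i = 1.

Lemma powR_convex : `|\sum_i w i *: z i| `^ p <= \sum_i w i * `|z i| `^ p.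
Proof.
pose T := \sum_i w i * `|z i|.
have T0 : 0 <= T by apply: sumr_ge0 => i _; rewrite mulr_ge0.
apply: (@le_trans _ _ (T `^ p)).
  rewrite ge0_ler_powR ?nnegrE ?(ltW p0)//.
  apply: (le_trans (ler_norm_sum _ _ _)); apply: ler_sum => i _.
  by rewrite normrZ (ger0_norm (w0 i)).
(* Tangent at the mean [T]: the linear terms average to zero. *)
have -> : T `^ p = \sum_i w i * (T `^ p + p * T `^ (p - 1) * (`|z i| - T)).
  under eq_bigr do rewrite mulrDr [w _ * (_ * (_ - _))]mulrCA mulrBr.
  rewrite big_split/= -big_distrl/= w1 mul1r -big_distrr/= sumrB -big_distrl/= w1.
  by rewrite mul1r -/T subrr mulr0 addr0.
by apply: ler_sum => i _; rewrite ler_wpM2l// powR_tangent.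
Qed.

(* Almost extreme convex combinations: the weights are nearly 0 or 1. *)
Lemma powR_almost_extreme M : (forall i, `|z i| <= M) ->
  \sum_i w i * `|z i| `^ p - p * M `^ (p - 1) * (M + M) * \sum_i w i * (1 - w i)
    <= `|\sum_i w i *: z i| `^ p.
Proof.
move=> zM; set Z := \sum_i w i *: z i.
(* Tangent at the norm of [z i] rather than at a mean: the norm of [Z] falls short of it by at most
   [(M + M) * (1 - w i)], since [z i - Z] involves only the other weights. *)
have key i : `|z i| `^ p - p * M `^ (p - 1) * (M + M) * (1 - w i) <= `|Z| `^ p.
  have M0 : 0 <= M by apply: le_trans (zM i).
  apply: le_trans (powR_tangent (normr_ge0 Z) (normr_ge0 (z i))).
  rewrite lerD2l -[X in X <= _]opprK lerNl -mulrN opprB opprK.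
  have wi1 : w i <= 1 by rewrite -w1 (bigD1 i)//= lerDl sumr_ge0.
  have h1 : `|z i| - `|Z| <= (M + M) * (1 - w i).
    apply: (le_trans (lerB_dist _ _)).
    have -> : z i - Z = \sum_j w j *: (z i - z j).
      by under eq_bigr do rewrite scalerBr; rewrite sumrB -scaler_suml w1 scale1r.
    rewrite (bigD1 i)//= subrr scaler0 add0r.
    apply: (le_trans (ler_norm_sum _ _ _)).
    have -> : 1 - w i = \sum_(j | j != i) w j.
      by rewrite -w1 (bigD1 i)//= addrAC subrr add0r.
    rewrite big_distrr/=; apply: ler_sum => j _.
    rewrite normrZ (ger0_norm (w0 j)) mulrC ler_wpM2r//.
    by apply: (le_trans (ler_normB _ _)); rewrite lerD.
  have h2 : `|z i| `^ (p - 1) <= M `^ (p - 1).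
    by rewrite ge0_ler_powR ?nnegrE// subr_ge0 ltW.
  have [h3|h3] := leP 0 (`|z i| - `|Z|).
    by rewrite -!mulrA ler_wpM2l ?(ltW p0)// ler_pM// powR_ge0.
  apply: (@le_trans _ _ 0).
    by rewrite mulr_ge0_le0 ?(ltW h3)// mulr_ge0 ?powR_ge0 ?ltW.
  by rewrite !mulr_ge0 ?powR_ge0 ?subr_ge0 ?addr_ge0// ltW.
have -> : `|Z| `^ p = \sum_i w i * `|Z| `^ p by rewrite -big_distrl/= w1 mul1r.
rewrite big_distrr/= -sumrB; apply: ler_sum => i _.
by rewrite [_ * (w i * _)]mulrCA -mulrBr ler_wpM2l.
Qed.

End power_inequalities.

Section Lp_test.
Context {R : realType} {X : normedModType R} {n : nat}.
Variable p : R.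
Hypothesis p1 : 1 < p.
Implicit Types u w : 'rV[R]_n -> X.

Let p0 : 0 < p. Proof. exact: lt_trans p1. Qed.

Definition Xtest u := continuous u /\ supported u.

Definition Lp u : R := integ (fun x => `|u x| `^ p) `^ p^-1.

Lemma continuous_powR (r : R) : 0 < r -> continuous (fun x : R => `|x| `^ r).
Proof.
move=> r0 x; have [->|x0] := eqVneq x 0; last first.
  have cn : {for x, continuous (fun y : R => `|y|)} by exact: norm_continuous.
  apply: (@continuous_comp _ _ _ (fun y : R => `|y|) (fun y => y `^ r)) => //.
  apply: differentiable_continuous; apply/derivable1_diffP.
  by apply: ex_derive; apply: is_derive1_powR; rewrite normr_gt0.
rewrite /continuous_at normr0 powR0 ?gt_eqF//.
apply/cvgrPdist_lt => e e0.
have H : 0 < e `^ r^-1 by rewrite powR_gt0.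
near=> y; rewrite sub0r normrN ger0_norm ?powR_ge0//.
have -> : e = (e `^ r^-1) `^ r by rewrite -powRrM mulVf ?powRr1 ?ltW// gt_eqF.
rewrite gt0_ltr_powR ?nnegrE ?normr_ge0 ?(ltW H)//.
Unshelve. all: by end_near. Qed.

Lemma Xtest_powR u : Xtest u -> test_function (fun x => `|u x| `^ p).
Proof.
move=> [cu su]; split; last by move=> x x1; rewrite su// normr0 powR0// gt_eqF.
have -> : (fun x => `|u x| `^ p) = (fun x => `|(`|u x|)| `^ p).
  by apply/funext => x; rewrite normr_id.
apply: (comp_continuous (continuous_powR p0)).
exact: fct_norm_continuous.
Qed.

Lemma LpRn_normE u : Xtest u -> LpRn_norm p u = (Lp u)%:E.
Proof.
move=> tu; have it := test_function_integrable (Xtest_powR tu).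
rewrite /LpRn_norm /LpX_norm unlock /Lp -poweR_EFin; congr poweR.
rewrite /integ /Rintegral fineK; last exact: integrable_fin_num it.
by apply: eq_integral => t _; rewrite /= normr_id.
Qed.

Lemma Lp_ge0 u : 0 <= Lp u. Proof. exact: powR_ge0. Qed.

Lemma Lp_powR u : Lp u `^ p = integ (fun x => `|u x| `^ p).
Proof.
rewrite /Lp -powRrM mulVf ?powRr1// ?gt_eqF//.
by apply: Rintegral_ge0 => t _; rewrite powR_ge0.
Qed.

Lemma XtestB u w : Xtest u -> Xtest w -> Xtest (fun x => u x - w x).
Proof.
move=> [cu su] [cw sw]; split; last by move=> x x1; rewrite su// sw// subrr.
exact: fctB_continuous.
Qed.

Lemma Lp_triangle u w : Xtest u -> Xtest w -> Lp u <= Lp w + Lp (fun x => u x - w x).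
Proof.
move=> tu tw; have tuw := XtestB tu tw.
have mn z : Xtest z -> measurable_fun setT (fun t : n.-tuple (measurableTypeR R) => `|z (rowt t)|).
  move=> [cz _]; apply: (@measurable_continuous _ _ (fun x => `|z x|)).
  exact: fct_norm_continuous.
have le_EFinD (A B C : \bar R) (a b c : R) : A = a%:E -> B = b%:E -> C = c%:E ->
  (A <= B + C)%E -> a <= b + c by move=> -> -> ->; rewrite -EFinD lee_fin.
apply: (le_EFinD _ _ _ _ _ _ (LpRn_normE tu) (LpRn_normE tw) (LpRn_normE tuw)).
apply: (@le_trans _ _ (Lnorm (lebesgue_tuple R n) p%:E
   (EFin \o ((fun t => `|w (rowt t)|) \+ (fun t => `|u (rowt t) - w (rowt t)|))%R))).
  rewrite /LpRn_norm /LpX_norm unlock; apply: gt0_ler_poweR.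
  - by rewrite invr_ge0 ltW.
  - by rewrite in_itv/= leey integral_ge0// => t _; exact: poweR_ge0.
  - by rewrite in_itv/= leey integral_ge0// => t _; exact: poweR_ge0.
  apply: ge0_le_integral => //.
  - by move=> t _; exact: poweR_ge0.
  - apply/measurable_EFinP; apply: (measurableT_comp (measurable_powR p)).
    by apply: measurableT_comp => //; exact: mn.
  - apply/measurable_EFinP; apply: (measurableT_comp (measurable_powR p)).
    apply: measurableT_comp => //.
    by apply: measurable_funD; [exact: mn|exact: (mn (fun x => u x - w x))].
  - move=> t _ /=; rewrite lee_fin ge0_ler_powR ?nnegrE ?(ltW p0)//.
    rewrite normr_id [leRHS]ger0_norm ?addr_ge0//.
    by rewrite -{1}[u _](subrK (w (rowt t))) addrC ler_normD.
apply: minkowski_EFin; [exact: mn|exact: (mn (fun x => u x - w x))|exact: ltW].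
Qed.

Lemma Lp_small u e : Xtest u -> 0 <= e -> (forall x, `|u x| <= e) ->
  Lp u <= e * (2 ^+ n) `^ p^-1.
Proof.
move=> tu e0 ue.
have -> : e * (2 ^+ n) `^ p^-1 = (e `^ p * 2 ^+ n) `^ p^-1.
  by rewrite powRM ?powR_ge0 ?exprn_ge0// -powRrM mulfV ?gt_eqF// powRr1.
rewrite ge0_ler_powR ?nnegrE ?invr_ge0 ?(ltW p0)//.
- by apply: Rintegral_ge0 => t _; rewrite powR_ge0.
- by rewrite mulr_ge0 ?powR_ge0 ?exprn_ge0.
apply: (le_trans (ler_norm _)); apply: integ_norm_le; first exact: Xtest_powR.
move=> x; rewrite ger0_norm ?powR_ge0// ge0_ler_powR ?nnegrE ?(ltW p0)//.
Qed.

End Lp_test.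

Lemma In_tnth T (s : seq T) (i : 'I_(size s)) : List.In (tnth (in_tuple s) i) s.
Proof.
have H (r : seq T) x j : (j < size r)%N -> List.In (nth x r j) r.
  by elim: r j => [|y r ih] [|j]//= jr; [left|right; exact: ih].
by case: s i => [[]//|x s] i; rewrite (tnth_nth x); exact: H.
Qed.

(** Lets the approximation error tend to 0; the restriction [e <= 1] helps to bound terms that are
    not linear in [e] by a constant times [e]. *)
Lemma le_of_small (R : realFieldType) (a b C : R) :
  (forall e, 0 < e -> e <= 1 -> a <= b + C * e) -> a <= b.
Proof.
move=> H; apply/ler_addgt0Pr => e e0.
pose D := `|C| + 1.
have D0 : 0 < D by rewrite ltr_wpDl.
pose d := Num.min 1 (e / D).
have d0 : 0 < d by rewrite lt_min ltr01 divr_gt0.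
apply: (le_trans (H d d0 _)); first by rewrite ge_min lexx.
rewrite lerD2l; apply: (@le_trans _ _ (D * d)).
  by rewrite ler_wpM2r ?(ltW d0)// (le_trans (ler_norm _))// lerDl.
by rewrite mulrC -ler_pdivlMr// ge_min lexx orbT.
Qed.

(** * The inequality for zigzag trees *)

Section tree_inequality.
Context {R : realType} {X : normedModType R} {n N : nat}.
Variables (p : R) (J : finType) (kind : J -> bool) (gam : J -> 'I_n.+1 -> nat).
Variables (m : nat) (v : bool -> 'rV[R]_n.+1) (tau : bool -> R).
Hypothesis p1 : 1 < p.
Hypothesis degm : forall j, mdeg (gam j) = m.
Hypothesis tauv : forall j s, tau s * \prod_i v s 0 i ^+ gam j i =
  if kind j then (-1) ^+ s else 1.
Hypothesis v1 : forall s, `|v s 0 ord0| = 1.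
Variables (jb : J) (ja : 'I_N -> J) (K : R).
Hypothesis kb : kind jb = true.
Hypothesis ka : forall j, kind (ja j) = false.
Hypothesis K0 : 0 <= K.
Hypothesis HK : forall u : 'rV[R]_n.+1 -> X, smooth_compact_support u ->
  (LpRn_norm p (mpartial (gam jb) u)
     <= K%:E * \sum_(j < N) LpRn_norm p (mpartial (gam (ja j)) u))%E.
Local Notation Rn := 'rV[R]_n.+1.
Local Notation chi := (@cutoff R n).
Local Notation chip := (@cutoff_powR R n p).

Let p0 : 0 < p. Proof. exact: lt_trans p1. Qed.

Let Q := K * N%:R.
Let Q0 : 0 <= Q. Proof. by rewrite mulr_ge0. Qed.

Lemma mpartial_supported (b : 'I_n.+1 -> nat) (u : Rn -> X) :
  supported u -> supported (mpartial b u).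
Proof. by move=> su; rewrite mpartialE; exact: partials_supported. Qed.

Lemma HK_Lp (u : Rn -> X) : smooth u -> supported u ->
  Lp p (mpartial (gam jb) u) <= K * \sum_(j < N) Lp p (mpartial (gam (ja j)) u).
Proof.
move=> su uu; have tu b : Xtest (mpartial b u).
  by split; [exact: (smooth_continuous (smooth_mpartial b su))|exact: mpartial_supported].
have := HK (supported_compact su uu).
rewrite (LpRn_normE p1 (tu (gam jb))).
rewrite (eq_bigr (fun j => (Lp p (mpartial (gam (ja j)) u))%:E)); last first.
  by move=> j _; exact: (LpRn_normE p1 (tu (gam (ja j)))).
by rewrite sumEFin -EFinM lee_fin.
Qed.

Lemma Lp_near (F G : Rn -> X) e : Xtest F -> Xtest G -> 0 <= e ->
  (forall x, `|F x - G x| <= e) ->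
  Lp p F <= Lp p G + e * (2 ^+ n.+1) `^ p^-1.
Proof.
move=> tF tG e0 FG; apply: (le_trans (Lp_triangle p1 tF tG)); rewrite lerD2l.
by apply: (Lp_small p1) => //; exact: XtestB.
Qed.

Section mixture.
Context {I : finType} (w : I -> Rn -> R) (z : I -> X).
Hypothesis sw : forall i, smooth (w i).
Hypothesis w0 : forall i x, 0 <= w i x.
Hypothesis w1 : forall x, \sum_i w i x = 1.

(** What the derivatives of the function built in [tree_approx] are close to: leaf values mixed by
    smooth weights instead of indicators. *)
Definition mixture x : X := chi x *: \sum_i w i x *: z i.

Lemma mixture_test : Xtest mixture.
Proof.
split.
  have -> : mixture = fun x => \sum_i (chi x * w i x) *: z i.
    by apply/funext => x; rewrite /mixture scaler_sumr; apply: eq_bigr => i _; rewrite scalerA.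
  apply: fct_sum_continuous => i; apply: fctZr_continuous; apply: fctM_continuous.
    exact: (smooth_continuous (smooth_bump _)).
  exact: (smooth_continuous (sw i)).
by move=> x x1; rewrite /mixture /cutoff bump_supported// scale0r.
Qed.

Lemma powR_mixture x : `|mixture x| `^ p = chip x * `|\sum_i w i x *: z i| `^ p.
Proof.
rewrite /mixture normrZ powRM// ger0_norm ?bump_ge0//.
by rewrite /cutoff powR_bump.
Qed.

Let tw i : test_function (fun x => chip x * w i x).
Proof. by apply: chip_test => //; exact: (smooth_continuous (sw i)). Qed.

Lemma mixture_le : Lp p mixture `^ p <= \sum_i integ (fun x => chip x * w i x) * `|z i| `^ p.
Proof.
rewrite Lp_powR//.
rewrite (eq_bigr (fun i => integ (fun x => `|z i| `^ p * (chip x * w i x)))); last first.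
  by move=> i _; rewrite integZ// mulrC.
rewrite -integ_sum; last by move=> i; exact: test_functionZ.
apply: le_integ.
- exact: (Xtest_powR p1 mixture_test).
- by apply: test_function_sum => i; exact: test_functionZ.
move=> x; rewrite powR_mixture.
have -> : \sum_i `|z i| `^ p * (chip x * w i x) = chip x * \sum_i w i x * `|z i| `^ p.
  by rewrite big_distrr/=; apply: eq_bigr => i _; ring.
by rewrite ler_wpM2l ?bump_ge0// powR_convex.
Qed.

(** The converse of [mixture_le] costs the defect of the weights, through [powR_almost_extreme]. *)
Lemma mixture_ge M : (forall i, `|z i| <= M) ->
  \sum_i integ (fun x => chip x * w i x) * `|z i| `^ p -
   p * M `^ (p - 1) * (M + M) * \sum_i integ (fun x => chip x * (w i x * (1 - w i x)))
   <= Lp p mixture `^ p.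
Proof.
move=> zM; rewrite Lp_powR//; set c := p * _ * _.
have tv i : test_function (fun x => chip x * (w i x * (1 - w i x))).
  apply: chip_test => //; apply: fctM_continuous; first exact: (smooth_continuous (sw i)).
  apply: (@fctB_continuous _ _ R^o (fun=> 1) (w i)); first exact: cst_continuous.
  exact: (smooth_continuous (sw i)).
have -> : \sum_i integ (fun x => chip x * w i x) * `|z i| `^ p =
    integ (fun x => \sum_i `|z i| `^ p * (chip x * w i x)).
  rewrite integ_sum; last by move=> i; exact: test_functionZ.
  by apply: eq_bigr => i _; rewrite integZ// mulrC.
rewrite -mulNr -integ_sum// -integZ; last exact: test_function_sum.
rewrite -integD; last 2 first.
- by apply: test_function_sum => i; exact: test_functionZ.
- by apply: test_functionZ; exact: test_function_sum.
apply: le_integ.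
- apply: test_functionD; last by apply: test_functionZ; exact: test_function_sum.
  by apply: test_function_sum => i; exact: test_functionZ.
- exact: (Xtest_powR p1 mixture_test).
move=> x; rewrite powR_mixture.
have -> : \sum_i `|z i| `^ p * (chip x * w i x) +
    - c * \sum_i chip x * (w i x * (1 - w i x)) =
    chip x * (\sum_i w i x * `|z i| `^ p - c * \sum_i w i x * (1 - w i x)).
  rewrite mulNr mulrBr; congr (_ - _).
    by rewrite big_distrr/=; apply: eq_bigr => i _; ring.
  by rewrite mulrCA -big_distrr.
by rewrite ler_wpM2l ?bump_ge0// powR_almost_extreme.
Qed.

End mixture.

(** The hypothesis is applied to the function built from the tree. The order [jb] sees the mixture
    of the [lfst], estimated from below by [mixture_ge]; all orders [ja j] see that of the [lsnd],
    estimated from above by [mixture_le]. The total mass [I] of [chip] cancels. *)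
Lemma tree_inequality (t : tree X) : wf_tree t ->
  \sum_(b <- leaves t) lprob b * `|lfst b| `^ p <=
  Q `^ p * \sum_(b <- leaves t) lprob b * `|lsnd b| `^ p :> R.
Proof.
move=> wft.
set A := \sum_(b <- _) _; set B := \sum_(b <- _) _.
pose Sa : R := \sum_(b <- leaves t) `|lfst b| `^ p.
pose Sc : R := \sum_(b <- leaves t) `|lsnd b| `^ p.
pose M : R := \sum_(b <- leaves t) `|lfst b|.
pose I := integ (fun x => chip x * 1).
have I0 : 0 < I.
  apply: integ_gt0.
  - by apply: chip_test => //; exact: cst_continuous.
  - by move=> x; rewrite mulr1 bump_ge0.
  rewrite mulr1 /cutoff_powR /bump flat1E big1 => [|i _]; last by rewrite mxE expr0n.
  by rewrite subr0 mulr1 invr_gt0 p0 expR_gt0.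
pose D := (2 ^+ n.+1) `^ p^-1 : R.
have D0 : 0 <= D by exact: powR_ge0.
pose D' := Q * D + D.
have D'0 : 0 <= D' by rewrite addr_ge0// mulr_ge0.
have B0 : 0 <= B.
  rewrite /B; have H : forall b, List.In b (leaves t) -> 0 <= lprob b.
    by move=> b /(leaf_prob01 wft) /andP[].
  elim: (leaves t) H => [|b s ih] H; first by rewrite big_nil.
  rewrite big_cons addr_ge0//; first by rewrite mulr_ge0 ?powR_ge0 ?H//; left.
  by apply: ih => c cs; apply: H; right.
have Sc0 : 0 <= Sc by apply: sumr_ge0 => b _; exact: powR_ge0.
(* [y1] bounds the norm of the plain mixture for all [e <= 1], which keeps [C] independent of
   [e]. *)
pose y1 := (I * B + Sc) `^ p^-1.
pose C := Sa + p * M `^ (p - 1) * (M + M) * (size (leaves t))%:R + Q `^ p * Sc +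
          p * (Q * y1 + D') `^ (p - 1) * D'.
suff H : I * A <= Q `^ p * (I * B).
  by rewrite -(ler_pM2l I0) mulrCA.
apply: (@le_of_small _ _ _ C) => e e0 e1.
(* The root weight is the constant 1: its defect is 0 and its mass is [I]. *)
have wone : weight (fun _ : Rn => 1 : R).
  by split; [exact: smooth_cst|move=> _; rewrite ler01 lexx].
have [u [L [EL [[su uu] wL sL dL iL]]]] := tree_approx (kind := kind) p0 degm tauv v1 wft wone e0.
pose T := 'I_(size L).
pose w (i : T) := (tnth (in_tuple L) i).1.
pose b (i : T) := (tnth (in_tuple L) i).2.
have sumL (V : nmodType) (G : leaf X -> V) : \sum_(i : T) G (b i) = \sum_(l <- leaves t) G l.
  by rewrite -EL big_map [RHS]big_tnth.
have sumw (V : nmodType) (G : (Rn -> R) * leaf X -> V) : \sum_(l <- L) G l = \sum_(i : T) G (w i, b i).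
  by rewrite big_tnth; apply: eq_bigr => i _; rewrite /w /b -surjective_pairing.
have sw i : smooth (w i) by have [] := wL _ (In_tnth i).
have w0 i x : 0 <= w i x by have [_ /(_ x)/andP[]] := wL _ (In_tnth i).
have w1 x : \sum_i w i x = 1 by rewrite -(sL x) sumw.
pose F k := mixture w (fun i => lval k (b i)).
have tF k : Xtest (F k) by exact: mixture_test.
have tu g : Xtest (mpartial g u).
  by split; [exact: (smooth_continuous (smooth_mpartial g su))|exact: mpartial_supported].
have dF j x : `|mpartial (gam j) u x - F (kind j) x| <= e.
  by apply: le_trans (dL j x); rewrite sumw.
have e0' := ltW e0.
have h1 : Lp p (F true) <= Lp p (mpartial (gam jb) u) + e * D.
  by apply: Lp_near => // x; rewrite distrC -kb.
have h2 j : Lp p (mpartial (gam (ja j)) u) <= Lp p (F false) + e * D.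
  by apply: Lp_near => // x; rewrite -(ka j).
pose y := Lp p (F false).
have y0 : 0 <= y := Lp_ge0 p _.
(* Each of the [N] norms on the right is at most [y + e * D], whence the factor [N] in [Q]. *)
have h3 : Lp p (F true) <= Q * y + e * D'.
  apply: (le_trans h1).
  have -> : Q * y + e * D' = K * (N%:R * (y + e * D)) + e * D by rewrite /D' /Q; ring.
  rewrite lerD2r; apply: (le_trans (HK_Lp su uu)); rewrite ler_wpM2l//.
  apply: (@le_trans _ _ (\sum_(j < N) (y + e * D))); first by apply: ler_sum => j _; exact: h2.
  by rewrite sumr_const card_ord -[leLHS]mulr_natl.
have integ_bound i : `|integ (fun x => chip x * w i x) - lprob (b i) * I| <= e.
  by have [] := iL _ (In_tnth i).
have hy : y `^ p <= I * B + e * Sc.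
  apply: (le_trans (mixture_le _ sw w0 w1)).
  have -> : I * B + e * Sc = \sum_i (lprob (b i) * I + e) * `|lsnd (b i)| `^ p.
    under eq_bigr do rewrite mulrDl.
    rewrite big_split/= (sumL _ (fun l => lprob l * I * `|lsnd l| `^ p)).
    rewrite (sumL _ (fun l => e * `|lsnd l| `^ p)) -[in RHS]big_distrr/=; congr (_ + _).
    by rewrite /B big_distrr/=; apply: eq_bigr => l _; ring.
  apply: ler_sum => i _; rewrite ler_wpM2r ?powR_ge0//.
  by have := integ_bound i; rewrite ler_norml => /andP[_]; rewrite lerBlDl.
have hx : I * A - e * (Sa + p * M `^ (p - 1) * (M + M) * (size (leaves t))%:R) <= Lp p (F true) `^ p.
  have bM i : `|lval true (b i)| <= M.
    rewrite /M -(sumL _ (fun l => `|lfst l|)) (bigD1 i)//= lerDl sumr_ge0//.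
  apply: le_trans (mixture_ge sw w0 w1 bM).
  set c := p * _ * _.
  have -> : I * A - e * (Sa + c * (size (leaves t))%:R) =
     \sum_i (lprob (b i) * I - e) * `|lfst (b i)| `^ p - c * \sum_(i : T) e.
    under eq_bigr do rewrite mulrBl.
    rewrite sumrB/= (sumL _ (fun l => lprob l * I * `|lfst l| `^ p)).
    rewrite (sumL _ (fun l => e * `|lfst l| `^ p)) -[X in _ = _ - X - _]big_distrr/=.
    have sz : size L = size (leaves t) by rewrite -EL size_map.
    rewrite sumr_const card_ord sz -[e *+ _]mulr_natr -/Sa.
    have -> : \sum_(l <- leaves t) lprob l * I * `|lfst l| `^ p = I * A.
      by rewrite /A big_distrr/=; apply: eq_bigr => l _; ring.
    by ring.
  have M0 : 0 <= M by apply: sumr_ge0 => l _.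
  have c0 : 0 <= c by rewrite !mulr_ge0 ?powR_ge0 ?addr_ge0// ltW.
  apply: lerB.
    apply: ler_sum => i _; rewrite ler_wpM2r ?powR_ge0//.
    have := integ_bound i; rewrite ler_norml => /andP[+ _].
    by rewrite lerBrDr [- e + _]addrC.
  rewrite ler_wpM2l//; apply: ler_sum => i _.
  have [_] := iL _ (In_tnth i); rewrite subrr mulr0.
  have -> : integ (fun x => chip x * 0) = 0 :> R.
    by rewrite /integ /Rintegral integral0_eq// => r _; rewrite mulr0.
  by rewrite add0r.
have yy1 : y <= y1.
  have -> : y = (y `^ p) `^ p^-1 by rewrite -powRrM mulfV ?powRr1// gt_eqF.
  rewrite ge0_ler_powR ?nnegrE ?invr_ge0 ?(ltW p0) ?powR_ge0//.
    by rewrite addr_ge0// mulr_ge0// ltW.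
  by apply: (le_trans hy); rewrite lerD2l ler_piMl.
have eD : 0 <= e * D' by rewrite mulr_ge0.
have Qy : 0 <= Q * y by rewrite mulr_ge0.
have h4 : Lp p (F true) `^ p <= Q `^ p * (I * B + e * Sc) +
    p * (Q * y1 + D') `^ (p - 1) * (e * D').
  apply: (@le_trans _ _ ((Q * y + e * D') `^ p)).
    by rewrite ge0_ler_powR ?nnegrE ?(ltW p0) ?Lp_ge0// addr_ge0.
  apply: (le_trans (le_powRD p1 Qy eD)); rewrite lerD//.
    by rewrite powRM// ler_wpM2l ?powR_ge0.
  apply: ler_wpM2r => //; apply: ler_wpM2l; first exact: ltW.
  have Qy1 : 0 <= Q * y1 by rewrite mulr_ge0 ?powR_ge0.
  apply: ge0_ler_powR; rewrite ?nnegrE.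
  - by rewrite subr_ge0 ltW.
  - exact: addr_ge0.
  - exact: addr_ge0.
  - by rewrite lerD// ?ler_wpM2l// ler_piMl.
have := le_trans hx h4; rewrite /C; set Y := _ `^ (p - 1) in h4 *.
move: (p * M `^ (p - 1) * (M + M) * _) => c.
rewrite lerBlDr => H; apply: (le_trans H).
by rewrite le_eqVlt; apply/orP; left; apply/eqP; ring.
Qed.

End tree_inequality.

(** * From martingale difference sequences to zigzag trees *)

Section tree_means.
Context {R : realType} {X : normedModType R}.
Implicit Types (Psi : X -> X -> R) (a c d : X).

(** Expectation of [Psi] at the end of the zigzag started at [(a, c)]; the recursive form follows
    the assembly of trees from subtrees. *)
Fixpoint tree_mean Psi (t : tree X) a c : R :=
  if t is Node lam s d t1 t2 then
    lam * tree_mean Psi t1 (a + ((-1) ^+ s * (1 - lam)) *: d) (c + (1 - lam) *: d) +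
    (1 - lam) * tree_mean Psi t2 (a + ((-1) ^+ s * - lam) *: d) (c + - lam *: d)
  else Psi a c.

Lemma tree_meanE Psi t a c : tree_mean Psi t a c =
  \sum_(b <- leaves t) lprob b * Psi (a + lfst b) (c + lsnd b).
Proof.
elim: t a c => [|lam s d t1 ih1 t2 ih2] a c /=.
  by rewrite big_seq1/= mul1r !addr0.
rewrite big_cat !big_map/= ih1 ih2 !big_distrr/=; congr (_ + _);
  by apply: eq_bigr => b _; rewrite mulrA !addrA.
Qed.

(* A splitting into finitely many branches is a succession of binary ones,
   all in the same direction. *)
Lemma kary_split (s : bool) (l : seq (R * X * tree X)) :
  (forall b, List.In b l -> 0 <= b.1.1 /\ wf_tree b.2) ->
  let M := \sum_(b <- l) b.1.1 in 0 < M ->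
  let m := M^-1 *: \sum_(b <- l) b.1.1 *: b.1.2 in
  exists2 t, wf_tree t & forall Psi a c,
    M * tree_mean Psi t (a + (-1) ^+ s *: m) (c + m) =
    \sum_(b <- l) b.1.1 * tree_mean Psi b.2 (a + (-1) ^+ s *: b.1.2) (c + b.1.2).
Proof.
elim: l => [|[[mu d] t1] l ih] H M; first by rewrite /M big_nil ltxx.
have [mu0 wt1] := H _ (or_introl erefl); rewrite /= in mu0 wt1.
have Hl b : List.In b l -> 0 <= b.1.1 /\ wf_tree b.2 by move=> bl; apply: H; right.
set M' := \sum_(b <- l) b.1.1 in ih.
have ME : M = mu + M' by rewrite /M big_cons.
have M'0 : 0 <= M'.
  rewrite /M'; elim: l Hl {ih H M M' ME} => [|b l ihl] Hl; first by rewrite big_nil.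
  rewrite big_cons addr_ge0//; first by have [] := Hl b (or_introl erefl).
  by apply: ihl => b' b'l; apply: Hl; right.
move=> M0 m.
(* If the other branches have total mass 0, then [m] is [d] and they contribute nothing; the mean of
   these branches could not be formed. *)
have [M'00|M'p] := eqVneq M' 0.
  have Z (V : nmodType) (G : R * X * tree X -> V) : (forall b, b.1.1 = 0 -> G b = 0) ->
      \sum_(b <- l) G b = 0.
    move=> G0; move: M'00; rewrite /M'; elim: l Hl {ih H M M' ME M'0 M0 m} => [|b l ihl] Hl.
      by rewrite !big_nil.
    rewrite !big_cons => E.
    have [b0 _] := Hl b (or_introl erefl).
    have s0 : 0 <= \sum_(b <- l) b.1.1.
      elim: l Hl {ihl E} => [|b' l ihl] Hl; first by rewrite big_nil.
      rewrite big_cons addr_ge0//; first by have [] := Hl b' (or_intror (or_introl erefl)).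
      by apply: ihl => b'' [?|?]; apply: Hl; [left|right; right].
    have bb : b.1.1 = 0 by lra.
    rewrite G0// add0r; apply: ihl; last by lra.
    by move=> b' b'l; apply: Hl; right.
  have Mmu : M = mu by rewrite ME M'00 addr0.
  have md : m = d.
    rewrite /m big_cons/= Z ?addr0; last by move=> b ->; rewrite scale0r.
    by rewrite scalerA Mmu mulVf ?scale1r// -Mmu gt_eqF.
  exists t1 => // Psi a c; rewrite md Mmu big_cons/= Z ?addr0// => b ->.
  by rewrite mul0r.
have {}M'p : 0 < M' by rewrite lt_def M'p.
have [t' wt' Ht'] := ih Hl M'p.
set m' := M'^-1 *: _ in Ht'.
pose lam := mu / M.
have lam0 : 0 <= lam by rewrite divr_ge0// ltW.
have lam1 : lam <= 1 by rewrite ler_pdivrMr// mul1r ME lerDl.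
have Mlam : M * lam = mu by rewrite mulrC divfK// gt_eqF.
have Mlam' : M * (1 - lam) = M' by rewrite mulrBr mulr1 Mlam ME addrAC subrr add0r.
have mE : m = lam *: d + (1 - lam) *: m'.
  rewrite /m big_cons/= scalerDr scalerA [M^-1 * _]mulrC; congr (_ + _).
  rewrite /m' scalerA; congr (_ *: _).
  rewrite -[1 - lam](mulKf (lt0r_neq0 M0)) Mlam' mulfK ?gt_eqF//.
(* From the mean [m] of all branches, the node goes with probability [lam] to the first value [d],
   and otherwise to the mean [m'] of the remaining ones, where the induction takes over. Both moves
   are along [d - m'], as [e1] and [e2] check. *)
exists (Node lam s (d - m') t1 t'); first by rewrite /= lam0 lam1 wt1 wt'.
have e1 : m + (1 - lam) *: (d - m') = d.
  by rewrite mE scalerBr addrA addrAC addrK addrC -scalerDl subrK scale1r.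
have e2 : m + - lam *: (d - m') = m'.
  rewrite mE scalerBr !scaleNr opprK addrACA subrr add0r -scalerDl subrK scale1r//.
have key A1 A2 : M * (lam * A1 + (1 - lam) * A2) = mu * A1 + M' * A2.
  by rewrite -Mlam -Mlam'; ring.
move=> Psi a c; rewrite big_cons/= -Ht' key.
by congr (mu * tree_mean _ _ _ _ + M' * tree_mean _ _ _ _);
  rewrite -addrA ?e1 ?e2// -scalerA -scalerDr ?e1 ?e2.
Qed.

End tree_means.

Section finite_range.
Context {T : Type}.
Implicit Types (G : set_system T).

(** For [Z := X] this is [simple_function]; other value types allow real factors and pairs of simple
    functions. *)
Definition fibered G (Z : choiceType) (q : T -> Z) :=
  finite_set (range q) /\ forall z, G (q @^-1` [set z]).

Lemma sigma_setU G A B : sigma_algebra setT G -> G A -> G B -> G (A `|` B).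
Proof.
move=> [G0 _ GU] GA GB; rewrite -bigcup2E; apply: GU => -[|[|n]] //=.
Qed.

Lemma sigma_setI G A B : sigma_algebra setT G -> G A -> G B -> G (A `&` B).
Proof.
move=> sG GA GB; have [G0 GC GU] := sG.
rewrite -[A `&` B]setCK -setTD; apply: (GC); rewrite setCI.
by apply: sigma_setU => //; rewrite -setTD; exact: GC.
Qed.

Lemma sigma_fin_bigcup G (Z : choiceType) (D : set Z) (A : Z -> set T) :
  sigma_algebra setT G -> finite_set D -> (forall z, D z -> G (A z)) ->
  G (\bigcup_(z in D) A z).
Proof.
move=> sG /finite_seqP[s ->]; elim: s => [|z s ih] H.
  by rewrite set_nil bigcup_set0; case: sG.
have -> : [set` z :: s] = z |` [set` s].
  apply/seteqP; split=> y /=; rewrite inE; first by case/predU1P => ?; [left|right].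
  by case=> [->|ys]; rewrite ?eqxx// ys orbT.
rewrite bigcup_setU1; apply: sigma_setU => //.
  by apply: H => /=; rewrite inE eqxx.
by apply: ih => y /= ys; apply: H => /=; rewrite inE ys orbT.
Qed.

Lemma fibered_preimage G (Z : choiceType) (q : T -> Z) B :
  sigma_algebra setT G -> fibered G q -> G (q @^-1` B).
Proof.
move=> sG [fq Gq].
have -> : q @^-1` B = \bigcup_(z in range q `&` B) q @^-1` [set z].
  apply/seteqP; split=> [x Bx|x [z [_ Bz] /= ->//]].
  by exists (q x) => //; split => //; exists x.
apply: sigma_fin_bigcup => //; exact: finite_setIl.
Qed.

Lemma fibered_comp G (Z Z' : choiceType) (q : T -> Z) (h : Z -> Z') :
  sigma_algebra setT G -> fibered G q -> fibered G (h \o q).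
Proof.
move=> sG fq; split; last by move=> z; rewrite comp_preimage; exact: fibered_preimage.
have -> : range (h \o q) = h @` range q by rewrite image_comp.
by have [ffq _] := fq; exact: finite_image.
Qed.

Lemma fibered_pair G (Z Z' : choiceType) (q : T -> Z) (q' : T -> Z') :
  sigma_algebra setT G -> fibered G q -> fibered G q' ->
  fibered G (fun x => (q x, q' x)).
Proof.
move=> sG [fq Gq] [fq' Gq']; split.
  apply: (@sub_finite_set _ _ (range q `*` range q')); last exact: finite_setX.
  by move=> _ [x _ <-]; split => /=; exists x.
move=> [z z']; rewrite (_ : _ @^-1` _ = q @^-1` [set z] `&` q' @^-1` [set z']).
  exact: sigma_setI.
by apply/seteqP; split=> x /= => [[-> ->]//|[-> ->]].
Qed.

Lemma fibered_comp2 G (Z Z' Y : choiceType) (q : T -> Z) (q' : T -> Z') (h : Z -> Z' -> Y) :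
  sigma_algebra setT G -> fibered G q -> fibered G q' ->
  fibered G (fun x => h (q x) (q' x)).
Proof.
move=> sG fq fq'.
exact: (@fibered_comp _ _ _ _ (fun z : Z * Z' => h z.1 z.2) sG (fibered_pair sG fq fq')).
Qed.

Lemma fibered_sub G G' (Z : choiceType) (q : T -> Z) : G `<=` G' ->
  fibered G q -> fibered G' q.
Proof. by move=> GG' [fq Gq]; split => // z; exact/GG'/Gq. Qed.

Lemma fibered_cst G (Z : choiceType) (z : Z) : sigma_algebra setT G -> fibered G (fun=> z).
Proof.
move=> [G0 GC _]; split.
  by apply: (@sub_finite_set _ _ [set z]); [move=> _ [x _ <-]|exact: finite_set1].
move=> y; have [->|yz] := eqVneq z y.
  rewrite (_ : _ @^-1` _ = setT); last by apply/seteqP; split.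
  by rewrite -(setD0 setT); exact: GC.
rewrite (_ : _ @^-1` _ = set0)//; apply/seteqP; split => // x /= zy.
by rewrite zy eqxx in yz.
Qed.

Lemma fibered_glue G (Z Y : choiceType) (q : T -> Z) (f : Z -> T -> Y) :
  sigma_algebra setT G -> fibered G q -> (forall z, fibered G (f z)) ->
  fibered G (fun x => f (q x) x).
Proof.
move=> sG [fq Gq] ff; split.
  apply: (@sub_finite_set _ _ (\bigcup_(z in range q) range (f z))).
    by move=> _ [x _ <-]; exists (q x); [exists x|exists x].
  by apply: bigcup_finite => // z _; case: (ff z).
move=> y; rewrite (_ : _ @^-1` _ = \bigcup_(z in range q) (q @^-1` [set z] `&` f z @^-1` [set y])).
  apply: sigma_fin_bigcup => // z _; apply: sigma_setI => //.
  by case: (ff z).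
apply/seteqP; split=> [x /= fy|x [z _ [/= -> ->]]//].
by exists (q x); [exists x|].
Qed.

End finite_range.

Section fibered_integral.
Context {R : realType} d (T : measurableType d) (P : probability T R).

Lemma measurable_sigma_algebra : sigma_algebra setT (@measurable _ T).
Proof.
split; first exact: measurable0.
  by move=> A mA; exact: measurableD.
by move=> A mA; exact: bigcup_measurable.
Qed.

Lemma fibered_measurable_fun d' (U : measurableType d') (Z : choiceType) (q : T -> Z) (h : Z -> U) :
  fibered measurable q -> measurable_fun setT (fun x => h (q x)).
Proof.
move=> fq _ B mB; rewrite setTI.
rewrite (_ : _ @^-1` _ = q @^-1` (h @^-1` B))//.
exact: (fibered_preimage _ measurable_sigma_algebra).
Qed.

Lemma ge0_integral_fibers (Z : choiceType) (q : T -> Z) A (phi : T -> \bar R) :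
  fibered measurable q -> measurable A -> measurable_fun A phi ->
  (forall x, 0 <= phi x)%E ->
  (\int[P]_(x in A) phi x =
   \sum_(z <- fset_set (range q)) \int[P]_(x in A `&` q @^-1` [set z]) phi x)%E.
Proof.
move=> [fq mq] mA mphi phi0.
have AE : A = \big[setU/set0]_(z <- fset_set (range q)) (A `&` q @^-1` [set z]).
  rewrite -bigcup_seq; apply/seteqP; split=> [x Ax|x [z _ []]//].
  exists (q x) => //; rewrite /= in_fset_set//; apply/mem_set; exact: imageT.
rewrite {1}AE ge0_integral_bigsetU//.
- by move=> z; apply: measurableI.
- apply/trivIsetP => z z' _ _ zz'; apply/seteqP; split => // x [[_ /= E] [_ /= E']].
  by rewrite -E -E' eqxx in zz'.
- by rewrite -AE.
Qed.

End fibered_integral.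

Section strong_measurability.
Context {R : realType} {X : normedModType R} d (T : measurableType d).
Variables (P : probability T R) (p : R).
Hypothesis p1 : 1 < p.
Implicit Types (f g s : T -> X).

Let p0 : 0 < p. Proof. exact: lt_trans p1. Qed.
Let sM := @measurable_sigma_algebra d T.

Local Notation smeas := (strongly_measurable (@measurable _ T)).

Lemma strongly_measurable_simple G f : simple_function G f -> strongly_measurable G f.
Proof. by move=> sf; exists (fun=> f); split=> // x; exact: cvg_cst. Qed.

Lemma strongly_measurable_sub G G' f : G `<=` G' ->
  strongly_measurable G f -> strongly_measurable G' f.
Proof.
move=> GG' [s [ss sf]]; exists s; split => // k.
exact: (@fibered_sub _ _ _ X _ GG' (ss k)).
Qed.

Lemma strongly_measurableD f g : smeas f -> smeas g -> smeas (fun x => f x + g x).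
Proof.
move=> [s [ss sf]] [t [st tg]]; exists (fun k x => s k x + t k x); split.
  by move=> k; exact: (@fibered_comp2 _ _ X X X _ _ +%R sM (ss k) (st k)).
by move=> x; apply: cvgD; [exact: sf|exact: tg].
Qed.

Lemma strongly_measurableZ (h : T -> R) f : fibered measurable h -> smeas f ->
  smeas (fun x => h x *: f x).
Proof.
move=> fh [s [ss sf]]; exists (fun k x => h x *: s k x); split.
  by move=> k; exact: (@fibered_comp2 _ _ R X X _ _ *:%R sM fh (ss k)).
by move=> x; apply: cvgZl_tmp; exact: sf.
Qed.

Lemma strongly_measurableB f g : smeas f -> smeas g -> smeas (fun x => f x - g x).
Proof.
move=> sf sg; have fc : fibered measurable (fun _ : T => -1 : R) by exact: fibered_cst.
have := strongly_measurableD sf (strongly_measurableZ fc sg).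
by under eq_fun do rewrite scaleN1r.
Qed.

Lemma strongly_measurable_cst (c : X) : smeas (fun=> c).
Proof. by apply: strongly_measurable_simple; exact: (@fibered_cst _ _ X). Qed.

Lemma strongly_measurable_sum I (r : seq I) (Q : pred I) (F : I -> T -> X) :
  (forall i, smeas (F i)) -> smeas (fun x => \sum_(i <- r | Q i) F i x).
Proof.
move=> sF; elim: r => [|i r ih].
  by under eq_fun do rewrite big_nil; exact: strongly_measurable_cst.
under eq_fun do rewrite big_cons.
by case: (Q i) => //; exact: strongly_measurableD.
Qed.

Lemma strongly_measurable_norm f : smeas f -> measurable_fun setT (fun x => `|f x|).
Proof.
move=> [s [ss sf]]; apply: (@measurable_fun_cvg _ _ _ setT (fun k x => `|s k x|)).
  by move=> k; exact: (@fibered_measurable_fun _ _ _ _ _ _ (fun y : X => `|y|) (ss k)).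
by move=> x _; apply: cvg_norm; exact: sf.
Qed.

Lemma strongly_measurable_powR f : smeas f -> measurable_fun setT (fun x => (`|f x| `^ p)%:E).
Proof.
move=> sf; apply/measurable_EFinP; apply: (measurableT_comp (measurable_powR p)).
exact: strongly_measurable_norm.
Qed.

Definition Np f : \bar R := (\int[P]_x (`|f x| `^ p)%:E)%E.

Lemma Np_ge0 f : (0 <= Np f)%E.
Proof. by apply: integral_ge0 => x _; rewrite lee_fin powR_ge0. Qed.

Lemma LpX_normE f : LpX_norm P p f = (Np f `^ p^-1)%E.
Proof.
rewrite /LpX_norm unlock; congr poweR.
by apply: eq_integral => x _; rewrite /= normr_id.
Qed.

Lemma LpX_norm_ge0 f : (0 <= LpX_norm P p f)%E.
Proof. by rewrite LpX_normE poweR_ge0. Qed.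

Lemma LpX_norm_powR f : (LpX_norm P p f `^ p = Np f)%E.
Proof.
by rewrite LpX_normE -poweRrM mulVf ?gt_eqF// poweRe1// Np_ge0.
Qed.

Lemma LpX_triangle f g : smeas f -> smeas g ->
  (LpX_norm P p f <= LpX_norm P p g + LpX_norm P p (fun x => f x - g x)%R)%E.
Proof.
move=> sf sg; have sfg := strongly_measurableB sf sg.
have mf := strongly_measurable_norm sf; have mg := strongly_measurable_norm sg.
have mfg := strongly_measurable_norm sfg.
apply: (@le_trans _ _ (Lnorm P p%:E
   (EFin \o ((fun x => `|g x|) \+ (fun x => `|f x - g x|))%R))).
  rewrite /LpX_norm unlock; apply: gt0_ler_poweR.
  - by rewrite invr_ge0 ltW.
  - by rewrite in_itv/= leey integral_ge0// => t _; exact: poweR_ge0.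
  - by rewrite in_itv/= leey integral_ge0// => t _; exact: poweR_ge0.
  apply: ge0_le_integral => //.
  - by move=> t _; exact: poweR_ge0.
  - apply/measurable_EFinP; apply: (measurableT_comp (measurable_powR p)).
    exact: measurableT_comp.
  - apply/measurable_EFinP; apply: (measurableT_comp (measurable_powR p)).
    by apply: measurableT_comp => //; exact: measurable_funD.
  - move=> t _ /=; rewrite lee_fin ge0_ler_powR ?nnegrE ?(ltW p0)//.
    rewrite normr_id [leRHS]ger0_norm ?addr_ge0//.
    by rewrite -{1}[f t](subrK (g t)) addrC ler_normD.
by apply: minkowski_EFin => //; exact: ltW.
Qed.

Lemma LpX_norm_le f (e : R) : 0 <= e -> (Np f <= (e `^ p)%:E)%E ->
  (LpX_norm P p f <= e%:E)%E.
Proof.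
move=> e0 H; rewrite LpX_normE.
have -> : e%:E = ((e `^ p)%:E `^ p^-1)%E.
  by rewrite poweR_EFin -powRrM mulfV ?gt_eqF// powRr1.
apply: gt0_ler_poweR => //; first by rewrite invr_ge0 ltW.
- by rewrite in_itv/= leey Np_ge0.
- by rewrite in_itv/= leey lee_fin powR_ge0.
Qed.

Lemma powR_sum3 (a b c : R) : 0 <= a -> 0 <= b -> 0 <= c ->
  (a + b + c) `^ p <= 3 `^ p * (a `^ p + b `^ p + c `^ p).
Proof.
move=> a0 b0 c0; pose m := Num.max a (Num.max b c).
have am : a <= m by rewrite le_max lexx.
have bm : b <= m by rewrite !le_max lexx orbT.
have cm : c <= m by rewrite !le_max lexx !orbT.
have m0 : 0 <= m := le_trans a0 am.
apply: (@le_trans _ _ ((3 * m) `^ p)).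
  by rewrite ge0_ler_powR ?nnegrE ?(ltW p0) ?addr_ge0 ?mulr_ge0//; lra.
rewrite powRM// ler_wpM2l ?powR_ge0//.
have := powR_ge0 a p; have := powR_ge0 b p; have := powR_ge0 c p.
rewrite /m; case: (leP b c) => _; case: (leP a _) => _; lra.
Qed.

Lemma dominated0 (phi : nat -> T -> R) (g : T -> R) (e : R) :
  (forall k, measurable_fun setT (phi k)) -> measurable_fun setT g ->
  (forall k x, 0 <= phi k x <= g x) -> (forall x, phi k x @[k --> \oo] --> 0) ->
  (\int[P]_x (g x)%:E < +oo)%E -> 0 < e ->
  exists k, (\int[P]_x (phi k x)%:E <= e%:E)%E.
Proof.
move=> mphi mg phig phi0 ig e0.
have g0 x : 0 <= g x by have /andP[a b] := phig 0%N x; exact: le_trans b.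
have /(_ _) H : (\int[P]_x (phi k x)%:E)%E @[k --> \oo] --> (\int[P]_x (cst 0%E x))%E.
  apply: (@dominated_cvg _ _ _ P setT measurableT (fun k x => (phi k x)%:E) (cst 0%E) (EFin \o g)) => //.
  - by move=> k; exact/measurable_EFinP.
  - by move=> x _; apply: cvg_EFin; [exact: nearW|exact: phi0].
  - apply/integrableP; split; first exact/measurable_EFinP.
    by under eq_integral do rewrite /= ger0_norm//.
  - by move=> k x _ /=; have /andP[a b] := phig k x; rewrite lee_fin ger0_norm.
rewrite integral0 in H.
have /fine_cvgP[fH] := H.
move=> /cvgrPdist_lt /(_ e e0) cH.
near \oo => k; exists k.
have fk : (\int[P]_x (phi k x)%:E)%E \is a fin_num by near: k; exact: fH.
rewrite -(fineK fk) lee_fin.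
have : `|0 - fine (\int[P]_x (phi k x)%:E)%E| < e by near: k; exact: cH.
by rewrite sub0r normrN => /ltW; apply: le_trans; exact: ler_norm.
Unshelve. all: by end_near. Qed.

End strong_measurability.

Section simple_approximation.
Context {R : realType} {X : normedModType R} d (T : measurableType d).
Variables (P : probability T R) (p : R).
Hypothesis p1 : 1 < p.
Implicit Types (f g s : T -> X).

Let p0 : 0 < p. Proof. exact: lt_trans p1. Qed.
Let sM := @measurable_sigma_algebra d T.

Local Notation smeas := (strongly_measurable (@measurable _ T)).

(** Depends continuously on [y], unlike setting large vectors to 0, so it preserves pointwise
    limits; it also keeps simple functions simple. *)
Definition truncate (M : R) (y : X) : X := (M / (M + `|y|)) *: y.

Lemma truncate_le M y : 0 < M -> `|truncate M y| <= M.
Proof.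
move=> M0; have My : 0 < M + `|y| by rewrite ltr_wpDr.
rewrite normrZ ger0_norm ?divr_ge0 ?(ltW M0) ?(ltW My)//.
rewrite -[leRHS]mulr1 -mulrA ler_wpM2l ?(ltW M0)// mulrC ler_pdivrMr// mul1r.
by rewrite lerDr ltW.
Qed.

Lemma truncate_dist M y : 0 < M -> `|y - truncate M y| <= `|y| ^+ 2 / M.
Proof.
move=> M0; have My : 0 < M + `|y| by rewrite ltr_wpDr.
have -> : y - truncate M y = (`|y| / (M + `|y|)) *: y.
  rewrite -{1}[y]scale1r -scalerBl; congr (_ *: _).
  by field; rewrite gt_eqF.
rewrite normrZ ger0_norm ?divr_ge0 ?(ltW My)//.
rewrite mulrAC -expr2 ler_wpM2l ?sqr_ge0// lef_pV2 ?posrE//.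
by rewrite lerDl.
Qed.

Lemma truncate_dist_le M y : 0 < M -> `|y - truncate M y| <= `|y|.
Proof.
move=> M0; have My : 0 < M + `|y| by rewrite ltr_wpDr.
have -> : y - truncate M y = (`|y| / (M + `|y|)) *: y.
  rewrite -{1}[y]scale1r -scalerBl; congr (_ *: _).
  by field; rewrite gt_eqF.
rewrite normrZ ger0_norm ?divr_ge0 ?(ltW My)//.
by rewrite ler_piMl// ler_pdivrMr// mul1r lerDr ltW.
Qed.

Lemma truncate_cvg M (s : nat -> X) (y : X) : 0 < M -> s k @[k --> \oo] --> y ->
  truncate M (s k) @[k --> \oo] --> truncate M y.
Proof.
move=> M0 sy; apply: cvgZ => //; apply: cvgM; first exact: cvg_cst.
apply: cvgV; first by rewrite gt_eqF// ltr_wpDr.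
by apply: cvgD; [exact: cvg_cst|exact: cvg_norm].
Qed.

Lemma powR_cvg0_norm (s : nat -> X) : s k @[k --> \oo] --> 0 ->
  `|s k| `^ p @[k --> \oo] --> (0 : R).
Proof.
move=> s0; have := @continuous_powR R p p0 0.
rewrite /continuous_at normr0 powR0 ?gt_eqF// => c0.
have -> : (fun k => `|s k| `^ p) = (fun x : R => `|x| `^ p) \o (fun k => `|s k|).
  by apply/funext => k /=; rewrite normr_id.
apply: (cvg_comp _ _ _ c0).
by rewrite -(@normr0 _ X); exact: cvg_norm.
Qed.

(** The simple functions in [strongly_measurable] converge pointwise, without a common bound.
    Truncating [f] at a high level costs little, by domination by [f] itself; once truncated at this
    level, the simple functions are dominated by a constant. *)
Lemma simple_approx G f (e : R) : sigma_algebra setT G -> G `<=` measurable ->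
  strongly_measurable G f -> (Np P p f < +oo)%E -> 0 < e ->
  exists2 s, simple_function G s & (Np P p (fun x => (s x - f x)%R) <= e%:E)%E.
Proof.
move=> sG GM sGf fp e0.
have sf := strongly_measurable_sub GM sGf.
pose c := 3 `^ p : R.
have c0 : 0 < c by rewrite powR_gt0.
(* Two such errors will be added, each multiplied by [c] from the inequality for three summands, the
   third being 0. *)
have e'0 : 0 < e / (2 * c) by rewrite divr_gt0// mulr_gt0.
have [r [sr rf]] := sGf.
have str M : 0 < M -> smeas (fun x => truncate M (f x)).
  move=> M0; exists (fun k x => truncate M (r k x)); split.
    by move=> k; apply: (fibered_sub GM); exact: (@fibered_comp _ _ X X (r k) (truncate M) sG (sr k)).
  by move=> x; apply: truncate_cvg.
have [K HK] : exists K : nat,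
    (\int[P]_x (`|f x - truncate K.+1%:R (f x)| `^ p)%:E <= (e / (2 * c))%:E)%E.
  apply: (@dominated0 _ _ _ P _ (fun x => `|f x| `^ p)) => //.
  - move=> k; apply/measurable_EFinP; apply: strongly_measurable_powR => //.
    by apply: strongly_measurableB => //; apply: str; rewrite ltr0n.
  - by apply/measurable_EFinP; exact: strongly_measurable_powR.
  - move=> k x; rewrite powR_ge0/= ge0_ler_powR ?nnegrE ?(ltW p0)//.
    by apply: truncate_dist_le; rewrite ltr0n.
  - move=> x; apply: powR_cvg0_norm; apply/cvgr0Pnorm_lt => e1 e10.
    near=> k; apply: (le_lt_trans (truncate_dist _ _)); first by rewrite ltr0n.
    rewrite ltr_pdivrMr ?ltr0n// mulrC -ltr_pdivrMr//.
    apply: (@lt_trans _ _ k%:R); last by rewrite ltr_nat.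
    by near: k; exact: nbhs_infty_gtr.
pose M : R := K.+1%:R.
have M0 : 0 < M by rewrite ltr0n.
have {}str := str M M0.
have [k Hk] : exists k : nat,
    (\int[P]_x (`|truncate M (r k x) - truncate M (f x)| `^ p)%:E <= (e / (2 * c))%:E)%E.
  apply: (@dominated0 _ _ _ P _ (fun x => (M + M) `^ p) _ _ _ _ _ _ e'0).
  - move=> k; apply/measurable_EFinP; apply: strongly_measurable_powR => //.
    apply: strongly_measurableB => //; apply: strongly_measurable_simple.
    by apply: (fibered_sub GM); exact: (@fibered_comp _ _ X X (r k) (truncate M) sG (sr k)).
  - exact: measurable_cst.
  - move=> k x; rewrite powR_ge0/= ge0_ler_powR ?nnegrE ?addr_ge0 ?(ltW p0) ?(ltW M0)//.
    by apply: (le_trans (ler_normB _ _)); rewrite lerD// truncate_le.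
  - move=> x; apply: powR_cvg0_norm.
    rewrite -(subrr (truncate M (f x))); apply: cvgB; last exact: cvg_cst.
    exact: truncate_cvg.
  - by rewrite (integral_cst P measurableT ((M + M) `^ p)%:E) lte_mul_pinfty ?lee_fin ?powR_ge0// -ge0_fin_numE ?fin_num_measure.
exists (fun x => truncate M (r k x)).
  exact: (@fibered_comp _ _ X X (r k) (truncate M) sG (sr k)).
have sr' : smeas (fun x => truncate M (r k x)).
  apply: strongly_measurable_simple; apply: (fibered_sub GM).
  exact: (@fibered_comp _ _ X X (r k) (truncate M) sG (sr k)).
apply: (@le_trans _ _ (\int[P]_x (c%:E * ((`|truncate M (r k x) - truncate M (f x)| `^ p)%:E +
    (`|f x - truncate M (f x)| `^ p)%:E))%E)%E).
  apply: ge0_le_integral => //.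
  - by apply: strongly_measurable_powR => //; exact: strongly_measurableB.
  - apply: measurable_funeM; apply: emeasurable_funD;
      by apply: strongly_measurable_powR => //; exact: strongly_measurableB.
  - move=> x _; rewrite -EFinD -EFinM lee_fin.
    apply: (@le_trans _ _ ((`|truncate M (r k x) - truncate M (f x)| + `|f x - truncate M (f x)| + 0) `^ p)).
      rewrite ge0_ler_powR ?nnegrE ?addr_ge0 ?(ltW p0)// addr0.
      by rewrite (distrC (f x)) ler_distD.
    apply: (le_trans (powR_sum3 p1 _ _ _)) => //.
    by rewrite powR0 ?gt_eqF// addr0.
rewrite ge0_integralZl//; last 3 first.
- by apply: emeasurable_funD; apply: strongly_measurable_powR => //; exact: strongly_measurableB.
- by move=> x _; rewrite adde_ge0// lee_fin powR_ge0.
- by rewrite lee_fin ltW.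
rewrite ge0_integralD//; last 2 first.
- by apply: strongly_measurable_powR => //; exact: strongly_measurableB.
- by apply: strongly_measurable_powR => //; exact: strongly_measurableB.
apply: (@le_trans _ _ (c%:E * ((e / (2 * c))%:E + (e / (2 * c))%:E))%E).
  by apply: lee_wpmul2l; [rewrite lee_fin ltW|exact: leeD].
by rewrite -EFinD -EFinM lee_fin; rewrite le_eqVlt; apply/orP; left; apply/eqP; field; rewrite gt_eqF.
Unshelve. all: by end_near. Qed.

End simple_approximation.

Section Bochner_bound.
Context {R : realType} {X : normedModType R} d (T : measurableType d).
Variables (P : probability T R).
Implicit Types (f g s t : T -> X).
Let sM := @measurable_sigma_algebra d T.
Local Notation smeas := (strongly_measurable (@measurable _ T)).
Local Notation simple := (simple_function (@measurable _ T)).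

Lemma fibered_indic_scale A (Z : choiceType) (q : T -> Z) (h : Z -> X) :
  measurable A -> fibered measurable q -> simple (fun x => \1_A x *: h (q x)).
Proof.
move=> mA fp; apply: (@fibered_comp2 _ _ R Z X (\1_A) q (fun b z => b *: h z) sM) => //.
split; last first.
  by move=> z; rewrite -[_ @^-1` _]setTI; apply: measurable_indic.
apply: (@sub_finite_set _ _ [set 0; 1]); last exact: finite_set2.
by move=> _ [x _ <-]; rewrite indicE; case: (x \in A); [right|left].
Qed.

(** The fibers of [q] may be finer than the level sets of the function, as [h] need not be
    injective; two simple functions can thus be integrated over common fibers. *)
Lemma simple_integral_fibered A (Z : choiceType) (q : T -> Z) (h : Z -> X) :
  measurable A -> fibered measurable q ->
  simple_integral P (fun x => \1_A x *: h (q x)) =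
  \sum_(z <- fset_set (range q)) fine (P (A `&` q @^-1` [set z])) *: h z.
Proof.
move=> mA fp; have [fq mq] := fp.
have [fg mg] := fibered_indic_scale h mA fp.
set g := (fun x => _) in fg mg *.
rewrite /simple_integral fsbig_finite//.
pose F y z := if h z == y then fine (P (A `&` q @^-1` [set z])) else 0.
have PE y : fine (P (g @^-1` [set y])) *: y = \sum_(z <- fset_set (range q)) F y z *: y.
  have [->|y0] := eqVneq y 0.
    by rewrite scaler0 big1// => z _; rewrite scaler0.
  rewrite -scaler_suml; congr (_ *: _).
  have -> : P (g @^-1` [set y]) = (\int[P]_(x in g @^-1` [set y]) cst 1%E x)%E.
    by rewrite integral_cst// mul1e.
  rewrite (ge0_integral_fibers P fp)//.
  rewrite (_ : (\sum_(z <- fset_set (range q)) _)%E = (\sum_(z <- fset_set (range q)) (F y z)%:E)%E).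
    by rewrite sumEFin.
  apply: eq_bigr => z _; rewrite integral_cst; last exact: measurableI.
  rewrite mul1e /F; case: eqP => [hz|hz].
    rewrite fineK ?fin_num_measure//; last exact: measurableI.
    congr (P _); apply/seteqP; split => x [/= gx qx]; split => //=.
      apply: contrapT => nA; move: gx; rewrite /g indicE memNset// scale0r => y0'.
      by rewrite -y0' eqxx in y0.
    by rewrite /g indicE mem_set// scale1r qx.
  rewrite (_ : _ `&` _ = set0) ?measure0//; apply/seteqP; split => // x [/= gx qx].
  have [xA|xA] := pselect (A x).
    by apply: hz; move: gx; rewrite /g indicE mem_set// scale1r qx.
  by move: gx; rewrite /g indicE memNset// scale0r => y0'; rewrite -y0' eqxx in y0.
under eq_bigr do rewrite PE.
rewrite exchange_big/= big_seq [RHS]big_seq; apply: eq_bigr => z.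
rewrite in_fset_set// => /set_mem[x _ zE].
have [hz|hz] := boolP (h z \in fset_set (range g)).
  rewrite (bigD1_seq (h z)) ?fset_uniq//= /F eqxx big1 ?addr0// => y /negPf yz.
  by rewrite eq_sym yz scale0r.
rewrite (_ : A `&` _ = set0) ?measure0 ?scale0r; last first.
  apply/seteqP; split => // x' [Ax' /= qx']; case/negP: hz.
  rewrite in_fset_set//; apply/mem_set; exists x' => //.
  by rewrite /g indicE mem_set// scale1r qx'.
rewrite big1_seq// => y /andP[_ yg]; rewrite /F; case: eqP => [hzy|]; last by rewrite scale0r.
by rewrite hzy yg in hz.
Qed.

Lemma simple_integral_comp (Z : choiceType) (q : T -> Z) (h : Z -> X) :
  fibered measurable q ->
  simple_integral P (h \o q) = \sum_(z <- fset_set (range q)) fine (P (q @^-1` [set z])) *: h z.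
Proof.
move=> fp; have := simple_integral_fibered h measurableT fp.
rewrite (_ : (fun x => _) = h \o q); last by apply/funext => x; rewrite indicT scale1r.
by move=> ->; apply: eq_bigr => z _; rewrite setTI.
Qed.

Lemma simple_integral_dist s t : simple s -> simple t ->
  (`|simple_integral P s - simple_integral P t|%:E <= \int[P]_x (`|s x - t x|)%:E)%E.
Proof.
move=> ss st.
pose q x := (s x, t x).
have fp : fibered measurable q := @fibered_pair _ _ X X s t sM ss st.
rewrite (simple_integral_comp (fst : X * X -> X) fp).
rewrite (simple_integral_comp (snd : X * X -> X) fp) -sumrB.
rewrite (ge0_integral_fibers P fp)//; last first.
  apply/measurable_EFinP.
  exact: (@fibered_measurable_fun _ _ _ _ _ _ (fun z : X * X => `|z.1 - z.2|) fp).
apply: (@le_trans _ _ (\sum_(z <- fset_set (range q))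
   (fine (P (q @^-1` [set z])) * `|z.1 - z.2|)%:E)%E).
  rewrite sumEFin lee_fin; apply: (le_trans (ler_norm_sum _ _ _)).
  apply: ler_sum => z _; rewrite -scalerBr normrZ ger0_norm//.
  by rewrite fine_ge0.
have [_ mq] := fp.
apply: lee_sum => z _; rewrite setTI.
rewrite (@eq_integral _ _ _ P _ (cst (`|z.1 - z.2|)%:E)); last first.
  by move=> x /set_mem /= <-.
by rewrite integral_cst// EFinM muleC fineK// fin_num_measure.
Qed.

(** The bound for two simple functions passes to the limit along the simple functions that define
    the Bochner integral. *)
Lemma Bochner_dist f v s : is_Bochner_integral P f v -> simple s ->
  (`|simple_integral P s - v|%:E <= \int[P]_x (`|s x - f x|)%:E)%E.
Proof.
move=> [sf [u [su uf uv]]] ss.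
have sms := strongly_measurable_simple ss.
have smu k := strongly_measurable_simple (su k).
set L := (\int[P]_x (`|s x - f x|)%:E)%E.
have H k : (`|simple_integral P s - simple_integral P (u k)|%:E <= L + \int[P]_x (`|f x - u k x|)%:E)%E.
  apply: (le_trans (simple_integral_dist ss (su k))).
  rewrite -ge0_integralD//; last 2 first.
  - by apply/measurable_EFinP/strongly_measurable_norm/strongly_measurableB.
  - by apply/measurable_EFinP/strongly_measurable_norm/strongly_measurableB.
  apply: ge0_le_integral => //.
  - by apply/measurable_EFinP/strongly_measurable_norm/strongly_measurableB.
  - apply: emeasurable_funD;
      by apply/measurable_EFinP/strongly_measurable_norm/strongly_measurableB.
  - by move=> x _; rewrite -EFinD lee_fin ler_distD.
have L0 : (0 <= L)%E by exact: integral_ge0.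
have cv : (L + \int[P]_x (`|f x - u k x|)%:E)%E @[k --> \oo] --> (L + 0)%E.
  have L0' : (L +? 0)%E by exact: fin_num_adde_defl.
  exact: (cvgeD L0' (cvg_cst L) uf).
rewrite adde0 in cv.
apply: (lee_cvg_to _ cv); last first.
  by apply: nearW => k; exact: H.
apply: cvg_EFin; first exact: nearW.
by apply: cvg_norm; apply: cvgB => //; exact: cvg_cst.
Qed.

Lemma Bochner_cst0 (A : set T) v :
  is_Bochner_integral_on P A (cst 0 : T -> X) v -> v = 0.
Proof.
move=> H; have s0 : simple (cst 0) := @fibered_cst _ _ X 0 sM.
have := Bochner_dist H s0.
rewrite (@eq_integral _ _ _ P _ (cst 0%E)); last first.
  by move=> x _; rewrite /= scaler0 subrr normr0.
have -> : simple_integral P (cst 0 : T -> X) = 0.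
  rewrite /simple_integral fsbig1// => y [x _ <-]; exact: scaler0.
by rewrite integral0 sub0r normrN lee_fin normr_le0 => /eqP.
Qed.

(** The common value [v] is 0, being an integral of 0. So the integral of [s] over [A] consists of
    approximation error only. *)
Lemma centered_mean (A : set T) (D s : T -> X) : measurable A ->
  (exists v, is_Bochner_integral_on P A D v /\ is_Bochner_integral_on P A (cst 0) v) ->
  simple s ->
  (`|\sum_(y <- fset_set (range s)) fine (P (A `&` s @^-1` [set y])) *: y|%:E <=
   \int[P]_(x in A) (`|s x - D x|)%:E)%E.
Proof.
move=> mA [v [HD H0]] ss.
have v0 := Bochner_cst0 H0; rewrite {v}v0 in HD {H0}.
have sA := fibered_indic_scale (idfun : X -> X) mA ss.
have := Bochner_dist HD sA.
rewrite subr0 (simple_integral_fibered (idfun : X -> X) mA ss) => /le_trans; apply.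
rewrite [leRHS]integral_mkcond le_eqVlt; apply/orP; left; apply/eqP.
apply: eq_integral => x _; rewrite patchE/= indicE.
by case: (x \in A); rewrite ?scale1r ?scale0r ?subrr ?normr0.
Qed.

End Bochner_bound.

Section Jensen.
Context {R : realType} d (T : measurableType d).
Variables (P : probability T R) (p : R).
Hypothesis p1 : 1 < p.

Let p0 : 0 < p. Proof. exact: lt_trans p1. Qed.

(** The tangent of the p-th power at [t], integrated over [A]; nothing is divided by [P A], which
    may be 0. *)
Lemma Jensen_bound A (phi : T -> R) (t : R) : measurable A -> 0 <= t ->
  measurable_fun setT phi -> (forall x, 0 <= phi x) ->
  (t%:E * P A <= \int[P]_(x in A) (phi x)%:E)%E ->
  ((t `^ p)%:E * P A <= \int[P]_(x in A) (phi x `^ p)%:E)%E.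
Proof.
move=> mA t0 mphi phi0 H; have q0 : 0 < p - 1 by rewrite subr_gt0.
have mphiA : measurable_fun A (EFin \o phi).
  by apply/measurable_EFinP; exact: measurable_funTS.
have mphip : measurable_fun A (EFin \o (fun x => phi x `^ p)).
  apply/measurable_EFinP/measurable_funTS.
  exact: (measurableT_comp (measurable_powR p)).
pose c := p * t `^ (p - 1).
have c0 : 0 <= c by rewrite mulr_ge0 ?powR_ge0 ?ltW.
have tp : c * t = t `^ p + (p - 1) * t `^ p.
  have -> : t `^ p = t * t `^ (p - 1) by rewrite mulr_powRB1.
  by rewrite /c; ring.
have q0' : 0 <= (p - 1) * t `^ p by rewrite mulr_ge0 ?powR_ge0 ?ltW.
have fPA : P A \is a fin_num by exact: fin_num_measure.
have E1 : (c%:E * \int[P]_(x in A) (phi x)%:E <=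
    \int[P]_(x in A) (phi x `^ p)%:E + ((p - 1) * t `^ p)%:E * P A)%E.
  rewrite -ge0_integralZl ?lee_fin//; last by move=> x _; rewrite lee_fin.
  rewrite -integral_cst// -ge0_integralD//; last by move=> x _; rewrite lee_fin powR_ge0.
  apply: ge0_le_integral => //.
  - by move=> x _; rewrite mule_ge0 ?lee_fin.
  - exact: measurable_funeM.
  - exact: emeasurable_funD.
  - move=> x _; rewrite -EFinM -EFinD lee_fin.
    have := powR_tangent p1 (phi0 x) t0; rewrite -/c mulrBr tp; lra.
have E2 : (c%:E * (t%:E * P A) <= c%:E * \int[P]_(x in A) (phi x)%:E)%E.
  by apply: lee_wpmul2l => //; rewrite lee_fin.
have := le_trans E2 E1.
rewrite muleA -EFinM tp EFinD ge0_muleDl ?lee_fin ?powR_ge0//.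
by rewrite leeD2rE// fin_numM.
Qed.

End Jensen.

Section martingale_trees.
Context {R : realType} {X : normedModType R} d (T : measurableType d).
Variables (P : probability T R) (p : R).
Hypothesis p1 : 1 < p.
Variables (F : nat -> set_system T) (r : nat) (sg : nat -> bool) (D : nat -> T -> X).
Hypothesis filtF : filtration F.
Hypothesis DF : forall i, strongly_measurable (F i.+1) (D i).
Hypothesis DLp : forall i, (Np P p (D i) < +oo)%E.
Hypothesis Dcentered : forall i, (i < r)%N -> forall A, F i A ->
  exists v, is_Bochner_integral_on P A (D i) v /\ is_Bochner_integral_on P A (cst 0) v.

Let p0 : 0 < p. Proof. exact: lt_trans p1. Qed.
Let sM := @measurable_sigma_algebra d T.
Local Notation smeas := (strongly_measurable (@measurable _ T)).
Local Notation simple := (simple_function (@measurable _ T)).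

Let FM i : F i `<=` measurable. Proof. by case: (filtF i). Qed.
Let sF i : sigma_algebra setT (F i). Proof. by case: (filtF i). Qed.
Let FS i : F i `<=` F i.+1. Proof. by case: (filtF i). Qed.
Let smD i : smeas (D i). Proof. exact: strongly_measurable_sub (DF i). Qed.

Definition Np_on A (f : T -> X) : \bar R := (\int[P]_(x in A) (`|f x| `^ p)%:E)%E.

Lemma measurable_Np_on A (f : T -> X) : smeas f -> measurable_fun A (fun x => (`|f x| `^ p)%:E).
Proof. by move=> sf; apply: measurable_funTS; exact: strongly_measurable_powR. Qed.

Lemma Np_on_le A f : measurable A -> smeas f -> (Np_on A f <= Np P p f)%E.
Proof.
move=> mA sf; apply: ge0_subset_integral => //.
exact: strongly_measurable_powR.
Qed.

Lemma Np_on_sum3 A (f g h : T -> X) (u : T -> X) : measurable A ->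
  smeas f -> smeas g -> smeas h -> smeas u ->
  (forall x, A x -> `|u x| <= `|f x| + `|g x| + `|h x|) ->
  (Np_on A u <= (3 `^ p)%:E * (Np_on A f + Np_on A g + Np_on A h))%E.
Proof.
move=> mA sf sg' sh su H.
have mf := @measurable_Np_on A f sf; have mg := @measurable_Np_on A g sg'.
have mh := @measurable_Np_on A h sh; have mu := @measurable_Np_on A u su.
rewrite -ge0_integralD//.
rewrite -ge0_integralD//; last 2 first.
- by move=> x _; rewrite adde_ge0 ?lee_fin ?powR_ge0.
- exact: emeasurable_funD.
rewrite -ge0_integralZl//; last 2 first.
- by apply: emeasurable_funD => //; exact: emeasurable_funD.
- by move=> x _; rewrite !adde_ge0 ?lee_fin ?powR_ge0.
apply: ge0_le_integral => //.
- apply: measurable_funeM; apply: emeasurable_funD => //; exact: emeasurable_funD.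
- move=> x Ax; rewrite -!EFinD -EFinM lee_fin.
  apply: le_trans (powR_sum3 p1 _ _ _) => //.
  by rewrite ge0_ler_powR ?nnegrE ?addr_ge0 ?(ltW p0)// H.
Qed.

(** The identity says that the end of the zigzag has the law of [(f, g)] under [P] conditioned on
    [A], written without division by [P A]. As [f] and [g] are simple, [Psi] can be any nonnegative
    function. *)
Definition tree_model i A (e : R) := exists t (f g : T -> X), [/\ wf_tree t, simple f, simple g,
  forall Psi : X -> X -> R, (forall a c, 0 <= Psi a c) -> forall a c,
    (P A * (tree_mean Psi t a c)%:E = \int[P]_(x in A) (Psi (a + f x) (c + g x))%:E)%E &
  (Np_on A (fun x => f x - \sum_(i <= j < r) (-1) ^+ sg j *: D j x)%R <= e%:E)%E /\
  (Np_on A (fun x => g x - \sum_(i <= j < r) D j x)%R <= e%:E)%E].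

(** Induction on the number [k] of remaining differences. [D i] is replaced by a simple [s],
    measurable at time [i + 1]; on each part of [A] where [s] is constant the induction hypothesis
    gives a tree, and [kary_split] joins these. Tree increments have mean zero, so [s] is corrected
    by its mean [m] over [A], which is small because [D i] is centered. *)
Lemma martingale_tree k i A e : (i + k = r)%N -> F i A -> 0 < e -> tree_model i A e.
Proof.
elim: k i A e => [|k ih] i A e ik FA e0.
  have s0 : simple (cst 0 : T -> X) by exact: (@fibered_cst _ _ X).
  have ri : i = r by rewrite -ik addn0.
  exists (Leaf : tree X), (cst 0), (cst 0); split=> //.
    move=> Psi Psi0 a c /=; rewrite !addr0 integral_cst; last exact: FM FA.
    by rewrite muleC.
  by split; rewrite /Np_on integral0_eq ?lee_fin ?(ltW e0)// => x _;
    rewrite ri big_geq// subr0 normr0 powR0 ?gt_eqF.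
have ir : (i < r)%N by rewrite -ik -addSnnS leq_addr.
have mA : measurable A := FM FA.
have sD1 : smeas (fun x => \sum_(i <= j < r) (-1) ^+ sg j *: D j x).
  apply: strongly_measurable_sum => j; apply: strongly_measurableZ => //.
  exact: fibered_cst.
have sD2 : smeas (fun x => \sum_(i <= j < r) D j x) by exact: strongly_measurable_sum.
(* On a null event any tree will do; otherwise the mean over [A] can be formed. *)
have [PA0|PA0] := eqVneq (P A) 0%E.
  have s0 : simple (cst 0 : T -> X) by exact: (@fibered_cst _ _ X).
  exists (Leaf : tree X), (cst 0), (cst 0); split=> //.
    move=> Psi Psi0 a c /=; rewrite PA0 mul0e null_set_integral//.
  by split; rewrite /Np_on null_set_integral ?lee_fin ?(ltW e0)//;
    apply: measurable_Np_on; apply: strongly_measurableB => //;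
    exact: strongly_measurable_cst.
have PAp : 0 < fine (P A).
  by rewrite fine_gt0// lt0e PA0 measure_ge0/= ltey_eq fin_num_measure.
pose c := 3 `^ p : R.
have c0 : 0 < c by rewrite powR_gt0.
(* Three errors are added, each weighted by [c]: the approximation of [D i] by [s], the correction
   [m], and the later differences. *)
pose e1 := e / (3 * c); have e10 : 0 < e1 by rewrite divr_gt0// mulr_gt0.
have [s ss sD] := simple_approx p1 (sF i.+1) (@FM i.+1) (DF i) (DLp i) e10.
have ssM : simple s := @fibered_sub _ _ _ X _ (@FM i.+1) ss.
have smsM := strongly_measurable_simple ssM.
pose Y := fset_set (range s); pose n := size Y.
(* The errors on the [n] pieces add up to at most [e1]; [n.+1] keeps the divisor positive. *)
pose e2 := e1 / n.+1%:R; have e20 : 0 < e2 by rewrite divr_gt0// ltr0n.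
pose Ay y := A `&` s @^-1` [set y].
have FAy y : F i.+1 (Ay y).
  by apply: sigma_setI => //; [exact: FS|case: ss].
have mAy y : measurable (Ay y) := FM (FAy y).
have Hy y : tree_model i.+1 (Ay y) e2 by apply: ih; rewrite // -ik addSnnS.
have [tt {}Hy] := choice Hy.
have [ff {}Hy] := choice Hy.
have [gg {}Hy] := choice Hy.
have wt y : wf_tree (tt y) by case: (Hy y).
have sff y : simple (ff y) by case: (Hy y).
have sgg y : simple (gg y) by case: (Hy y).
pose mu y := fine (P (Ay y)).
have fs : finite_set (range s) by case: ss.
have PAE : (\sum_(y <- Y) mu y)%R = fine (P A).
  have : P A = (\int[P]_(x in A) cst 1%E x)%E by rewrite integral_cst// mul1e.
  rewrite (ge0_integral_fibers P ssM)// => ->.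
  rewrite (_ : (\sum_(z <- _) _)%E = (\sum_(z <- Y) (mu z)%:E)%E); first by rewrite sumEFin.
  apply: eq_bigr => z _; rewrite integral_cst//; last exact: mAy.
  by rewrite mul1e /mu fineK// fin_num_measure//; exact: mAy.
pose l := [seq (mu y, y, tt y) | y <- Y].
have Hl b : List.In b l -> 0 <= b.1.1 /\ wf_tree b.2.
  by move=> /List.in_map_iff[y [<- _]]; split; [exact: fine_ge0|exact: wt].
have lM : \sum_(b <- l) b.1.1 = fine (P A) by rewrite big_map.
have := @kary_split R X (sg i) l Hl.
rewrite lM !big_map /= => /(_ PAp)[t wt' Ht].
set m := (fine (P A))^-1 *: _ in Ht.
pose f x := (-1) ^+ sg i *: (s x - m) + ff (s x) x.
pose g x := (s x - m) + gg (s x) x.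
have sim (b : bool) (h : X -> T -> X) : (forall y, simple (h y)) ->
    simple (fun x => (-1) ^+ b *: (s x - m) + h (s x) x).
  move=> sh; pose hh y x := (-1) ^+ b *: (y - m) + h y x.
  apply: (@fibered_glue _ _ X X s hh sM ssM) => y.
  exact: (@fibered_comp _ _ X X (h y) (fun z => (-1) ^+ b *: (y - m) + z) sM (sh y)).
have sf : simple f by exact: sim.
have sg' : simple g by have := sim false gg sgg; under eq_fun do rewrite expr0 scale1r.
have mDA : ((`|m| `^ p)%:E * P A <= e1%:E)%E.
  apply: (@le_trans _ _ (\int[P]_(x in A) (`|s x - D i x| `^ p)%:E)%E).
    apply: (Jensen_bound p1 mA) => //.
      by apply: strongly_measurable_norm; exact: strongly_measurableB.
    have := centered_mean mA (Dcentered ir FA) ssM.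
    rewrite -/Y /m; set v := \sum_(y <- Y) _ => vle.
    apply: le_trans vle; rewrite normrZ ger0_norm ?invr_ge0 ?(ltW PAp)//.
    rewrite -[P A]fineK ?fin_num_measure// -EFinM lee_fin.
    by rewrite mulrAC mulVf ?mul1r// gt_eqF.
  apply: (le_trans _ sD); apply: Np_on_le => //; exact: strongly_measurableB.
have err (b : bool) (h : X -> T -> X) (S : T -> X) : (forall y, simple (h y)) -> smeas S ->
    (forall y, (Np_on (Ay y) (fun x => h y x - S x)%R <= e2%:E)%E) ->
    (Np_on A (fun x => ((-1) ^+ b *: (s x - m) + h (s x) x) - ((-1) ^+ b *: D i x + S x))%R <= e%:E)%E.
  move=> sh sS hS.
  have shs : smeas (fun x => h (s x) x).
    by apply: strongly_measurable_simple; exact: (@fibered_glue _ _ X X s h sM ssM).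
  have sb (u : T -> X) : smeas u -> smeas (fun x => (-1) ^+ b *: u x).
    by move=> su; apply: strongly_measurableZ => //; exact: fibered_cst.
  have N3 : (Np_on A (fun x => h (s x) x - S x)%R <= e1%:E)%E.
    rewrite /Np_on (ge0_integral_fibers P ssM)//; last first.
      by apply: measurable_Np_on; exact: strongly_measurableB.
    apply: (@le_trans _ _ (\sum_(y <- Y) e2%:E)%E).
      apply: lee_sum => y _; apply: le_trans (hS y).
      rewrite le_eqVlt; apply/orP; left; apply/eqP.
      by apply: eq_integral => x /set_mem[_ /= ->].
    rewrite sumEFin lee_fin big_const_seq count_predT iter_addr_0 -/n.
    by rewrite -mulr_natr /e2 mulrAC ler_pdivrMr ?ltr0n// ler_pM2l// ler_nat.
  apply: (le_trans (@Np_on_sum3 A (fun x => s x - D i x) (cst m) (fun x => h (s x) x - S x) _ mA _ _ _ _ _)).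
  - exact: strongly_measurableB.
  - exact: strongly_measurable_cst.
  - exact: strongly_measurableB.
  - apply: strongly_measurableB; apply: strongly_measurableD => //; apply: sb => //.
    by apply: strongly_measurableB => //; exact: strongly_measurable_cst.
  - move=> x _.
    rewrite (_ : _ - _ = (-1) ^+ b *: (s x - D i x) + ((-1) ^+ b *: (- m)) + (h (s x) x - S x)).
      apply: (le_trans (ler_normD _ _)); rewrite lerD2r.
      apply: (le_trans (ler_normD _ _)).
      have nb (z : X) : `|(-1) ^+ b *: z| = `|z|.
        by rewrite normrZ normrX normrN1 expr1n mul1r.
      by rewrite !nb normrN.
    rewrite -scalerDr opprD addrACA -scalerBr; congr (_ *: _ + _).
    by rewrite -!addrA [- m - _]addrC.
  - apply: (@le_trans _ _ (c%:E * (e1%:E + e1%:E + e1%:E))%E).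
      apply: lee_wpmul2l; first by rewrite lee_fin ltW.
      apply: leeD => //; apply: leeD.
        by apply: (le_trans _ sD); apply: Np_on_le => //; exact: strongly_measurableB.
      by rewrite /Np_on (integral_cst P mA (`|m| `^ p)%:E).
    rewrite -!EFinD -EFinM lee_fin le_eqVlt; apply/orP; left; apply/eqP.
    by rewrite /e1; field; rewrite gt_eqF.
exists t, f, g; split=> //.
  move=> Psi Psi0 a c'.
  (* [kary_split] starts its tree at a point shifted by [m]; this base point undoes the shift. *)
  have := Ht Psi (a - (-1) ^+ sg i *: m) (c' - m).
  rewrite !subrK big_map /= => E.
  rewrite -[P A]fineK ?fin_num_measure// -EFinM E -sumEFin.
  rewrite (ge0_integral_fibers P ssM)//; last 2 first.
  - apply: measurable_funTS; apply/measurable_EFinP.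
    have fgp := @fibered_pair _ _ X X f g sM sf sg'.
    exact: (@fibered_measurable_fun _ _ _ _ _ _ (fun z : X * X => Psi (a + z.1) (c' + z.2)) fgp).
  - by move=> x; rewrite lee_fin.
  apply: eq_bigr => y _.
  have [_ _ _ Hy1 _] := Hy y.
  rewrite EFinM /mu fineK ?fin_num_measure//.
  rewrite Hy1//; apply: eq_integral => x /set_mem[_ /= sx].
  by rewrite /f /g sx scalerBr !addrA [a - _ + _]addrAC [c' - _ + _]addrAC.
split.
- have H1 y : (Np_on (Ay y) (fun x => ff y x - \sum_(i.+1 <= j < r) (-1) ^+ sg j *: D j x)%R <= e2%:E)%E.
    by have [_ _ _ _ [H _]] := Hy y.
  have := err (sg i) ff _ sff _ H1.
  under [in X in _ -> X]eq_fun do rewrite big_ltn//.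
  apply; apply: strongly_measurable_sum => j; apply: strongly_measurableZ => //.
  exact: fibered_cst.
- have H1 y : (Np_on (Ay y) (fun x => gg y x - \sum_(i.+1 <= j < r) D j x)%R <= e2%:E)%E.
    by have [_ _ _ _ [_ H]] := Hy y.
  rewrite (_ : (fun x => _) = (fun x => (-1) ^+ false *: (s x - m) + gg (s x) x -
      ((-1) ^+ false *: D i x + \sum_(i.+1 <= j < r) D j x))); last first.
    by apply/funext => x; rewrite big_ltn// !scale1r.
  apply: (err false gg _ sgg _ H1); exact: strongly_measurable_sum.
Qed.

End martingale_trees.

(** * From the tree inequality to the UMD bound *)

Section tree_models.
Context {R : realType} {X : normedModType R} (p Q : R).
Hypotheses (p1 : 1 < p) (Q0 : 0 <= Q).
Hypothesis tree_bound : forall t : tree X, wf_tree t ->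
  \sum_(b <- leaves t) lprob b * `|lfst b| `^ p <=
  Q `^ p * \sum_(b <- leaves t) lprob b * `|lsnd b| `^ p.

Let p0 : 0 < p. Proof. exact: lt_trans p1. Qed.

Lemma martingale_bound d (T : measurableType d) (P : probability T R)
    (F : nat -> set_system T) (r : nat) (sg : nat -> bool) (D : nat -> T -> X) :
  filtration F -> (forall i, strongly_measurable (F i.+1) (D i)) ->
  (forall i, (Np P p (D i) < +oo)%E) ->
  (forall i, (i < r)%N -> forall A, F i A ->
    exists v, is_Bochner_integral_on P A (D i) v /\ is_Bochner_integral_on P A (cst 0) v) ->
  (LpX_norm P p (fun x => \sum_(0 <= i < r) (-1) ^+ sg i *: D i x)%R
    <= Q%:E * LpX_norm P p (fun x => \sum_(0 <= i < r) D i x)%R)%E.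
Proof.
move=> filtF DF DLp Dc.
have smD i : strongly_measurable measurable (D i).
  by apply: (strongly_measurable_sub _ (DF i)); case: (filtF i.+1).
have sM := @measurable_sigma_algebra d T.
set h1 := (fun x => \sum_(0 <= i < r) (-1) ^+ sg i *: D i x).
set h2 := (fun x => \sum_(0 <= i < r) D i x).
have s1 : strongly_measurable measurable h1.
  apply: strongly_measurable_sum => j; apply: strongly_measurableZ => //.
  exact: fibered_cst.
have s2 : strongly_measurable measurable h2 by exact: strongly_measurable_sum.
apply/lee_addgt0Pr => e e0.
(* One error [eta] arises on the left and one, multiplied by [Q], on the right. *)
pose eta := e / (Q + 1).
have Q1 : 0 < Q + 1 by rewrite ltr_wpDl.
have eta0 : 0 < eta by rewrite divr_gt0.
have etap0 : 0 < eta `^ p by rewrite powR_gt0.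
have FT : F 0%N setT.
  have [[F0 FC _] _ _] := filtF 0%N.
  by rewrite -(setD0 setT); exact: FC.
have [t [f [g [wft sf sg' model [e1 e2]]]]] :=
  @martingale_tree R X d T P p p1 F r sg D filtF DF DLp Dc r 0%N setT _ (add0n r) FT etap0.
have smf := strongly_measurable_simple sf.
have smg := strongly_measurable_simple sg'.
have PT : P setT = 1%E by exact: probability_setT.
have Nf : Np P p f = (\sum_(b <- leaves t) lprob b * `|lfst b| `^ p)%:E.
  have := model (fun a _ => `|a| `^ p) (fun a _ => powR_ge0 _ _) 0 0.
  rewrite PT mul1e tree_meanE; under eq_bigr do rewrite add0r.
  by move=> ->; apply: eq_integral => x _; rewrite add0r.
have Ng : Np P p g = (\sum_(b <- leaves t) lprob b * `|lsnd b| `^ p)%:E.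
  have := model (fun _ c => `|c| `^ p) (fun _ c => powR_ge0 _ _) 0 0.
  rewrite PT mul1e tree_meanE; under eq_bigr do rewrite add0r.
  by move=> ->; apply: eq_integral => x _; rewrite add0r.
have fg : (LpX_norm P p f <= Q%:E * LpX_norm P p g)%E.
  have Ng0 := Np_ge0 P p g; have Nf0 := Np_ge0 P p f.
  rewrite !LpX_normE Nf Ng; rewrite Nf lee_fin in Nf0; rewrite Ng lee_fin in Ng0.
  rewrite !poweR_EFin -EFinM lee_fin.
  have -> : Q = (Q `^ p) `^ p^-1 by rewrite -powRrM mulfV ?gt_eqF// powRr1.
  rewrite -powRM ?powR_ge0// ge0_ler_powR ?nnegrE ?invr_ge0 ?(ltW p0)//.
    by rewrite mulr_ge0 ?powR_ge0.
  exact: tree_bound.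
have close (h u : T -> X) : strongly_measurable measurable h -> strongly_measurable measurable u ->
    (Np P p (fun x => h x - u x)%R <= (eta `^ p)%:E)%E ->
    (LpX_norm P p h <= LpX_norm P p u + eta%:E)%E.
  move=> sh su H; apply: (le_trans (LpX_triangle P p1 sh su)).
  by apply: leeD => //; apply: LpX_norm_le => //; exact: ltW.
apply: (@le_trans _ _ (LpX_norm P p f + eta%:E)%E).
  apply: (close h1 f s1 smf); apply: le_trans e1.
  by rewrite le_eqVlt; apply/orP; left; apply/eqP/eq_integral => x _; rewrite distrC.
apply: (@le_trans _ _ (Q%:E * (LpX_norm P p h2 + eta%:E) + eta%:E)%E).
  apply: leeD => //; apply: (le_trans fg); apply: lee_wpmul2l; first by rewrite lee_fin.
  exact: (close g h2 smg s2 e2).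
rewrite ge0_muleDr ?lee_fin ?(ltW eta0) ?LpX_norm_ge0//.
rewrite -addeA; apply: leeD => //.
rewrite -EFinM -EFinD lee_fin le_eqVlt; apply/orP; left; apply/eqP.
by rewrite /eta; field; rewrite gt_eqF.
Qed.

End tree_models.

Lemma UMD_bound_of_trees (R : realType) (X : completeNormedModType R) (p Q : R) :
  1 < p -> 0 <= Q ->
  (forall t : tree X, wf_tree t ->
    \sum_(b <- leaves t) lprob b * `|lfst b| `^ p <=
    Q `^ p * \sum_(b <- leaves t) lprob b * `|lsnd b| `^ p) ->
  UMD_bound p X Q.
Proof.
move=> p1 Q0 H d T P r sigma D r0 sigs [F [filtF HD]].
have p0 : 0 < p by exact: lt_trans p1.
(* [martingale_bound] takes sequences indexed by all natural numbers: from [r] on the sign is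
   positive and the difference is 0. *)
pose sg (j : nat) := if insub j is Some o then sigma o == -1 else false.
pose D' (j : nat) (x : T) : X := if insub j is Some o then D o x else 0.
have sgE (i : 'I_r) : (-1) ^+ sg i = sigma i.
  rewrite /sg valK; case: (sigs i) => ->; last by rewrite eqxx expr1.
  by rewrite eq_sym lt_eqF ?expr0// (@lt_trans _ _ 0)// oppr_lt0.
have D'E (i : 'I_r) : D' i = D i by apply/funext => x; rewrite /D' valK.
have D'0 j : ~~ (j < r)%N -> D' j = cst 0.
  by move=> jr; apply/funext => x; rewrite /D' insubF// (negbTE jr).
have := @martingale_bound R X p Q p1 Q0 H d T P F r sg D' filtF.
have -> : (fun x => \sum_(0 <= i < r) (-1) ^+ sg i *: D' i x) =
    (fun x => \sum_(i < r) sigma i *: D i x).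
  by apply/funext => x; rewrite big_mkord; apply: eq_bigr => i _; rewrite sgE D'E.
have -> : (fun x => \sum_(0 <= i < r) D' i x) = (fun x => \sum_(i < r) D i x).
  by apply/funext => x; rewrite big_mkord; apply: eq_bigr => i _; rewrite D'E.
apply.
- move=> i; have [ir|ir] := boolP (i < r)%N.
    by rewrite (D'E (Ordinal ir)); case: (HD (Ordinal ir)).
  rewrite D'0//; apply: strongly_measurable_simple.
  by apply: (@fibered_cst _ _ X); case: (filtF i.+1).
- move=> i; have [ir|ir] := boolP (i < r)%N.
    rewrite (D'E (Ordinal ir)); case: (HD (Ordinal ir)) => -[_ fin] _ _.
    by rewrite -(LpX_norm_powR P p1) poweR_lty.
  rewrite D'0// /Np integral0_eq ?ltry// => x _.
  by rewrite normr0 powR0 ?gt_eqF.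
- move=> i ir A FA; rewrite (D'E (Ordinal ir)).
  have [_ _ [_ E]] := HD (Ordinal ir); exact: E.
Qed.

(* Reversing the coordinates in [F] of a wave vector changes the sign of either
   the derivatives of order [alpha j] or that of order [beta], but not of both. *)
Section reflection.
Context {R : realType} {n : nat} (F : {set 'I_n}).

Definition reflected (s : bool) : 'rV[R]_n := \row_l (if s && (l \in F) then -1 else 1).

Lemma reflected_norm s l : `|reflected s 0 l| = 1.
Proof. by rewrite mxE; case: ifP => _; rewrite ?normrN normr1. Qed.

Lemma prod_reflected s (g : 'I_n -> nat) :
  \prod_l reflected s 0 l ^+ g l = (-1) ^+ (s && odd (\sum_(l in F) g l)%N).
Proof.
under eq_bigr do rewrite mxE.
case: s => /=; last by rewrite big1// => l _; rewrite expr1n.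
rewrite signr_odd expr_sum [RHS]big_mkcond; apply: eq_bigr => l _.
by case: ifP => _; rewrite ?expr1n.
Qed.

End reflection.

Lemma UMD_bound_trivial (R : realType) (X : completeNormedModType R) (p C : R) :
  1 < p -> (forall x : X, x = 0) -> UMD_bound p X C.
Proof.
move=> p1 X0 d T P r sigma D r0 sigs HD.
have E (f : T -> X) : LpX_norm P p f = 0%E.
  have p0 : 0 < p by exact: lt_trans p1.
  rewrite LpX_normE /Np integral0_eq ?poweR0r ?poweR0e ?invr_neq0 ?gt_eqF// => x _.
  by rewrite (X0 (f x)) normr0 powR0 ?gt_eqF.
by rewrite !E mule0.
Qed.

Theorem theorem1p1 (R : realType) (X : completeNormedModType R) (p : R)
    (hp : 1 < p) (n N : nat) (hn : (1 <= n)%N) (hN : (1 <= N)%N)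
    (beta : 'I_n -> nat) (alpha : 'I_N -> 'I_n -> nat)
    (hdeg : forall j : 'I_N, mdeg (alpha j) = mdeg beta)
    (hparity : exists F : {set 'I_n},
      (forall j k : 'I_N, odd (\sum_(l in F) alpha j l)%N
                        = odd (\sum_(l in F) alpha k l)%N) /\
      (forall j : 'I_N, odd (\sum_(l in F) alpha j l)%N
                     <> odd (\sum_(l in F) beta l)%N))
    (K : R)
    (hK : forall u : 'rV[R]_n -> X, smooth_compact_support u ->
      (LpRn_norm p (mpartial beta u)
        <= K%:E * \sum_(j < N) LpRn_norm p (mpartial (alpha j) u))%E) :
  is_UMD X /\ (UMD_constant p X <= (K * N%:R)%:E)%E.
Proof.
(* A first coordinate must exist for the integration by parts. *)
case: n hn beta alpha hdeg hparity hK => // n _ beta alpha hdeg [F [Fa Fb]] hK.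
suff : UMD_bound p X (K * N%:R).
  move=> H; split; first by exists p; split=> //; exists (K * N%:R).
  by apply: ereal_inf_lbound; exists (K * N%:R).
pose gam (j : option 'I_N) := if j is Some k then alpha k else beta.
pose kind (j : option 'I_N) := ~~ isSome j.
pose j0 := Ordinal hN.
pose ea := odd (\sum_(l in F) alpha j0 l)%N.
have ob : odd (\sum_(l in F) beta l)%N = ~~ ea.
  by have := Fb j0; rewrite -/ea; case: ea; case: odd.
pose v := @reflected R n.+1 F.
(* On reflected waves all orders [alpha j] have the sign given by [ea] and [beta] has the opposite
   one; the factor [tau] turns these into 1 and -1. *)
pose tau (s : bool) : R := (-1) ^+ (s && ea).
have degm j : mdeg (gam j) = mdeg beta by case: j.
have tauv j s : tau s * \prod_i v s 0 i ^+ gam j i = if kind j then (-1) ^+ s else 1.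
  rewrite prod_reflected -signr_addb; case: j => [j|] /=.
    by rewrite (Fa j j0) addbb.
  by rewrite ob; case: s; case: (ea).
have v1 s : `|v s 0 ord0| = 1 by exact: reflected_norm.
have tree_bound (C : R) (C0 : 0 <= C) (HC : forall u : 'rV[R]_n.+1 -> X, smooth_compact_support u ->
      (LpRn_norm p (mpartial beta u) <= C%:E * \sum_(j < N) LpRn_norm p (mpartial (alpha j) u))%E) :=
  @tree_inequality R X n N p _ kind gam _ v tau hp degm tauv v1 None Some C erefl (fun _ => erefl) C0 HC.
have [K0|K0] := leP 0 K.
  by apply: UMD_bound_of_trees => //; [rewrite mulr_ge0|exact: tree_bound].
apply: UMD_bound_trivial => // x.
have hK0 (u : 'rV[R]_n.+1 -> X) : smooth_compact_support u ->
    (LpRn_norm p (mpartial beta u) <= 0%:E * \sum_(j < N) LpRn_norm p (mpartial (alpha j) u))%E.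
  move=> su; rewrite mul0e; apply: (le_trans (hK u su)).
  by apply: mule_le0_ge0; [rewrite lee_fin ltW|apply: sume_ge0 => j _; exact: Lnorm_ge0].
have p0 : 0 < p by exact: lt_trans hp.
have half : 0 <= (2^-1 : R) <= 1 by rewrite invr_ge0 ler0n invf_le1 ?ler1n ?ltr0n.
(* One fair step, to [x / 2] or [- x / 2]: with constant 0 its signed moment must vanish, although
   it is positive unless [x = 0]. *)
pose t : tree X := Node 2^-1 false x Leaf Leaf.
have wft : wf_tree t by rewrite /= half.
have := tree_bound 0 (lexx 0) hK0 t wft.
rewrite mul0r powR0 ?gt_eqF// mul0r.
have -> : \sum_(b <- leaves t) lprob b * `|lfst b| `^ p = tree_mean (fun a _ => `|a| `^ p) t 0 0.
  by rewrite tree_meanE; apply: eq_bigr => b _; rewrite add0r.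
rewrite /= !add0r expr0 !mul1r => H.
have [//|x0] := eqVneq x 0.
have nx : 0 < `|(1 - 2^-1) *: x| `^ p.
  by rewrite powR_gt0// normr_gt0 scaler_eq0 negb_or x0 andbT subr_eq0 eq_sym invr_eq1 (eqr_nat _ 2 1).
have : 0 < 2^-1 * `|(1 - 2^-1) *: x| `^ p + (1 - 2^-1) * `|- 2^-1 *: x| `^ p.
  rewrite ltr_pwDl ?mulr_gt0 ?invr_gt0 ?ltr0n//.
  by rewrite mulr_ge0 ?powR_ge0// subr_ge0; case/andP: half.
by move=> /lt_le_trans /(_ H); rewrite ltxx.
Qed.
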